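(* There exists a polynomial-time $(1-1/e)$-approximation algorithm for the Max-WRAC problem restricted to instances whose supporting graph is a star; i.e., it outputs a representation whose total profit is at least $(1-1/e)$ times the maximum possible total profit.
   Context: A box is an axis-aligned rectangle with a fixed width and height. A representation of boxes $B_1,\dots,B_n$ places each box (by translation) in the plane so that the interiors of the boxes are pairwise disjoint; two boxes touch if they have a common boundary. In the Max-WRAC problem the input is $n$ boxes and, for each unordered pair $\{i,j\}$, a non-negative profit $p_{ij}$; the supporting graph has an edge $\{B_i,B_j\}$ exactly when $p_{ij}>0$. The total profit of a representation is the sum of $p_{ij}$ over all touching pairs, and the task is to find a representation of maximum total profit. *)

(* Defs.v *)
From Stdlib Require Import BinNums BinNat Rdefinitions Rtrigo_def.
From mathcomp Require Import all_boot all_order all_algebra.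
From mathcomp Require Import Rstruct.
Set Implicit Arguments. Unset Strict Implicit. Unset Printing Implicit Defensive.
Import Order.TTheory GRing.Theory Num.Theory.

(* An instance on n boxes: widths w, heights h (positive rationals) and
   profits p (non-negative rationals, symmetric; p i j is the profit of
   the unordered pair {i,j}, only entries with i < j are used).        *)

Definition valid_instance (n : nat) (w h : 'I_n -> rat)
    (p : 'I_n -> 'I_n -> rat) : Prop :=
  [/\ forall i, (0 < w i)%R, forall i, (0 < h i)%R,
      forall i j, (0 <= p i j)%R & forall i j, p i j = p j i].

Definition star_support (n : nat) (p : 'I_n -> 'I_n -> rat) : Prop :=
  exists c : 'I_n, forall i j : 'I_n, i != j ->
    ((0 < p i j)%R <-> (i == c) || (j == c)).

Local Open Scope ring_scope.

(* A placement: box i is the closed rectangle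
   [x_i, x_i + w_i] x [y_i, y_i + h_i], where pos i = (x_i, y_i). *)
Section Placement.
Variables (n : nat) (w h : 'I_n -> rat) (pos : 'I_n -> R * R).
Let X i := (pos i).1.
Let Y i := (pos i).2.
Let W i : R := ratr (w i).
Let H i : R := ratr (h i).

Definition interiors_disjoint (i j : 'I_n) : bool :=
  [|| X i + W i <= X j, X j + W j <= X i,
      Y i + H i <= Y j | Y j + H j <= Y i].

Definition is_representation : Prop :=
  forall i j : 'I_n, i != j -> interiors_disjoint i j.

(* boxes i and j touch: they share a boundary segment of positive length *)
Definition touch (i j : 'I_n) : bool :=
  ((X i + W i == X j) || (X j + W j == X i)) &&
     ((Y i < Y j + H j) && (Y j < Y i + H i))
  || ((Y i + H i == Y j) || (Y j + H j == Y i)) &&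
     ((X i < X j + W j) && (X j < X i + W i)).

End Placement.

Definition total_profit (n : nat) (w h : 'I_n -> rat)
    (p : 'I_n -> 'I_n -> rat) (pos : 'I_n -> R * R) : R :=
  \sum_(i : 'I_n) \sum_(j : 'I_n | (i < j)%N && touch w h pos i j) ratr (p i j).

Fixpoint pos_bits (q : positive) : seq bool :=
  match q with
  | xH => [:: true]
  | xO q' => false :: pos_bits q'
  | xI q' => true :: pos_bits q'
  end.

(* binary (LSB first); every bit b is written as [false; b];
   the number is terminated by [true; true] *)
Definition enc_nat (m : nat) : seq bool :=
  let bits := match N.of_nat m with N0 => [::] | Npos q => pos_bits q end in
  flatten [seq [:: false; b] | b <- bits] ++ [:: true; true].

Definition enc_int (z : int) : seq bool :=
  match z with
  | Posz m => [:: false; false] ++ enc_nat m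
  | Negz m => [:: false; true] ++ enc_nat m
  end.

Definition enc_rat (q : rat) : seq bool :=
  enc_int (numq q) ++ enc_nat (absz (denq q)).

Definition enc_instance (n : nat) (w h : 'I_n -> rat)
    (p : 'I_n -> 'I_n -> rat) : seq bool :=
  enc_nat n
  ++ flatten [seq enc_rat (w i) ++ enc_rat (h i) | i <- enum 'I_n]
  ++ flatten [seq enc_rat (p ij.1 ij.2)
               | ij <- enum [pred ij : 'I_n * 'I_n | (ij.1 < ij.2)%N]].

Definition enc_placement (n : nat) (pos : 'I_n -> rat * rat) : seq bool :=
  flatten [seq enc_rat (pos i).1 ++ enc_rat (pos i).2 | i <- enum 'I_n].

Definition ratr2 (n : nat) (pos : 'I_n -> rat * rat) : 'I_n -> R * R :=
  fun i => (ratr (pos i).1, ratr (pos i).2).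

Inductive dir := GoL | GoR | Stay.

Record TM := {
  tm_nstates : nat;
  tm_start : 'I_tm_nstates;
  (* None = halt *)
  tm_delta : 'I_tm_nstates -> option bool ->
             option ('I_tm_nstates * option bool * dir)
}.

(* configuration: state, tape left of head (nearest first), head cell,
   tape right of head (nearest first); cells beyond the lists are blank *)
Record config (M : TM) := Config {
  cf_state : 'I_(tm_nstates M);
  cf_left : seq (option bool);
  cf_head : option bool;
  cf_right : seq (option bool)
}.

Definition tm_init (M : TM) (inp : seq bool) : config M :=
  match inp with
  | [::] => Config (tm_start M) [::] None [::]
  | b :: bs => Config (tm_start M) [::] (Some b) (map Some bs)
  end.

Definition tm_halted (M : TM) (c : config M) : bool :=
  if tm_delta (cf_state c) (cf_head c) is None then true else false.

Definition tm_step (M : TM) (c : config M) : config M :=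
  match tm_delta (cf_state c) (cf_head c) with
  | None => c
  | Some (q, a, d) =>
      match d with
      | Stay => Config q (cf_left c) a (cf_right c)
      | GoL => match cf_left c with
               | [::] => Config q [::] None (a :: cf_right c)
               | x :: l => Config q l x (a :: cf_right c)
               end
      | GoR => match cf_right c with
               | [::] => Config q (a :: cf_left c) None [::]
               | x :: r => Config q (a :: cf_left c) x r
               end
      end
  end.

Definition tm_run (M : TM) (t : nat) (c : config M) : config M :=
  iter t (@tm_step M) c.

Fixpoint read_bits (s : seq (option bool)) : seq bool :=
  match s with
  | Some b :: s' => b :: read_bits s'
  | _ => [::]
  end.

Definition tm_output (M : TM) (c : config M) : seq bool :=
  read_bits (cf_head c :: cf_right c).

Definition tm_computes_in (M : TM) (inp : seq bool) (t : nat)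
    (out : seq bool) : Prop :=
  tm_halted (tm_run t (tm_init M inp)) /\
  tm_output (tm_run t (tm_init M inp)) = out.

Definition one_minus_inv_e : R := 1 - (exp 1)^-1.

(* Main.v *)
(* In a representation of a star the leaves touching the centre are distributed over its four
   sides; at most one leaf sticks out over each corner and needs only an arbitrarily short piece
   of a side, and the remaining leaves of a side have total length at most (strictly less than,
   if a leaf sticks out) the length of the side.  Hence the problem is a knapsack problem with
   four bins.  Guess the 27 most profitable leaves of an optimal solution together with their
   positions, and let the other leaves compete only if they are not more profitable.  Sorting
   the remaining leaves of the optimum by width/height, an exchange argument shows that, up to
   the loss of one leaf t, those before t can be put on the horizontal sides and those after t on
   the vertical ones.  For each orientation, filling the two sides greedily by profit density
   loses two more leaves.  With the corners at most 9 leaves are lost, each worth at most 1/27 of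
   the guessed ones, which gives the ratio 2/3 >= 1 - 1/e.  All of this is determined by the
   guessed leaves and the 5 lost ones, so the algorithm enumerates these tuples and keeps the
   best feasible assignment.

   Polynomial time is obtained compositionally.  The data are binary trees in prefix code, kept
   on a stack; four such stacks are interleaved on the tape of a machine generated from a
   structured program.  A function is shown to be polynomial-time by closure under composition,
   pairing, conditionals and folds whose accumulator has polynomial size. *)

Require Import Defs.
From Stdlib Require Import BinNums BinNat ZArith Lia FunctionalExtensionality.
From Stdlib Require Import Rdefinitions Rtrigo_def Exp_prop Rpower.
From mathcomp Require Import all_boot all_order all_algebra.
From mathcomp Require Import zify lra Rstruct.
Set Implicit Arguments. Unset Strict Implicit. Unset Printing Implicit Defensive.
Import Order.TTheory GRing.Theory Num.Theory.
Delimit Scope Z_scope with ZZ.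

(** * Structured tape programs and their Turing machines *)

(** The four bins are not of one kind: a leaf consumes its width on a horizontal side and its height
    on a vertical one, so no single density order serves all of them. Cutting in the order of
    width/height separates the two kinds. The cut must be applied to the whole pool of unguessed
    leaves, since the algorithm does not know which of them the optimum uses; this is harmless,
    because in each half the greedy filling is compared with all subsets of that half. An optimal
    representation may have real coordinates. Only inequalities between sums of box lengths are
    extracted from it. After clearing denominators with an additional factor 2 they relate even
    integers, so a strict inequality leaves 2 units, one for each end of a side. Running times are
    counted in stack operations. Unlike the number of machine steps, this count does not depend on
    what lies deeper on the stacks, and it therefore adds up under composition. *)

Definition cell := option bool.
Definition tape := Z -> cell.
Definition upd (f : tape) (z : Z) (a : cell) : tape :=
  fun y => if Z.eqb y z then a else f y.
Definition dirZ (d : dir) : Z :=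
  match d with GoL => -1 | GoR => 1 | Stay => 0 end%ZZ.

Inductive tp :=
  | Mv of dir
  | Wr of cell
  | Sq of tp & tp
  | If3 of tp & tp & tp
  | Wh of tp.

Inductive exec : tp -> tape -> Z -> tape -> Z -> nat -> Prop :=
  | exec_mv d f z : exec (Mv d) f z f (z + dirZ d)%ZZ 1
  | exec_wr a f z : exec (Wr a) f z (upd f z a) z 1
  | exec_sq p q f z f1 z1 f2 z2 t1 t2 :
      exec p f z f1 z1 t1 -> exec q f1 z1 f2 z2 t2 ->
      exec (Sq p q) f z f2 z2 (t1 + t2)
  | exec_if p0 p1 p2 f z f1 z1 t :
      exec (match f z with None => p0 | Some false => p1 | Some true => p2 end)
        f z f1 z1 t ->
      exec (If3 p0 p1 p2) f z f1 z1 t.+1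
  | exec_wh0 p f z : f z = None -> exec (Wh p) f z f z 1
  | exec_wh1 p f z f1 z1 f2 z2 t1 t2 :
      f z <> None -> exec p f z f1 z1 t1 -> exec (Wh p) f1 z1 f2 z2 t2 ->
      exec (Wh p) f z f2 z2 (t1 + t2).+1.

Fixpoint tsize (p : tp) : nat :=
  match p with
  | Mv _ | Wr _ => 1
  | Sq p q => tsize p + tsize q
  | If3 p q r => (tsize p + tsize q + tsize r).+1
  | Wh p => (tsize p).+1
  end.

(* The code of [p] occupies the states [k, k + tsize p) and exits to [e]. *)
Fixpoint tdelta (p : tp) (k e q : nat) (a : cell) : nat * cell * dir :=
  match p with
  | Mv d => (e, a, d)
  | Wr b => (e, b, Stay)
  | Sq p1 p2 =>
      let k2 := k + tsize p1 in
      if q < k2 then tdelta p1 k k2 q a else tdelta p2 k2 e q a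
  | If3 p0 p1 p2 =>
      let k0 := k.+1 in let k1 := k0 + tsize p0 in let k2 := k1 + tsize p1 in
      if q == k then
        (match a with None => k0 | Some false => k1 | Some true => k2 end, a, Stay)
      else if q < k1 then tdelta p0 k0 e q a
      else if q < k2 then tdelta p1 k1 e q a
      else tdelta p2 k2 e q a
  | Wh p1 =>
      if q == k then (match a with None => e | Some _ => k.+1 end, a, Stay)
      else tdelta p1 k.+1 k q a
  end.

Lemma tsize_gt0 p : 0 < tsize p.
Proof. by elim: p => //= p1 H1 p2 H2; rewrite addn_gt0 H1. Qed.

Lemma tdelta_lt p k e q a N :
  k <= q < k + tsize p -> k + tsize p <= N -> e < N -> (tdelta p k e q a).1.1 < N.
Proof.
elim: p k e q a N => [d|b|p1 H1 p2 H2|p0 H0 p1 H1 p2 H2|p1 H1] k e q a N //= hq hN he.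
- have h2 := tsize_gt0 p2.
  case: ifP => h; [apply: H1; lia|apply: H2; lia].
- have h0 := tsize_gt0 p0; have h1 := tsize_gt0 p1; have h2 := tsize_gt0 p2.
  case: eqP => h; first by case: a => [[]|] /=; lia.
  case: ifP => h3; first by apply: H0; lia.
  by case: ifP => h4; [apply: H1; lia|apply: H2; lia].
- have h1 := tsize_gt0 p1.
  case: eqP => h; first by case: a => [[]|] /=; lia.
  by apply: H1; lia.
Qed.

(** * Runs of the compiled machine *)

Definition ncfg := (nat * tape * Z)%type.
Definition nstep (D : nat -> cell -> nat * cell * dir) (c : ncfg) : ncfg :=
  let: (q, f, z) := c in
  let: (q', a, d) := D q (f z) in (q', upd f z a, (z + dirZ d)%ZZ).

Lemma upd_id f z : upd f z (f z) = f.
Proof.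
by apply: functional_extensionality => y; rewrite /upd; case: Z.eqb_spec => // ->.
Qed.

(** [D] has to agree with the code of [p] only on the states of [p], so the induction applies to a
    piece of a larger program. The second conjunct keeps the run inside these states until the exit:
    the exit state of the whole program is the halting one, so the machine cannot stop early. *)
Lemma exec_nstep p f z f' z' t :
  exec p f z f' z' t -> forall D k e,
  (forall q a, k <= q < k + tsize p -> D q a = tdelta p k e q a) ->
  iter t (nstep D) (k, f, z) = (e, f', z') /\
  forall s, s < t -> k <= (iter s (nstep D) (k, f, z)).1.1 < k + tsize p.
Proof.
elim=> {p f z f' z' t} /=.
- move=> d f z D k e HD; split; first by rewrite /nstep HD ?upd_id //; lia.
  by case=> //= _; lia.
- move=> a f z D k e HD; split; first by rewrite /nstep HD ?Z.add_0_r //; lia.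
  by case=> //= _; lia.
- move=> p q f z f1 z1 f2 z2 t1 t2 _ IH1 _ IH2 D k e HD.
  have h1 := tsize_gt0 p; have h2 := tsize_gt0 q.
  have [r a hr|E1 R1] := IH1 D k (k + tsize p).
    by rewrite HD; [rewrite ifT //; lia | lia].
  have [r a hr|E2 R2] := IH2 D (k + tsize p) e.
    by rewrite HD; [rewrite ifF //; lia | lia].
  rewrite addnC iterD E1; split=> // s hs.
  case: (ltnP s t1) => h; first by have := R1 s h; lia.
  by rewrite -(subnK h) iterD E1; have := R2 (s - t1); lia.
- move=> p0 p1 p2 f z f1 z1 t _ IH D k e HD.
  have h0 := tsize_gt0 p0; have h1 := tsize_gt0 p1; have h2 := tsize_gt0 p2.
  have S1 : nstep D (k, f, z) = (match f z with None => k.+1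
      | Some false => k.+1 + tsize p0 | Some true => k.+1 + tsize p0 + tsize p1 end, f, z).
    by rewrite /nstep HD; [rewrite eqxx upd_id Z.add_0_r | lia].
  rewrite -iterS iterSr S1; case E: (f z) IH S1 => [[]|] IH S1.
  + have [q a hq|E1 R1] := IH D (k.+1 + tsize p0 + tsize p1) e.
      rewrite HD; last by lia.
      by do 3 (rewrite ifF; last by lia).
    by split=> // -[|s] hs; [rewrite /=; lia | rewrite iterSr S1; move: _.1.1 (R1 s hs) => m; lia].
  + have [q a hq|E1 R1] := IH D (k.+1 + tsize p0) e.
      rewrite HD; last by lia.
      by do 2 (rewrite ifF; last by lia); rewrite ifT //; lia.
    by split=> // -[|s] hs; [rewrite /=; lia | rewrite iterSr S1; move: _.1.1 (R1 s hs) => m; lia].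
  + have [q a hq|E1 R1] := IH D k.+1 e.
      rewrite HD; last by lia.
      by rewrite ifF; [rewrite ifT //; lia | lia].
    by split=> // -[|s] hs; [rewrite /=; lia | rewrite iterSr S1; move: _.1.1 (R1 s hs) => m; lia].
- move=> p f z fz D k e HD; split; last by case=> //= _; lia.
  rewrite /nstep HD; last by lia.
  by rewrite eqxx upd_id fz Z.add_0_r.
- move=> p f z f1 z1 f2 z2 t1 t2 fz _ IH1 _ IH2 D k e HD.
  have S1 : nstep D (k, f, z) = (k.+1, f, z).
    rewrite /nstep HD; last by lia.
    by rewrite eqxx upd_id Z.add_0_r; case: (f z) fz.
  have [q a hq|E1 R1] := IH1 D k.+1 k.
    by rewrite HD; [rewrite ifF //; lia | lia].
  have [E2 R2] := IH2 D k e HD.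
  rewrite -iterS iterSr S1 addnC iterD E1; split=> // -[|s] hs; first by rewrite /=; lia.
  rewrite iterSr S1; case: (ltnP s t1) => h; first by move: _.1.1 (R1 s h) => m; lia.
  by rewrite -(subnK h) iterD E1; apply: R2; lia.
Qed.

Definition tp_TM (p : tp) : TM :=
  {| tm_nstates := (tsize p).+1;
     tm_start := ord0;
     tm_delta := fun q a =>
       if q == tsize p :> nat then None
       else let: (q', b, d) := tdelta p 0 (tsize p) q a in Some (inord q', b, d) |}.

(** Comparing through [nth None] identifies lists that differ by trailing blanks. *)
Definition repr (M : TM) (c : config M) (n : ncfg) : Prop :=
  let: (q, f, z) := n in
  [/\ cf_state c = q :> nat, cf_head c = f z,
      forall i : nat, nth None (cf_left c) i = f (z - 1 - Z.of_nat i)%ZZ &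
      forall i : nat, nth None (cf_right c) i = f (z + 1 + Z.of_nat i)%ZZ].

Lemma repr_step p (c : config (tp_TM p)) q f z :
  repr c (q, f, z) -> q < tsize p ->
  repr (tm_step c) (nstep (tdelta p 0 (tsize p)) (q, f, z)).
Proof.
case: c => s l h r [/= hs hh hl hr] hq.
rewrite /tm_step /= hs ifF; last by lia.
rewrite hh; case E: tdelta => [[q' b] d].
have hq' : q' < (tsize p).+1.
  by have := @tdelta_lt p 0 (tsize p) q (f z) (tsize p).+1; rewrite E /=; apply; lia.
case: d E => E; rewrite /repr /nstep /=.
- case: l hl => [|x l] hl; split=> /=; rewrite ?inordK // /upd.
  + rewrite ifF; [have /= := hl 0 => -> | lia]; congr f; lia.
  + move=> i; rewrite nth_nil ifF; last by lia.
    have := hl i.+1; rewrite /= => e.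
    by rewrite (_ : (_ - _ - _)%ZZ = (z - 1 - Z.of_nat i.+1)%ZZ) -?e //; lia.
  + case=> [|i] /=; first by rewrite ifT //; lia.
    by rewrite hr ifF; [congr f; lia | lia].
  + rewrite ifF; [have /= := hl 0 => -> | lia]. congr f; lia.
  + by move=> i; have /= -> := hl i.+1; rewrite ifF; [congr f; lia | lia].
  + case=> [|i] /=; first by rewrite ifT //; lia.
    by rewrite hr ifF; [congr f; lia | lia].
- case: r hr => [|x r] hr; split=> /=; rewrite ?inordK // /upd.
  + rewrite ifF; [have /= := hr 0 => -> | lia]. congr f; lia.
  + case=> [|i] /=; first by rewrite ifT //; lia.
    by rewrite hl ifF; [congr f; lia | lia].
  + move=> i; rewrite nth_nil ifF; last by lia.
    have := hr i.+1; rewrite /= => e.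
    by rewrite (_ : (_ + _ + _)%ZZ = (z + 1 + Z.of_nat i.+1)%ZZ) -?e //; lia.
  + rewrite ifF; [have /= := hr 0 => -> | lia]. congr f; lia.
  + case=> [|i] /=; first by rewrite ifT //; lia.
    by rewrite hl ifF; [congr f; lia | lia].
  + by move=> i; have /= -> := hr i.+1; rewrite ifF; [congr f; lia | lia].
- split=> /=; rewrite ?inordK // /upd ?Z.add_0_r ?Z.eqb_refl // => i.
  + by rewrite hl ifF //; lia.
  + by rewrite hr ifF //; lia.
Qed.

Lemma tp_TM_run p (c : config (tp_TM p)) f z f' z' t :
  exec p f z f' z' t -> repr c (0, f, z) ->
  repr (tm_run t c) (tsize p, f', z').
Proof.
move=> X Hc; set D := tdelta p 0 (tsize p).
have HD : forall q a, 0 <= q < 0 + tsize p -> D q a = tdelta p 0 (tsize p) q a by [].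
have [<- R] := exec_nstep X HD.
have : t <= t by [].
elim: {-2}t => [|s IH] hs //.
have := IH (ltnW hs); rewrite /tm_run !iterS.
have := R s hs; by case: (iter s _ (0, f, z)) => [[q g] y] hq Hr; exact: (repr_step Hr).
Qed.

(** The start cell may be given any address [o]; the choice 5 will make the input coincide with
    stack 4. *)
Definition input_tape (inp : seq bool) (o : Z) : tape := fun y =>
  if (y <? o)%ZZ then None else nth None (map Some inp) (Z.to_nat (y - o)%ZZ).

Lemma repr_init p inp o :
  repr (tm_init (tp_TM p) inp) (0, input_tape inp o, o).
Proof.
have H0 : forall i : nat, input_tape inp o (o - 1 - Z.of_nat i)%ZZ = None.
  by move=> i; rewrite /input_tape ifT //; lia.
case: inp H0 => [|b inp] H0; split=> //=.
- by rewrite /input_tape nth_nil; case: ifP.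
- by move=> i; rewrite H0 nth_nil.
- by move=> i; rewrite /input_tape !nth_nil; case: ifP.
- by rewrite /input_tape ifF ?Z.sub_diag //; lia.
- by move=> i; rewrite H0 nth_nil.
- move=> i; rewrite /input_tape ifF; last by lia.
  by rewrite (_ : Z.to_nat _ = i.+1) //; lia.
Qed.

Lemma read_bits_nth s out :
  (forall i, nth None s i = nth None (map Some out) i) -> read_bits s = out.
Proof.
elim: s out => [|a s IH] [|b out] //= H.
- by have := H 0.
- by have /= -> := H 0.
- have /= -> := H 0; congr cons; apply: IH => i; exact: (H i.+1).
Qed.

Lemma tp_TM_computes p inp out o f' z' t :
  exec p (input_tape inp o) o f' z' t ->
  (forall i : nat, f' (z' + Z.of_nat i)%ZZ = nth None (map Some out) i) ->
  tm_computes_in (tp_TM p) inp t out.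
Proof.
move=> X Hout; have [hs hh _ hr] := tp_TM_run X (repr_init p inp o).
split; first by rewrite /tm_halted /= hs eqxx.
apply: read_bits_nth => -[|i] /=; rewrite ?hh ?hr -Hout; congr f'; lia.
Qed.

(** * Stacks on the tape *)

Record stks := St { sS : seq bool; sA : seq bool; sB : seq bool;
                    sC : seq bool; sR : seq bool }.

Definition sget (s : stks) (j : nat) : seq bool :=
  match j with 0 => sS s | 1 => sA s | 2 => sB s | 3 => sC s | _ => sR s end.
Definition sset (s : stks) (j : nat) (l : seq bool) : stks :=
  let: St a b c d e := s in
  match j with
  | 0 => St l b c d e | 1 => St a l c d e | 2 => St a b l d e
  | 3 => St a b c l e | _ => St a b c d l end.
Definition hsum (s : stks) : nat :=
  size (sS s) + size (sA s) + size (sB s) + size (sC s) + size (sR s).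

(** Position 0 is the bottom of the stack, so that a push leaves the other cells in place; the list
    starts at the top, hence [rev]. *)
Definition cell_of (l : seq bool) (p : nat) : cell := nth None (map Some (rev l)) p.

(* Stacks are listed from the top.  Stacks 0-3 are interleaved leftwards from cell 0; stack 4
   extends rightwards from cell 5.  Cells 1-4 stay blank, so that walking a stack towards its
   bottom always stops at a blank cell whose address is known. *)
Definition tape_of (s : stks) : tape := fun z =>
  if (5 <=? z)%ZZ then cell_of (sget s 4) (Z.to_nat (z - 5)%ZZ)
  else if (z <=? 0)%ZZ then
    cell_of (sget s (Z.to_nat ((- z) mod 4)%ZZ)) (Z.to_nat ((- z) / 4)%ZZ)
  else None.

Definition base (j : nat) : Z := if j < 4 then (- Z.of_nat j)%ZZ else 5%ZZ.
Definition stride (j : nat) : Z := if j < 4 then (-4)%ZZ else 1%ZZ.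
Definition addr (j p : nat) : Z := (base j + stride j * Z.of_nat p)%ZZ.

Lemma tape_of_addr s j p : j <= 4 -> tape_of s (addr j p) = cell_of (sget s j) p.
Proof.
move=> hj; rewrite /tape_of /addr /base /stride.
case: (ltnP j 4) => h.
- rewrite ifF; last by lia.
  rewrite ifT; last by lia.
  have -> : (- (- Z.of_nat j + -4 * Z.of_nat p) = Z.of_nat j + Z.of_nat p * 4)%ZZ by lia.
  rewrite Z.mod_add // Z.div_add // Z.mod_small; last by lia.
  by rewrite Z.div_small ?Nat2Z.id //; lia.
- rewrite ifT; last by lia.
  have -> : j = 4 by lia.
  by have -> : Z.to_nat (5 + 1 * Z.of_nat p - 5)%ZZ = p by lia.
Qed.

Lemma tape_of_below s j : j <= 4 -> tape_of s (base j - stride j)%ZZ = None.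
Proof.
move=> hj; rewrite /tape_of /base /stride.
case: (ltnP j 4) => h //.
by rewrite ifF; [rewrite ifF //; lia | lia].
Qed.

Lemma addr_cases z :
  (exists j p, j <= 4 /\ z = addr j p) \/ (forall s, tape_of s z = None).
Proof.
have [h5|h5] := Z.leb_spec 5 z.
  left; exists 4, (Z.to_nat (z - 5)%ZZ); split=> //.
  by rewrite /addr (_ : base 4 = 5%ZZ) // (_ : stride 4 = 1%ZZ) //; lia.
have [h0|h0] := Z.leb_spec z 0; last first.
  by right=> s; rewrite /tape_of; do 2 (rewrite ifF; last by lia).
left; exists (Z.to_nat ((- z) mod 4)%ZZ), (Z.to_nat ((- z) / 4)%ZZ).
have hm := Z.mod_pos_bound (- z) 4 erefl; have hd := Z.div_mod (- z) 4.
have hq := Z.div_pos (- z) 4.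
rewrite /addr /base /stride; have -> : Z.to_nat ((- z) mod 4)%ZZ < 4 by lia.
by split; lia.
Qed.

Lemma addr_inj j p j' p' : j <= 4 -> j' <= 4 -> addr j p = addr j' p' -> j = j' /\ p = p'.
Proof.
move=> hj hj'; rewrite /addr /base /stride.
by case: (ltnP j 4) => h; case: (ltnP j' 4) => h' e; split; lia.
Qed.

Lemma sget_sset s j l j' : j <= 4 -> j' <= 4 ->
  sget (sset s j l) j' = if j' == j then l else sget s j'.
Proof.
by case: s => a b c d e; case: j => [|[|[|[|[|]]]]] //; case: j' => [|[|[|[|[|]]]]].
Qed.

Lemma hsum_sset s j l : j <= 4 -> hsum (sset s j l) + size (sget s j) = hsum s + size l.
Proof.
by case: s => a b c d e; case: j => [|[|[|[|[|]]]]] //= _; rewrite /hsum /=; lia.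
Qed.

Lemma size_sget s j : size (sget s j) <= hsum s.
Proof. by case: s => a b c d e; case: j => [|[|[|[|]]]]; rewrite /hsum /=; lia. Qed.

Lemma sset_sget s j : sset s j (sget s j) = s.
Proof. by case: s => a b c d e; case: j => [|[|[|[|]]]]. Qed.

Lemma sset_sset s j l l' : sset (sset s j l) j l' = sset s j l'.
Proof. by case: s => a b c d e; case: j => [|[|[|[|]]]]. Qed.

Lemma cell_of_cons b l p :
  cell_of (b :: l) p = if p == size l then Some b else cell_of l p.
Proof.
rewrite /cell_of rev_cons map_rcons nth_rcons size_map size_rev.
case: ltngtP => // h; by rewrite nth_default // size_map size_rev ltnW.
Qed.

Lemma cell_of_size l : cell_of l (size l) = None.
Proof. by rewrite /cell_of nth_default // size_map size_rev. Qed.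

Lemma cell_of_lt l p : p < size l -> cell_of l p <> None.
Proof.
by move=> h; rewrite /cell_of (nth_map true) // size_rev.
Qed.

Lemma upd_push s j b : j <= 4 ->
  upd (tape_of s) (addr j (size (sget s j))) (Some b) = tape_of (sset s j (b :: sget s j)).
Proof.
move=> hj; apply: functional_extensionality => z; rewrite /upd.
case: (addr_cases z) => [[j' [p [hj' ->]]]|hz]; last first.
  rewrite !hz; case: Z.eqb_spec => // e.
  have := hz (sset s j (b :: sget s j)); rewrite e tape_of_addr // sget_sset // eqxx.
  by rewrite cell_of_cons eqxx.
rewrite !tape_of_addr // sget_sset //; case: Z.eqb_spec => e.
  by case: (addr_inj hj' hj e) => -> ->; rewrite eqxx cell_of_cons eqxx.
case: eqP => ej //; rewrite cell_of_cons; case: eqP => ep; last by rewrite ej.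
by case: e; rewrite ej ep.
Qed.

Lemma upd_pop s j b l : j <= 4 -> sget s j = b :: l ->
  upd (tape_of s) (addr j (size l)) None = tape_of (sset s j l).
Proof.
move=> hj hg.
set s' := sset s j l.
have gl : sget s' j = l by rewrite sget_sset // eqxx.
have E := upd_push s' b hj; rewrite gl sset_sset -hg sset_sget in E.
rewrite -E; apply: functional_extensionality => z; rewrite /upd.
by case: Z.eqb_spec => [->|//]; rewrite tape_of_addr // gl cell_of_size.
Qed.

(** * Stack operations as tape programs *)

Definition skip := Mv Stay.
Definition go (z : Z) : tp :=
  iter (Z.abs_nat z) (Sq (Mv (if (0 <=? z)%ZZ then GoR else GoL))) skip.

Lemma exec_go z f x : exec (go z) f x f (x + z)%ZZ (Z.abs_nat z).+1.
Proof.
rewrite /go; case: (Z.leb_spec 0 z) => hz.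
- have {2}-> : z = Z.of_nat (Z.abs_nat z) by lia.
  elim: (Z.abs_nat z) x => [|n IH] x /=; first exact: exec_mv.
  rewrite -(add1n n.+1) (_ : (x + _)%ZZ = (x + dirZ GoR + Z.of_nat n)%ZZ) ?/dirZ; last by lia.
  by apply: exec_sq; [exact: exec_mv | exact: IH].
- have {2}-> : z = (- Z.of_nat (Z.abs_nat z))%ZZ by lia.
  elim: (Z.abs_nat z) x => [|n IH] x /=; first exact: exec_mv.
  rewrite -(add1n n.+1) (_ : (x + _)%ZZ = (x + dirZ GoL - Z.of_nat n)%ZZ) ?/dirZ; last by lia.
  by apply: exec_sq; [exact: exec_mv | exact: IH].
Qed.

Lemma exec_eq p f x f' x' t f2 x2 t2 :
  exec p f x f2 x2 t2 -> f2 = f' -> x2 = x' -> t2 = t -> exec p f x f' x' t.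
Proof. by move=> X <- <- <-. Qed.

(** A stride costs at most 4 moves, the closing [skip] and the loop test, hence the factor 6. *)
Lemma exec_walk_up s j p : j <= 4 -> p <= size (sget s j) ->
  exists2 t, t <= 6 * (size (sget s j) - p) + 1 &
    exec (Wh (go (stride j))) (tape_of s) (addr j p) (tape_of s) (addr j (size (sget s j))) t.
Proof.
move=> hj; move: {2}(size _ - p) (leqnn (size (sget s j) - p)) => m.
elim: m p => [|m IH] p hm hp.
  have -> : p = size (sget s j) by lia.
  exists 1; first by lia.
  apply: exec_wh0; rewrite tape_of_addr // cell_of_size //.
case: (ltnP p (size (sget s j))) => h; last first.
  have -> : p = size (sget s j) by lia.
  exists 1; first by lia. apply: exec_wh0; rewrite tape_of_addr // cell_of_size //.
have [||t ht Ht] := IH p.+1; [lia | lia|].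
exists (((Z.abs_nat (stride j)).+1 + t).+1); first by rewrite /stride; case: ifP; lia.
apply: exec_wh1 (exec_go _ _ _) _; first by rewrite tape_of_addr //; exact: cell_of_lt.
by rewrite (_ : (_ + _)%ZZ = addr j p.+1) // /addr; lia.
Qed.

Lemma exec_walk_down s j p : j <= 4 -> p <= size (sget s j) ->
  exists2 t, t <= 6 * p + 1 &
    exec (Wh (go (- stride j)%ZZ)) (tape_of s) (addr j p - stride j)%ZZ
      (tape_of s) (base j - stride j)%ZZ t.
Proof.
move=> hj; elim: p => [|p IH] hp.
  exists 1; first by lia.
  apply: exec_eq (exec_wh0 _ _) _ _ _ => //; last by rewrite /addr; lia.
  by rewrite (_ : (_ - _)%ZZ = (base j - stride j)%ZZ) ?tape_of_below // /addr; lia.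
have [|t ht Ht] := IH; first by lia.
exists (((Z.abs_nat (- stride j)).+1 + t).+1); first by rewrite /stride; case: ifP; lia.
have -> : (addr j p.+1 - stride j)%ZZ = addr j p by rewrite /addr; lia.
apply: exec_wh1 (exec_go _ _ _) _; first by rewrite tape_of_addr //; exact: cell_of_lt.
by rewrite Z.add_opp_r.
Qed.

(** A downward walk stops on the blank cell next to the bottom, at [base j - stride j]. From there
    the way back to cell 0, where the head rests between operations, has constant length. *)
Definition ret (j : nat) : tp := go (stride j - base j)%ZZ.

Definition push (j : nat) (b : bool) : tp :=
  Sq (go (base j)) (Sq (Wh (go (stride j))) (Sq (Wr (Some b))
    (Sq (Wh (go (- stride j)%ZZ)) (ret j)))).

Definition erase_ret (j : nat) : tp :=
  Sq (Wr None) (Sq (go (- stride j)%ZZ) (Sq (Wh (go (- stride j)%ZZ)) (ret j))).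

Definition pop_case (j : nat) (p0 pF pT : tp) : tp :=
  Sq (go (base j)) (Sq (Wh (go (stride j))) (Sq (go (- stride j)%ZZ)
    (If3 (Sq (ret j) p0) (Sq (erase_ret j) pF) (Sq (erase_ret j) pT)))).

Definition while_ne (j : nat) (p : tp) : tp :=
  Sq (go (base j)) (Sq (Wh (Sq (go (- base j)%ZZ) (Sq p (go (base j))))) (go (- base j)%ZZ)).

Lemma exec_ret f j :
  exec (ret j) f (base j - stride j)%ZZ f 0%ZZ (Z.abs_nat (stride j - base j)).+1.
Proof. by apply: exec_eq (exec_go _ _ _) _ _ _ => //; lia. Qed.

Lemma base_stride j : j <= 4 ->
  Z.abs_nat (base j) <= 5 /\ Z.abs_nat (stride j - base j) <= 5 /\
  Z.abs_nat (stride j) <= 4 /\ Z.abs_nat (- stride j) <= 4 /\ Z.abs_nat (- base j) <= 5.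
Proof. by rewrite /base /stride; case: ifP; lia. Qed.

Lemma exec_push s j b : j <= 4 ->
  exists2 t, t <= 64 * (size (sget s j)).+1 &
    exec (push j b) (tape_of s) 0%ZZ (tape_of (sset s j (b :: sget s j))) 0%ZZ t.
Proof.
move=> hj; have [hb [hs [ht [hn hm]]]] := base_stride hj.
have [//|t1 h1 X1] := @exec_walk_up s j 0 hj.
set s' := sset s j _.
have gs' : sget s' j = b :: sget s j by rewrite sget_sset // eqxx.
have [|t2 h2 X2] := @exec_walk_down s' j (size (sget s j)).+1 hj; first by rewrite gs'.
exists ((Z.abs_nat (base j)).+1 + (t1 + (1 + (t2 + (Z.abs_nat (stride j - base j)).+1)))).
  by lia.
apply: exec_sq (exec_go _ _ _) _; apply: exec_sq.
  by rewrite Z.add_0_l (_ : base j = addr j 0) ?/addr; [exact: X1 | lia].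
apply: exec_sq (exec_wr _ _ _) _; rewrite upd_push //.
apply: exec_sq; last exact: exec_ret.
by rewrite (_ : addr j _ = (addr j (size (sget s j)).+1 - stride j)%ZZ) // /addr; lia.
Qed.

Lemma exec_erase_ret s j b l : j <= 4 -> sget s j = b :: l ->
  exists2 t, t <= 32 * (size l).+1 &
    exec (erase_ret j) (tape_of s) (addr j (size l)) (tape_of (sset s j l)) 0%ZZ t.
Proof.
move=> hj hg; have [hb [hs [ht [hn hm]]]] := base_stride hj.
have gs : sget (sset s j l) j = l by rewrite sget_sset // eqxx.
have [|t2 h2 X2] := @exec_walk_down (sset s j l) j (size l) hj; first by rewrite gs.
exists (1 + ((Z.abs_nat (- stride j)).+1 + (t2 + (Z.abs_nat (stride j - base j)).+1))).
  by lia.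
apply: exec_sq (exec_wr _ _ _) _; rewrite (upd_pop hj hg).
apply: exec_sq (exec_go _ _ _) _; apply: exec_sq; last exact: exec_ret.
by rewrite Z.add_opp_r.
Qed.

Lemma exec_pop_cons s j b l p0 pF pT f z t : j <= 4 -> sget s j = b :: l ->
  exec (if b then pT else pF) (tape_of (sset s j l)) 0%ZZ f z t ->
  exists2 t', t' <= 64 * (size l).+1 + t &
    exec (pop_case j p0 pF pT) (tape_of s) 0%ZZ f z t'.
Proof.
move=> hj hg X; have [hb [hs [ht [hn hm]]]] := base_stride hj.
have [//|t1 h1 X1] := @exec_walk_up s j 0 hj.
have [t2 h2 X2] := exec_erase_ret hj hg.
exists ((Z.abs_nat (base j)).+1 + (t1 + ((Z.abs_nat (- stride j)).+1 + (t2 + t).+1))).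
  by rewrite hg /= in h1; lia.
apply: exec_sq (exec_go _ _ _) _; apply: exec_sq.
  by rewrite Z.add_0_l (_ : base j = addr j 0) ?/addr; [exact: X1 | lia].
apply: exec_sq (exec_go _ _ _) _; apply: exec_if.
have -> : (addr j (size (sget s j)) + - stride j)%ZZ = addr j (size l).
  by rewrite hg /addr /=; lia.
rewrite tape_of_addr // hg cell_of_cons eqxx.
by case: b hg X => hg X; apply: exec_sq X2 X.
Qed.

(* [t] counts stack operations; each costs a number of machine steps linear in the stack
   heights, and the heights grow by at most one per operation. *)
Definition srun (p : tp) (s s' : stks) (t : nat) : Prop :=
  hsum s' <= hsum s + t /\
  exists2 T, T <= 128 * t * (hsum s + t + 1) &
    exec p (tape_of s) 0%ZZ (tape_of s') 0%ZZ T.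

Lemma srun_le p s s' t t' : srun p s s' t -> t <= t' -> srun p s s' t'.
Proof.
move=> [h1 [T hT X]] le; split; first by lia.
by exists T => //; apply: leq_trans hT _; apply: leq_mul; lia.
Qed.

Lemma srun_skip s : srun skip s s 1.
Proof. by split; [lia|]; exists 1; [lia|]; exact: exec_mv. Qed.

(** The bound on machine steps is superadditive in [t], because the second program starts at height
    at most [hsum s + t1]. *)
Lemma srun_seq p q s s1 s2 t1 t2 :
  srun p s s1 t1 -> srun q s1 s2 t2 -> srun (Sq p q) s s2 (t1 + t2).
Proof.
move=> [h1 [T1 hT1 X1]] [h2 [T2 hT2 X2]]; split; first by lia.
exists (T1 + T2); last exact: exec_sq X1 X2.
apply: leq_trans (leq_add hT1 hT2) _; rewrite (mulnDr 128) (mulnDl (128 * t1)).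
by apply: leq_add; apply: leq_mul; lia.
Qed.

Lemma srun_push s j b : j <= 4 -> srun (push j b) s (sset s j (b :: sget s j)) 1.
Proof.
move=> hj; have [t ht X] := exec_push s b hj; split.
  by have /= := hsum_sset s (b :: sget s j) hj; lia.
by exists t => //; have := size_sget s j; lia.
Qed.

Lemma srun_pop_cons s j b l p0 pF pT s' t : j <= 4 -> sget s j = b :: l ->
  srun (if b then pT else pF) (sset s j l) s' t -> srun (pop_case j p0 pF pT) s s' t.+1.
Proof.
move=> hj hg [h [T hT X]]; have [t' ht' X'] := exec_pop_cons p0 hj hg X.
have := hsum_sset s l hj; rewrite hg /= => e.
split; first by lia.
exists t' => //; apply: leq_trans ht' _.
have := size_sget s j; rewrite hg /= => e2.
nia.
Qed.

(** Loop runs form a relation that can be concatenated: the inductions on trees below split a single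
    loop into the iterations spent on the two subtrees. Each iteration is charged one unit for its
    test. *)
Inductive witer (j : nat) (p : tp) : stks -> stks -> nat -> Prop :=
  | witer0 s : witer j p s s 0
  | witer1 s s1 s2 t1 t2 : sget s j <> [::] -> srun p s s1 t1 -> witer j p s1 s2 t2 ->
      witer j p s s2 (t1.+1 + t2).

Lemma witer_cat j p s s1 s2 t1 t2 :
  witer j p s s1 t1 -> witer j p s1 s2 t2 -> witer j p s s2 (t1 + t2).
Proof.
move=> W; elim: W s2 t2 => {s s1 t1} [s|s s1 s2 t1 t2 hg R _ IH] s3 t3 W3 //.
rewrite -addnA; exact: witer1 hg R (IH _ _ W3).
Qed.

Lemma witer_one j p s s1 t : sget s j <> [::] -> srun p s s1 t -> witer j p s s1 t.+1.
Proof. by move=> hg R; rewrite -[t.+1]addn0; apply: witer1 hg R _; exact: witer0. Qed.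

Lemma witer_srun j p s s' t : j <= 4 -> witer j p s s' t -> sget s' j = [::] ->
  srun (while_ne j p) s s' t.+1.
Proof.
move=> hj W hg; have [hb [_ [_ [_ hm]]]] := base_stride hj.
suff [h [T hT X]] : hsum s' <= hsum s + t /\ exists2 T, T <= (128 * t) * (hsum s + t + 1) + 1 &
    exec (Wh (Sq (go (- base j)%ZZ) (Sq p (go (base j))))) (tape_of s) (base j)
       (tape_of s') (base j) T.
  split; first by lia.
  exists ((Z.abs_nat (base j)).+1 + (T + (Z.abs_nat (- base j)).+1)).
    apply: leq_trans (_ : 20 + 128 * t * (hsum s + t + 1) <= _); first by lia.
    nia.
  apply: exec_sq (exec_go _ _ _) _; rewrite Z.add_0_l; apply: exec_sq X _.
  by apply: exec_eq (exec_go _ _ _) _ _ _ => //; lia.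
elim: W hg => {s s' t} [s|s s1 s2 t1 t2 hg [h1 [T1 hT1 X1]] _ IH] hg'.
  split; first by lia.
  exists 1; first by lia.
  apply: exec_wh0.
  rewrite (_ : base j = addr j 0) ?tape_of_addr ?hg' //.
  by rewrite /addr; lia.
have [h2 [T2 hT2 X2]] := IH hg'.
split; first by lia.
exists (((Z.abs_nat (- base j)).+1 + (T1 + (Z.abs_nat (base j)).+1) + T2).+1).
  apply: leq_trans (_ : (128 * t1) * (hsum s + t1 + 1) + 20
     + (128 * t2 * (hsum s1 + t2 + 1) + 1) <= _); first by lia.
  have : 128 * t2 * (hsum s1 + t2 + 1) <= 128 * t2 * (hsum s + (t1.+1 + t2) + 1).
    by apply: leq_mul; lia.
  nia.
apply: exec_wh1 _ _ X2.
  rewrite (_ : base j = addr j 0) ?tape_of_addr //; last by rewrite /addr; lia.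
  by apply: cell_of_lt; case: (sget s j) hg.
apply: exec_sq (exec_go _ _ _) _; rewrite Z.add_opp_diag_r.
apply: exec_sq X1 _.
by apply: exec_eq (exec_go _ _ _) _ _ _.
Qed.

(** * Polynomial-time functions on encoded data *)

Inductive tree := Lf | Nd of tree & tree.

(** A prefix code: a tree ends where its own bits say so, and trees can be stacked without
    separators. *)
Fixpoint code (v : tree) : seq bool :=
  match v with Lf => [:: false] | Nd a b => true :: code a ++ code b end.

Definition pop (j : nat) : tp := pop_case j skip skip skip.

Lemma srun_pop s j b l : j <= 4 -> sget s j = b :: l -> srun (pop j) s (sset s j l) 2.
Proof. by move=> hj hg; apply: srun_pop_cons hj hg _; case: b; exact: srun_skip. Qed.

Lemma srun_weak p s s' t t' s'' : srun p s s' t -> s' = s'' -> t <= t' -> srun p s s'' t'.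
Proof. by move=> R <-; exact: srun_le. Qed.

Definition stA (j : bool) S x y c r := if j then St S x y c r else St S y x c r.

(* Reads one prefix-coded tree off stack 0 onto stack A or B; the height of stack 3 is the
   number of subtrees still to be read. *)
Definition mv_tree (j : bool) : tp :=
  let d := if j then 1 else 2 in
  Sq (push 3 true) (while_ne 3 (pop_case 0 skip (Sq (push d false) (pop 3))
     (Sq (push d true) (push 3 true)))).

Lemma srun_mv_tree j v s x y r :
  srun (mv_tree j) (stA j (code v ++ s) x y [::] r)
    (stA j s (rev (code v) ++ x) y [::] r) (6 * size (code v) + 2).
Proof.
set T := 6 * _; have -> : T + 2 = 1 + T.+1 by lia.
apply: (@srun_seq _ _ _ (stA j (code v ++ s) x y [:: true] r)).
  by case: j; exact: srun_push.
apply: witer_srun => //; last by case: j.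
(* The part of stack 3 below the token of [v] is generalised: a leaf removes its token, a node adds
   one so that both subtrees have theirs. *)
rewrite {}/T; elim: v s x [::] => [|a IHa b IHb] s x c.
  have W := @witer_one 3 (pop_case 0 skip (Sq (push (if j then 1 else 2) false) (pop 3))
     (Sq (push (if j then 1 else 2) true) (push 3 true)))
     (stA j (code Lf ++ s) x y (true :: c) r) (stA j s (false :: x) y c r) 5.
  case: j W => W; apply: W => //; apply: (@srun_le _ _ _ 4) => //;
    apply: (srun_pop_cons (j := 0) (b := false) (l := s)) => //;
    by apply: (srun_seq (t1 := 1) (t2 := 2)); [exact: srun_push | exact: srun_pop].
rewrite [code (Nd a b)]/= [size _]/= size_cat rev_cons rev_cat cat_rcons -!catA cat_cons -catA.
have -> : 6 * (size (code a) + size (code b)).+1 =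
  6 + (6 * size (code a) + 6 * size (code b)) by lia.
apply: (@witer_cat _ _ _ (stA j (code a ++ code b ++ s) (true :: x) y (true :: true :: c) r)).
  apply: witer_one; first by clear; case: j.
  case: j IHa IHb => _ _; apply: (@srun_le _ _ _ 3) => //;
    apply: (srun_pop_cons (j := 0) (b := true) (l := code a ++ code b ++ s)) => //;
    by apply: (srun_seq (t1 := 1) (t2 := 1)); exact: srun_push.
apply: witer_cat (IHa _ _ _) _; exact: IHb.
Qed.

Definition drop_tree : tp :=
  Sq (push 3 true) (while_ne 3 (pop_case 0 skip (pop 3) (push 3 true))).

Definition stS s r := St s [::] [::] [::] r.

Lemma srun_drop_tree v s r :
  srun drop_tree (stS (code v ++ s) r) (stS s r) (6 * size (code v) + 2).
Proof.
set T := 6 * _; have -> : T + 2 = 1 + T.+1 by lia.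
apply: srun_seq; first exact: srun_push.
apply: witer_srun => //=; rewrite {}/T /stS.
suff H c : witer 3 (pop_case 0 skip (pop 3) (push 3 true))
    (St (code v ++ s) [::] [::] (true :: c) r) (St s [::] [::] c r) (6 * size (code v)).
  exact: H.
elim: v s c => [|a IHa b IHb] s c.
  apply: witer_one => //.
  apply: (@srun_le _ _ _ 3) => //.
  by apply: (srun_pop_cons (j := 0) (b := false) (l := s)) => //; exact: srun_pop.
rewrite [code (Nd a b)]/= [size _]/= size_cat cat_cons -catA.
have -> : 6 * (size (code a) + size (code b)).+1 =
  6 + (6 * size (code a) + 6 * size (code b)) by lia.
apply: (@witer_cat _ _ _ (St (code a ++ code b ++ s) [::] [::] (true :: true :: c) r)).
  apply: witer_one => //.
  apply: (@srun_le _ _ _ 2) => //.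
  apply: (srun_pop_cons (j := 0) (b := true) (l := code a ++ code b ++ s)) => //.
  exact: srun_push.
apply: witer_cat (IHa _ _) _; exact: IHb.
Qed.

Definition mv_all (i j : nat) : tp := while_ne i (pop_case i skip (push j false) (push j true)).

Lemma srun_mv_all i j s l l' : i <= 4 -> j <= 4 -> i != j -> sget s i = l -> sget s j = l' ->
  srun (mv_all i j) s (sset (sset s i [::]) j (rev l ++ l')) (3 * size l).+1.
Proof.
move=> hi hj nij gi gj.
have nji : (j == i) = false by rewrite eq_sym (negbTE nij).
suff W : witer i (pop_case i skip (push j false) (push j true)) s
    (sset (sset s i [::]) j (rev l ++ l')) (3 * size l).
  by apply: witer_srun => //; rewrite sget_sset // (negbTE nij) sget_sset // eqxx.
elim: l s l' gi gj => [|b l IH] s l' gi gj.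
  have -> : sset s i [::] = s by rewrite -gi sset_sget.
  by rewrite /= -gj sset_sget; exact: witer0.
rewrite rev_cons cat_rcons /=.
have -> : 3 * (size l).+1 = 3 + 3 * size l by lia.
have -> : sset (sset s i [::]) j (rev l ++ b :: l')
   = sset (sset (sset (sset s i l) j (b :: l')) i [::]) j (rev l ++ b :: l').
  case: s {gi gj} => a0 a1 a2 a3 a4; move: nij hi hj.
  by case: i {IH nji} => [|[|[|[|[|]]]]] //; case: j => [|[|[|[|[|]]]]].
apply: (@witer_cat _ _ _ (sset (sset s i l) j (b :: l'))); last first.
  apply: IH; first by rewrite sget_sset // (negbTE nij) sget_sset // eqxx.
  by rewrite sget_sset // eqxx.
apply: witer_one; first by rewrite gi.
have R : srun (if b then push j true else push j false) (sset s i l)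
    (sset (sset s i l) j (b :: l')) 1; last exact: (srun_pop_cons skip hi gi R).
have e : sget (sset s i l) j = l' by rewrite sget_sset // nji.
by rewrite -e; case: b {gi}; exact: srun_push.
Qed.

(** Emptying A rebuilds the code on stack 0 and leaves a copy with the same orientation on B. Moving
    that copy directly would reverse it, so it goes back through A. *)
Definition dup_tree : tp :=
  Sq (mv_tree true)
   (Sq (while_ne 1 (pop_case 1 skip (Sq (push 0 false) (push 2 false))
                                    (Sq (push 0 true) (push 2 true))))
   (Sq (mv_all 2 1) (mv_all 1 0))).

Lemma srun_dup_tree v s r :
  srun dup_tree (stS (code v ++ s) r) (stS (code v ++ code v ++ s) r)
    (16 * size (code v) + 5).
Proof.
have -> : 16 * size (code v) + 5 = (6 * size (code v) + 2) + ((4 * size (code v)).+1 +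
  ((3 * size (code v)).+1 + (3 * size (code v)).+1)) by lia.
apply: srun_seq; first exact: (srun_mv_tree true v s [::] [::] r).
rewrite /stA cats0.
apply: (@srun_seq _ _ _ (St (code v ++ s) [::] (code v) [::] r)).
  apply: witer_srun => //.
  suff H : forall l s' b', witer 1 (pop_case 1 skip (Sq (push 0 false) (push 2 false))
         (Sq (push 0 true) (push 2 true))) (St s' l b' [::] r)
         (St (rev l ++ s') [::] (rev l ++ b') [::] r) (4 * size l).
    by have := H (rev (code v)) s [::]; rewrite revK cats0 size_rev.
  elim=> [|b l IH] s' b'; first exact: witer0.
  rewrite rev_cons !cat_rcons /= (_ : 4 * (size l).+1 = 4 + 4 * size l); last by lia.
  apply: witer_cat (IH _ _); apply: witer_one => //.
  apply: (srun_pop_cons (j := 1) (b := b)) => //.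
  by case: b; apply: (srun_seq (t1 := 1) (t2 := 1)); exact: srun_push.
apply: srun_seq.
  exact: (srun_mv_all (i := 2) (j := 1) (l := code v) (l' := [::])).
have := srun_mv_all (i := 1) (j := 0) (s := St (code v ++ s) (rev (code v)) [::] [::] r)
  (l := rev (code v)) (l' := code v ++ s).
rewrite /= revK size_rev cats0; exact.
Qed.

Definition swap_tree : tp :=
  Sq (mv_tree true) (Sq (mv_tree false) (Sq (mv_all 1 0) (mv_all 2 0))).

Lemma srun_swap_tree u v s r :
  srun swap_tree (stS (code u ++ code v ++ s) r) (stS (code v ++ code u ++ s) r)
    (9 * (size (code u) + size (code v)) + 6).
Proof.
have -> : 9 * (size (code u) + size (code v)) + 6 =
  (6 * size (code u) + 2) + ((6 * size (code v) + 2) + ((3 * size (code u)).+1 +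
  (3 * size (code v)).+1)) by lia.
apply: srun_seq; first exact: (srun_mv_tree true u _ [::] [::] r).
apply: srun_seq; first exact: (srun_mv_tree false v s [::] (rev (code u) ++ [::]) r).
rewrite !cats0; apply: srun_seq.
  have := srun_mv_all (i := 1) (j := 0) (s := St s (rev (code u)) (rev (code v)) [::] r)
    (l := rev (code u)) (l' := s).
  by rewrite /= revK size_rev; apply.
have := srun_mv_all (i := 2) (j := 0) (s := St (code u ++ s) [::] (rev (code v)) [::] r)
  (l := rev (code v)) (l' := code u ++ s).
by rewrite /= revK size_rev; apply.
Qed.

(** The base [n + 2] is at least 2, so constants and sums are absorbed by the exponent. *)
Definition pbound (F : nat -> nat) : Prop := exists k, forall n, F n <= (n + 2) ^ k.

Lemma pbound_le F G : pbound G -> (forall n, F n <= G n) -> pbound F.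
Proof. by move=> [k H] le; exists k => n; apply: leq_trans (le n) (H n). Qed.

Lemma leq_pow2 n k l : k <= l -> (n + 2) ^ k <= (n + 2) ^ l.
Proof. by move=> h; rewrite leq_exp2l //; lia. Qed.

Lemma pbound_const c : pbound (fun => c).
Proof.
exists c => n; apply: leq_trans (ltnW (ltn_expl c (ltnSn 1))) _.
by case: c => [|c] //; rewrite leq_exp2r ?leq_addl.
Qed.

Lemma pbound_id : pbound id.
Proof. by exists 1 => n; rewrite expn1 leq_addr. Qed.

Lemma pbound_mul F G : pbound F -> pbound G -> pbound (fun n => F n * G n).
Proof. by move=> [k H] [l H']; exists (k + l) => n; rewrite expnD leq_mul. Qed.

Lemma pbound_add F G : pbound F -> pbound G -> pbound (fun n => F n + G n).
Proof.
move=> [k H] [l H']; exists (maxn k l).+1 => n.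
apply: leq_trans (_ : (n + 2) ^ maxn k l + (n + 2) ^ maxn k l <= _).
  apply: leq_add; [apply: leq_trans (H n) _|apply: leq_trans (H' n) _];
    by apply: leq_pow2; rewrite ?leq_maxl ?leq_maxr.
by rewrite expnS addnn -mul2n leq_mul2r leq_addl orbT.
Qed.

Lemma pbound_pow F k : pbound F -> pbound (fun n => F n ^ k).
Proof.
move=> [l H]; exists (l * k) => n; rewrite expnM.
by case: k => [|k] //; rewrite leq_exp2r.
Qed.

Lemma pbound_comp F G : pbound F -> pbound G -> pbound (fun n => F (G n)).
Proof.
move=> [k H] hG; apply: pbound_le (fun n => H (G n)).
apply: pbound_pow; exact: pbound_add hG (pbound_const 2).
Qed.

Class Enc (A : Type) := enc : A -> tree.

#[export] Instance enc_bool : Enc bool := fun b => if b then Nd Lf Lf else Lf.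
#[export] Instance enc_prod A B {EA : Enc A} {EB : Enc B} : Enc (A * B) :=
  fun x => Nd (enc x.1) (enc x.2).
(** A nonempty list has the same tree as the pair of its head and its tail; [pf_cons], [pf_case] and
    the folds rely on this. *)
#[export] Instance enc_seq A {EA : Enc A} : Enc (seq A) :=
  fix enc_seq s := match s with [::] => Lf | x :: s' => Nd (enc x) (enc_seq s') end.

Definition sz A {EA : Enc A} (a : A) : nat := size (code (enc a)).

Lemma sz_pair A B {EA : Enc A} {EB : Enc B} (x : A * B) : sz x = (sz x.1 + sz x.2).+1.
Proof. by rewrite /sz /= size_cat. Qed.

Lemma sz_cons A {EA : Enc A} (x : A) s : sz (x :: s) = (sz x + sz s).+1.
Proof. by rewrite /sz /= size_cat. Qed.

Lemma sz_nil A {EA : Enc A} : sz ([::] : seq A) = 1.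
Proof. by []. Qed.

Lemma sz_bool b : 1 <= sz b <= 3.
Proof. by case: b. Qed.

Section PolyFun.
Context {A B C : Type} {EA : Enc A} {EB : Enc B} {EC : Enc C}.

(** The data [s] and [r] below are arbitrary and preserved, the auxiliary stacks are empty before
    and after, and the count depends on [sz a] alone. Hence a program may run on top of saved
    data. *)
Definition polyfun (f : A -> B) : Prop :=
  exists p F, pbound F /\ forall a s r,
    srun p (stS (code (enc a) ++ s) r) (stS (code (enc (f a)) ++ s) r) (F (sz a)).

(** An operation raises the total height by at most one, so the output is at most as long as input
    and running time together. *)
Lemma polyfun_sz f : polyfun f -> exists2 F, pbound F & forall a, sz (f a) <= F (sz a).
Proof.
move=> [p [F [PF H]]]; exists (fun n => n + F n); first exact: pbound_add pbound_id PF.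
move=> a; have [h _] := H a [::] [::].
by move: h; rewrite /hsum /sz /= !cats0; lia.
Qed.

(** The explicit bound is monotone, which [F] need not be, and can be evaluated at an upper bound
    for an intermediate size. *)
Lemma polyfun_poly f : polyfun f -> exists p k, forall a s r,
    srun p (stS (code (enc a) ++ s) r) (stS (code (enc (f a)) ++ s) r) ((sz a + 2) ^ k).
Proof.
by move=> [p [F [[k Hk] H]]]; exists p, k => a s r; apply: srun_le (H a s r) (Hk _).
Qed.

Lemma polyfun_eq (f g : A -> B) : polyfun f -> f =1 g -> polyfun g.
Proof. by move=> [p [F [PF H]]] e; exists p, F; split=> // a s r; rewrite -e. Qed.

End PolyFun.

Lemma polyfun_sz_pow A B {EA : Enc A} {EB : Enc B} (f : A -> B) : polyfun f ->
  exists k, forall a, sz (f a) <= (sz a + 2) ^ k.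
Proof.
by move=> /polyfun_sz [F [k Hk] H]; exists k => a; apply: leq_trans (H a) (Hk _).
Qed.

Ltac pb := repeat lazymatch goal with
  | |- pbound (fun n => n) => exact: pbound_id
  | |- pbound (fun n => @?f n + @?g n) => apply: (@pbound_add f g)
  | |- pbound (fun n => @?f n * @?g n) => apply: (@pbound_mul f g)
  | |- pbound (fun n => @?f n ^ ?k) => apply: (@pbound_pow f k)
  | |- pbound (fun n => ?c) => exact: pbound_const
  | |- pbound _ => assumption
  end.

(** * Closure properties of polynomial-time functions *)

Lemma pf_id A {EA : Enc A} : polyfun (fun a : A => a).
Proof.
by exists skip, (fun => 1); split; [pb | move=> a s r; exact: srun_skip].
Qed.

Lemma pf_comp A B C {EA : Enc A} {EB : Enc B} {EC : Enc C} (f : A -> B) (g : B -> C) :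
  polyfun f -> polyfun g -> polyfun (fun a => g (f a)).
Proof.
move=> Pf Pg; have [k2 Hsz] := polyfun_sz_pow Pf.
have [q [k Hq]] := polyfun_poly Pg; case: Pf => p [F [PF Hp]].
exists (Sq p q), (fun n => F n + ((n + 2) ^ k2 + 2) ^ k); split; first by pb.
move=> a s r; apply: srun_seq (Hp _ _ _) _; apply: srun_le (Hq _ _ _) _.
by case: k {Hq} => [|k] //; rewrite leq_exp2r ?leq_add2r.
Qed.

Lemma pf_enc A B C {EA : Enc A} {EB : Enc B} {EC : Enc C} (f : A -> B) (g : A -> C) :
  polyfun f -> (forall a, enc (g a) = enc (f a)) -> polyfun g.
Proof. by move=> [p [F [PF H]]] e; exists p, F; split=> // a s r; rewrite e. Qed.

Lemma pf_const A B {EA : Enc A} {EB : Enc B} (b : B) : polyfun (fun _ : A => b).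
Proof.
pose push_all l := foldr (fun x p => Sq p (push 0 x)) skip l.
have Hl l s r : srun (push_all l) (stS s r) (stS (l ++ s) r) (size l).+1.
  elim: l => [|x l IH] /=; first exact: srun_skip.
  rewrite -addn1; apply: srun_seq IH _; exact: srun_push.
exists (Sq drop_tree (push_all (code (enc b)))),
  (fun n => (6 * n + 2) + (size (code (enc b))).+1); split; first by pb.
move=> a s r; apply: srun_seq (Hl _ _ _); exact: srun_drop_tree.
Qed.

Lemma pf_pair A B C {EA : Enc A} {EB : Enc B} {EC : Enc C} (f : A -> B) (g : A -> C) :
  polyfun f -> polyfun g -> polyfun (fun a => (f a, g a)).
Proof.
move=> Pf Pg; have [Ff PFf Hf] := polyfun_sz Pf; have [Fg PFg Hg] := polyfun_sz Pg.
case: Pf => p [F [PF Hp]]; case: Pg => q [G [PG Hq]].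
(* [g] is computed first: after the swap [f] runs on top, and one [true] in front of the two codes
   makes them the code of the pair. *)
exists (Sq dup_tree (Sq q (Sq swap_tree (Sq p (push 0 true))))),
  (fun n => (16 * n + 5) + (G n + ((9 * (Fg n + n) + 6) + (F n + 1)))).
split; first by pb.
move=> a s r; apply: srun_seq (srun_dup_tree _ _ _) _; apply: srun_seq (Hq _ _ _) _.
apply: srun_seq.
  by apply: srun_le (srun_swap_tree _ _ _ _) _; have := Hg a; rewrite /sz; lia.
apply: srun_seq (Hp _ _ _) _.
apply: srun_weak (srun_push _ _ _) _ _ => //=.
by rewrite catA.
Qed.

Lemma pf_fst A B C {EA : Enc A} {EB : Enc B} {EC : Enc C} (f : A -> B * C) :
  polyfun f -> polyfun (fun a => (f a).1).
Proof.
move=> Pf; apply: (pf_comp Pf (g := fst)).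
exists (Sq (pop 0) (Sq swap_tree drop_tree)), (fun n => 2 + ((9 * n + 6) + (6 * n + 2))).
split; first by pb.
move=> [b c] s r; rewrite [code (enc (b, c))]/=.
apply: (@srun_seq _ _ _ (stS (code (enc b) ++ code (enc c) ++ s) r)).
  by apply: srun_weak (srun_pop (j := 0) (b := true) _ _) _ _ => //; rewrite /= catA.
have e : sz (b, c) = (size (code (enc b)) + size (code (enc c))).+1 by exact: sz_pair.
apply: srun_seq; first by apply: srun_le (srun_swap_tree _ _ _ _) _; lia.
by apply: srun_le (srun_drop_tree _ _ _) _; lia.
Qed.

Lemma pf_snd A B C {EA : Enc A} {EB : Enc B} {EC : Enc C} (f : A -> B * C) :
  polyfun f -> polyfun (fun a => (f a).2).
Proof.
move=> Pf; apply: (pf_comp Pf (g := snd)).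
exists (Sq (pop 0) drop_tree), (fun n => 2 + (6 * n + 2)).
split; first by pb.
move=> [b c] s r; rewrite [code (enc (b, c))]/=.
apply: (@srun_seq _ _ _ (stS (code (enc b) ++ code (enc c) ++ s) r)).
  by apply: srun_weak (srun_pop (j := 0) (b := true) _ _) _ _ => //; rewrite /= catA.
have e : sz (b, c) = (size (code (enc b)) + size (code (enc c))).+1 by exact: sz_pair.
by apply: srun_le (srun_drop_tree _ _ _) _; lia.
Qed.

Lemma pf_if A B {EA : Enc A} {EB : Enc B} (b : A -> bool) (f g : A -> B) :
  polyfun b -> polyfun f -> polyfun g -> polyfun (fun a => if b a then f a else g a).
Proof.
move=> [pb0 [Fb [PFb Hb]]] [p [F [PF Hp]]] [q [G [PG Hq]]].
(* The test consumes the first bit of the boolean. Nothing is left of [false], but two leaves are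
   left of [true], which the branch has to pop. *)
exists (Sq dup_tree (Sq pb0 (pop_case 0 skip q (Sq (pop 0) (Sq (pop 0) p))))),
  (fun n => (16 * n + 5) + (Fb n + (G n + F n + 5))).
split; first by pb.
move=> a s r; apply: srun_seq (srun_dup_tree _ _ _) _; apply: srun_seq (Hb _ _ _) _.
case: (b a) => /=.
- apply: (@srun_le _ _ _ (2 + (2 + F (sz a))).+1); last by lia.
  apply: (srun_pop_cons (j := 0) (b := true)) => //.
  apply: srun_seq; first exact: srun_pop.
  by apply: srun_seq (Hp _ _ _); exact: srun_pop.
- apply: (@srun_le _ _ _ (G (sz a)).+1); last by lia.
  by apply: (srun_pop_cons (j := 0) (b := false)) => //; exact: Hq.
Qed.

Lemma pf_case A B C {EA : Enc A} {EB : Enc B} {EC : Enc C} (l : A -> seq B)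
    (f : A -> C) (g : A * (B * seq B) -> C) :
  polyfun l -> polyfun f -> polyfun g ->
  polyfun (fun a => if l a is x :: l' then g (a, (x, l')) else f a).
Proof.
move=> Pl Pf Pg; have [Fl PFl Hl] := polyfun_sz Pl.
case: Pl => pl [L [PL HL]]; case: Pf => p [F [PF Hp]].
have [q [k Hq]] := polyfun_poly Pg.
(* The test has popped the first bit of the list; if it was [true], pushing it back restores the
   code of the pair of head and tail. *)
exists (Sq dup_tree (Sq pl (pop_case 0 skip p
  (Sq (push 0 true) (Sq swap_tree (Sq (push 0 true) q)))))),
  (fun n => (16 * n + 5) + (L n + (F n + ((9 * (Fl n + n) + 6) + ((n + Fl n + 1) + 2) ^ k) + 9))).
split; first by pb.
move=> a s r; apply: srun_seq (srun_dup_tree _ _ _) _; apply: srun_seq (HL _ _ _) _.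
have := Hl a; case: (l a) => [|x l'] hl.
- apply: (@srun_le _ _ _ (F (sz a)).+1); last by lia.
  by apply: (srun_pop_cons (j := 0) (b := false)) => //; exact: Hp.
- apply: (@srun_le _ _ _ (1 + ((9 * (Fl (sz a) + sz a) + 6) +
     (1 + ((sz a + Fl (sz a) + 1) + 2) ^ k))).+1); last by lia.
  apply: (srun_pop_cons (j := 0) (b := true)) => //.
  rewrite sz_cons in hl.
  apply: (@srun_seq _ _ _ (stS (code (enc (x, l')) ++ code (enc a) ++ s) r)).
    exact: srun_push.
  apply: srun_seq.
    apply: srun_le (srun_swap_tree (enc (x, l')) (enc a) s r) _.
    by rewrite -/(sz a) -/(sz (x, l')) sz_pair /=; lia.
  apply: (@srun_seq _ _ _ (stS (code (enc (a, (x, l'))) ++ s) r)).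
    have -> : code (enc (a, (x, l'))) ++ s = true :: code (enc a) ++ code (enc (x, l')) ++ s.
      by rewrite [code (enc (a, _))]/= cat_cons -catA.
    exact: srun_push.
  apply: srun_le (Hq (a, (x, l')) s r) _.
  by case: k {Hq} => [|k] //; rewrite leq_exp2r // !sz_pair /=; lia.
Qed.

(* The flag on stack 3 is popped before the body runs, so that the body starts, as every
   program for a [polyfun] does, with stacks 1-3 empty. *)
Definition fold_loop (p : tp) : tp :=
  Sq (push 3 true) (while_ne 3 (Sq (pop 3) (Sq (pop 0)
    (pop_case 0 skip skip (Sq (push 0 true) (Sq (push 0 true) (Sq p (push 3 true)))))))).

(** Removing the pair bit exposes the first bit of the list. If it is [false], the list is used up
    and exactly the code of [(b, c)] remains. If it is [true], the codes of head and tail follow,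
    and two pushes regroup the data as [((x, l), (b, c))]. *)
Lemma srun_fold_loop A B C {EA : Enc A} {EB : Enc B} {EC : Enc C}
    (step : C -> B -> A -> B) (p : tp) (F : nat -> nat) (c : C) (l : seq A) (b : B) T s r :
  (forall x (l : seq A) b s r, srun p (stS (code (enc ((x, l), (b, c))) ++ s) r)
     (stS (code (enc (l, (step c b x, c))) ++ s) r) (F (sz ((x, l), (b, c))))) ->
  (forall m, F (sz (drop m l, (foldl (step c) b (take m l), c))) <= T) ->
  srun (fold_loop p) (stS (code (enc (l, (b, c))) ++ s) r)
    (stS (code (enc (foldl (step c) b l, c)) ++ s) r) (2 + (size l).+1 * (T + 10)).
Proof.
move=> Hp HT; set N := _ * _; have -> : 2 + N = 1 + N.+1 by lia.
apply: srun_seq; first exact: srun_push.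
apply: witer_srun => //; rewrite {}/N /stS /=.
elim: l b HT => [|x l IH] b HT.
  rewrite mul1n; have -> : T + 10 = (T + 9).+1 by lia.
  apply: witer_one => //.
  apply: (@srun_le _ _ _ (2 + (2 + 2))); last by lia.
  apply: srun_seq; first exact: srun_pop.
  apply: srun_seq; first exact: (srun_pop (b := true)).
  by apply: (srun_pop_cons (j := 0) (b := false)) => //; exact: srun_skip.
have -> : (size (x :: l)).+1 * (T + 10) = (T + 9).+1 + (size l).+1 * (T + 10) by rewrite /=; lia.
have := HT 0; rewrite drop0 take0 [foldl _ _ [::]]/= => H0.
apply: witer_cat (IH (step c b x) (fun m => HT m.+1)).
apply: witer_one => //.
apply: (@srun_le _ _ _ (2 + (2 + (1 + (1 + (F (sz ((x, l), (b, c))) + 1))).+1)));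
  last by rewrite (_ : sz (x, l, (b, c)) = sz (x :: l, (b, c))) //; lia.
apply: srun_seq; first exact: srun_pop.
apply: srun_seq; first exact: (srun_pop (b := true)).
apply: (srun_pop_cons (j := 0) (b := true)) => //.
apply: srun_seq; first exact: srun_push.
apply: srun_seq; first exact: srun_push.
apply: srun_seq; first exact: (Hp x l b s r).
exact: srun_push.
Qed.

Lemma sz_drop A {EA : Enc A} (l : seq A) m : sz (drop m l) <= sz l.
Proof.
elim: l m => [|x l IH] [|m] //=; rewrite sz_cons; have := IH m; lia.
Qed.

Lemma size_sz A {EA : Enc A} (l : seq A) : size l <= sz l.
Proof. by elim: l => [|x l IH] //=; rewrite sz_cons; lia. Qed.

(** Iterating a polynomial-time step can produce exponentially long values, hence the size bound [G]
    on the accumulator after every prefix. *)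
Lemma pf_foldl A B C {EA : Enc A} {EB : Enc B} {EC : Enc C}
    (step : C -> B -> A -> B) (l : C -> seq A) (b0 : C -> B) G :
  polyfun l -> polyfun b0 ->
  polyfun (fun x : C * (B * A) => step x.1 x.2.1 x.2.2) ->
  pbound G ->
  (forall c m, sz (foldl (step c) (b0 c) (take m (l c))) <= G (sz c)) ->
  polyfun (fun c => foldl (step c) (b0 c) (l c)).
Proof.
move=> Pl Pb Ps PG HG.
pose body (y : (A * seq A) * (B * C)) : seq A * (B * C) :=
  (y.1.2, (step y.2.2 y.2.1 y.1.1, y.2.2)).
have Pbody : polyfun body.
  apply: pf_pair; first by apply: pf_snd; apply: pf_fst; exact: pf_id.
  apply: pf_pair; last by apply: pf_snd; apply: pf_snd; exact: pf_id.
  apply: (pf_comp (f := fun y : (A * seq A) * (B * C) => (y.2.2, (y.2.1, y.1.1))) _ Ps).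
  apply: pf_pair; first by apply: pf_snd; apply: pf_snd; exact: pf_id.
  apply: pf_pair; first by apply: pf_fst; apply: pf_snd; exact: pf_id.
  by apply: pf_fst; apply: pf_fst; exact: pf_id.
have [p [k Hp]] := polyfun_poly Pbody.
have [Fl PFl Hl] := polyfun_sz Pl.
have [q [F [PF Hq]]] : polyfun (fun c => (l c, (b0 c, c))).
  by apply: pf_pair => //; apply: pf_pair => //; exact: pf_id.
have H : polyfun (fun c => (foldl (step c) (b0 c) (l c), c)); last exact: (pf_fst H).
exists (Sq q (fold_loop p)),
  (fun n => F n + (2 + (Fl n + 1) * ((Fl n + (G n + n) + 2 + 2) ^ k + 10))).
split; first by pb.
move=> c s r; apply: srun_seq (Hq c s r) _.
have step_run x (l' : seq A) b s' r' : srun p (stS (code (enc ((x, l'), (b, c))) ++ s') r')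
    (stS (code (enc (l', (step c b x, c))) ++ s') r') ((sz ((x, l'), (b, c)) + 2) ^ k).
  exact: (Hp ((x, l'), (b, c))).
apply: srun_le (srun_fold_loop (T := (Fl (sz c) + (G (sz c) + sz c) + 2 + 2) ^ k)
  (F := fun n => (n + 2) ^ k) s r step_run _) _.
- move=> m; case: k {Hp step_run} => [|k] //.
  rewrite leq_exp2r // leq_add2r !sz_pair /=.
  have := @sz_drop A EA (l c) m; have := Hl c; have := HG c m; lia.
- rewrite leq_add2l; apply: leq_mul => //.
  by rewrite addn1 ltnS; apply: leq_trans (size_sz _) (Hl c).
Qed.

(** The top of stack 4 is the last input bit, so the list is built from its end. The code of the
    element is pushed backwards, then the node bit of the new cell. *)
Definition read_loop : tp :=
  while_ne 4 (pop_case 4 skip (Sq (push 0 false) (push 0 true))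
    (Sq (push 0 false) (Sq (push 0 false) (Sq (push 0 true) (push 0 true))))).

Lemma srun_read_loop (inp : seq bool) :
  srun (Sq (push 0 false) read_loop) (stS [::] (rev inp)) (stS (code (enc inp)) [::])
    (1 + (6 * size inp).+1).
Proof.
apply: srun_seq; first exact: srun_push.
apply: witer_srun => //=.
have H : forall (r l : seq bool),
    witer 4 (pop_case 4 skip (Sq (push 0 false) (push 0 true))
    (Sq (push 0 false) (Sq (push 0 false) (Sq (push 0 true) (push 0 true)))))
    (stS (code (enc l)) r) (stS (code (enc (rev r ++ l))) [::]) (6 * size r).
  elim=> [|b r IH] l; first exact: witer0.
  rewrite rev_cons cat_rcons /= (_ : 6 * (size r).+1 = 6 + 6 * size r); last by lia.
  apply: witer_cat (IH _); apply: witer_one => //.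
  apply: (@srun_le _ _ _ (if b then 5 else 3)); last by case: b.
  case: b; apply: (srun_pop_cons (j := 4)) => //.
  - do 3 (apply: (srun_seq (t1 := 1)); first exact: srun_push); exact: srun_push.
  - apply: (srun_seq (t1 := 1)); first exact: srun_push; exact: srun_push.
by have := H (rev inp) [::]; rewrite revK cats0 size_rev.
Qed.

(** The first element goes to the bottom of stack 4, which is cell 5, so the output reads from there
    to the right. *)
Definition write_loop : tp :=
  Sq (push 3 true) (while_ne 3 (Sq (pop 3) (pop_case 0 skip skip
    (Sq (pop_case 0 skip (push 4 false) (Sq (pop 0) (Sq (pop 0) (push 4 true))))
        (push 3 true))))).

Lemma srun_write_loop (out : seq bool) :
  srun write_loop (stS (code (enc out)) [::]) (stS [::] (rev out))
    (1 + (11 * (size out).+1).+1).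
Proof.
apply: srun_seq; first exact: srun_push.
apply: witer_srun => //.
have H : forall (l r : seq bool), witer 3 (Sq (pop 3) (pop_case 0 skip skip
    (Sq (pop_case 0 skip (push 4 false) (Sq (pop 0) (Sq (pop 0) (push 4 true))))
        (push 3 true)))) (St (code (enc l)) [::] [::] [:: true] r) (stS [::] (rev l ++ r))
     (11 * (size l).+1).
  elim=> [|b l IH] r.
    apply: witer_one => //; apply: (@srun_le _ _ _ (2 + 2)); last by lia.
    apply: srun_seq; first exact: srun_pop.
    by apply: (srun_pop_cons (j := 0) (b := false)) => //; exact: srun_skip.
  rewrite rev_cons cat_rcons [size _]/= mulnS; apply: witer_cat (IH _).
  apply: witer_one => //.
  apply: (@srun_le _ _ _ (2 + ((if b then 6 else 2) + 1).+1)); last by case: b.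
  apply: srun_seq; first exact: srun_pop.
  apply: (srun_pop_cons (j := 0) (b := true)) => //.
  apply: (@srun_seq _ _ _ (stS (code (enc l)) (b :: r))); last exact: srun_push.
  case: b; apply: (srun_pop_cons (j := 0)) => //; last exact: srun_push.
  do 2 (apply: (srun_seq (t1 := 2)); first exact: srun_pop); exact: srun_push.
by have := H out [::]; rewrite cats0.
Qed.

Lemma sz_bits (l : seq bool) : sz l <= 4 * size l + 1.
Proof. by elim: l => [|b l IH] //=; rewrite sz_cons; have := sz_bool b; lia. Qed.

Theorem polyfun_TM (F : seq bool -> seq bool) : polyfun F ->
  exists (M : TM) (c k : nat), forall inp, exists2 t,
    t <= c * (size inp).+1 ^ k & tm_computes_in M inp t (F inp).
Proof.
move=> PF; have [H PH HF] := polyfun_sz PF; case: PF => p [G [PG Hp]].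
have [k Hk] : pbound (fun n => 20 + 128 * ((1 + (6 * n).+1) + (G n + (1 + (11 * (H n).+1).+1)))
    * (n + ((1 + (6 * n).+1) + (G n + (1 + (11 * (H n).+1).+1))) + 1)).
  have E : pbound (fun n => 20 + 128 * ((1 + (6 * n + 1)) +
    (G n + (1 + (11 * (H n + 1) + 1)))) *
    (n + ((1 + (6 * n + 1)) + (G n + (1 + (11 * (H n + 1) + 1)))) + 1)) by pb.
  by apply: pbound_le E _ => n; rewrite !addn1.
(* Input and output start at cell 5, whereas stack programs start and end at cell 0. *)
exists (tp_TM (Sq (go (-5)%ZZ) (Sq (Sq (Sq (push 0 false) read_loop) (Sq p write_loop))
  (go 5%ZZ)))), (6 ^ k), k => inp.
have [_ [T hT X]] : srun (Sq (Sq (push 0 false) read_loop) (Sq p write_loop))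
    (stS [::] (rev inp)) (stS [::] (rev (F inp)))
    ((1 + (6 * size inp).+1) + (G (sz inp) + (1 + (11 * (size (F inp)).+1).+1))).
  apply: srun_seq (srun_read_loop inp) _.
  apply: srun_seq (srun_write_loop (F inp)).
  by have := Hp inp [::] [::]; rewrite !cats0.
have X' : exec (Sq (go (-5)%ZZ) (Sq (Sq (Sq (push 0 false) read_loop) (Sq p write_loop))
  (go 5%ZZ))) (input_tape inp 5) 5 (tape_of (stS [::] (rev (F inp)))) 5 (6 + (T + 6)).
  apply: exec_sq (exec_go _ _ _) _.
  have -> : input_tape inp 5 = tape_of (stS [::] (rev inp)).
    apply: functional_extensionality => z; rewrite /input_tape.
    case: (addr_cases z) => [[j [q [hj ->]]]|].
      rewrite tape_of_addr // /addr /base /stride; case: ltnP => hj4.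
        rewrite ifT; last by lia.
        by case: j hj4 {hj} => [|[|[|[|j]]]] //= _; rewrite /cell_of nth_nil.
      rewrite ifF; last by lia.
      have -> : j = 4 by lia.
      by rewrite /cell_of revK; congr nth; lia.
    move=> H0; rewrite H0; case: Z.ltb_spec => // h.
    have := H0 (stS [::] (rev inp)); rewrite /tape_of ifT; last by lia.
    by rewrite /cell_of revK.
  by apply: exec_sq X _; exact: (exec_go 5%ZZ).
exists (6 + (T + 6)).
  have h1 : size (F inp) <= H (sz inp) by apply: leq_trans (size_sz _) (HF inp).
  have h2 : size inp <= sz inp by exact: size_sz.
  have h3 := sz_bits inp.
  (* The factor [6 ^ k] comes from [sz inp <= 4 * size inp + 1]. *)
  apply: leq_trans (_ : (sz inp + 2) ^ k <= _); last first.
    rewrite -expnMn; case: (k) => [|k'] //; rewrite leq_exp2r //; lia.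
  apply: leq_trans (Hk (sz inp)).
  have : T <= 128 * ((1 + (6 * sz inp).+1) + (G (sz inp) + (1 + (11 * (H (sz inp)).+1).+1)))
    * (sz inp + ((1 + (6 * sz inp).+1) + (G (sz inp) + (1 + (11 * (H (sz inp)).+1).+1))) + 1).
    apply: leq_trans hT _; rewrite /hsum /= size_rev; apply: leq_mul; lia.
  lia.
apply: tp_TM_computes X' _ => i.
rewrite /tape_of ifT; last by lia.
rewrite /cell_of (_ : Z.to_nat (5 + Z.of_nat i - 5)%ZZ = i); [by rewrite /= revK | lia].
Qed.

(** * Polynomial-time functions on lists *)

Lemma leq_exp2w m n k : m <= n -> m ^ k <= n ^ k.
Proof. by case: k => [|k] // h; rewrite leq_exp2r. Qed.

Lemma sz_take A {EA : Enc A} (l : seq A) m : sz (take m l) <= sz l.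
Proof. by elim: l m => [|x l IH] [|m] //=; rewrite !sz_cons; have := IH m; lia. Qed.

Lemma foldl_growth A B {EA : Enc A} (step : B -> A -> B) (mu : B -> nat) k N :
  (forall b a, mu (step b a) <= mu b + (N + sz a) ^ k) ->
  forall l b, mu (foldl step b l) <= mu b + size l * (N + sz l) ^ k.
Proof.
move=> H; elim=> [|a l IH] b /=; first by lia.
apply: leq_trans (IH _) _; rewrite sz_cons mulSn addnA; apply: leq_add.
  by apply: leq_trans (H b a) _; rewrite leq_add2l leq_exp2w //; lia.
by rewrite leq_mul2l leq_exp2w ?orbT //; lia.
Qed.

(** The increment of a step may depend on the context and the element but not on the accumulator, so
    the total stays polynomial. [mu] is used instead of [sz] because the code of a number can change
    by a constant factor when its bits change, whereas its bit length grows additively. *)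
Lemma pf_foldl_growth A B C {EA : Enc A} {EB : Enc B} {EC : Enc C}
    (step : C -> B -> A -> B) (l : C -> seq A) (b0 : C -> B) (mu : B -> nat) M F :
  polyfun l -> polyfun b0 ->
  polyfun (fun x : C * (B * A) => step x.1 x.2.1 x.2.2) ->
  (forall b, mu b <= sz b <= M * mu b + M) ->
  pbound F ->
  (forall c b a, mu (step c b a) <= mu b + F (sz c + sz a)) ->
  polyfun (fun c => foldl (step c) (b0 c) (l c)).
Proof.
move=> Pl Pb Ps Hmu [k Hk] Hs; have [Fl PFl Hl] := polyfun_sz Pl; have [Fb PFb Hb] := polyfun_sz Pb.
apply: (pf_foldl (G := fun n => M * (Fb n + Fl n * (n + 2 + Fl n) ^ k) + M)) => //; first by pb.
move=> c m; have [_ h] := andP (Hmu (foldl (step c) (b0 c) (take m (l c)))).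
apply: leq_trans h _; rewrite leq_add2r leq_mul2l; apply/orP; right.
apply: leq_trans (@foldl_growth _ _ _ _ mu k (sz c + 2) _ (take m (l c)) (b0 c)) _.
  move=> b a; apply: leq_trans (Hs c b a) _; rewrite leq_add2l.
  by apply: leq_trans (Hk _) _; rewrite leq_exp2w //; lia.
apply: leq_add; first by have [h' _] := andP (Hmu (b0 c)); apply: leq_trans h' (Hb c).
apply: leq_mul.
  by apply: leq_trans (Hl c); apply: leq_trans (size_sz _) (sz_take _ _).
by rewrite leq_exp2w // leq_add2l; apply: leq_trans (sz_take _ _) (Hl c).
Qed.

Lemma pf_comp2 A B C D {EA : Enc A} {EB : Enc B} {EC : Enc C} {ED : Enc D}
    (f : A -> B) (g : A -> C) (h : B -> C -> D) :
  polyfun f -> polyfun g -> polyfun (fun x : B * C => h x.1 x.2) ->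
  polyfun (fun a => h (f a) (g a)).
Proof. by move=> Pf Pg Ph; exact: (pf_comp (pf_pair Pf Pg) Ph). Qed.

Lemma pf_comp3 A B C D E {EA : Enc A} {EB : Enc B} {EC : Enc C} {ED : Enc D} {EE : Enc E}
    (f : A -> B) (g : A -> C) (h : A -> D) (F : B -> C -> D -> E) :
  polyfun f -> polyfun g -> polyfun h ->
  polyfun (fun x : B * (C * D) => F x.1 x.2.1 x.2.2) ->
  polyfun (fun a => F (f a) (g a) (h a)).
Proof. by move=> Pf Pg Ph PF; exact: (pf_comp (pf_pair Pf (pf_pair Pg Ph)) PF). Qed.

Lemma pf_cons A B {EA : Enc A} {EB : Enc B} (f : A -> B) (g : A -> seq B) :
  polyfun f -> polyfun g -> polyfun (fun a => f a :: g a).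
Proof. by move=> Pf Pg; apply: pf_enc (pf_pair Pf Pg) _. Qed.

(* [pf_step] decomposes a goal [polyfun (fun x => e)] along the head symbol of [e]; it matches
   syntactically because unification would unfold one arithmetic operation into another. *)
Ltac pf_ext := fail.
Ltac pf_step := cbv beta; first [ lazymatch goal with
  | |- polyfun (fun x => x) => exact (pf_id)
  | |- polyfun (fun x => (@?f x).1) => refine (@pf_fst _ _ _ _ _ _ f _)
  | |- polyfun (fun x => (@?f x).2) => refine (@pf_snd _ _ _ _ _ _ f _)
  | |- polyfun (fun x => (@?f x, @?g x)) => refine (@pf_pair _ _ _ _ _ _ f g _ _)
  | |- polyfun (fun x => @?f x :: @?g x) => refine (@pf_cons _ _ _ _ f g _ _)
  end | pf_ext | lazymatch goal with
  | |- polyfun (fun x => match _ with true => _ | false => _ end) => apply: pf_if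
  end | assumption | exact: pf_const ].
Ltac pfs := repeat pf_step.

Lemma pf_not A {EA : Enc A} (f : A -> bool) : polyfun f -> polyfun (fun a => ~~ f a).
Proof.
move=> Pf; apply: (@polyfun_eq _ _ _ _ (fun a => if f a then false else true)); first by pfs.
by move=> a; case: (f a).
Qed.

Lemma pf_and A {EA : Enc A} (f g : A -> bool) :
  polyfun f -> polyfun g -> polyfun (fun a => f a && g a).
Proof. by move=> Pf Pg; apply: (@pf_if _ _ _ _ f g (fun => false)) => //; exact: pf_const. Qed.

Lemma pf_or A {EA : Enc A} (f g : A -> bool) :
  polyfun f -> polyfun g -> polyfun (fun a => f a || g a).
Proof. by move=> Pf Pg; apply: (@pf_if _ _ _ _ f (fun => true) g) => //; exact: pf_const. Qed.

Lemma sz_cat A {EA : Enc A} (l l' : seq A) : sz (l ++ l') + 1 = sz l + sz l'.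
Proof. by elim: l => [|x l IH] /=; [rewrite sz_nil addnC | rewrite !sz_cons; lia]. Qed.

Lemma sz_rev A {EA : Enc A} (l : seq A) : sz (rev l) = sz l.
Proof.
elim: l => [|x l IH] //; apply/eqP; rewrite -(eqn_add2r 1) rev_cons -cats1 sz_cat.
by rewrite !sz_cons IH sz_nil; lia.
Qed.

Lemma pf_catrev A B {EA : Enc A} {EB : Enc B} (f g : A -> seq B) :
  polyfun f -> polyfun g -> polyfun (fun a => catrev (f a) (g a)).
Proof.
move=> Pf Pg; apply: (@polyfun_eq _ _ _ _ (fun a => foldl (fun b x => x :: b) (g a) (f a))).
  apply: (@pf_foldl_growth _ _ _ _ _ _ (fun _ b x => x :: b) f g (fun b => sz b) 1
    (fun n => n + 1)) => //; first by pfs.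
  - by move=> b; lia.
  - exact: (pbound_add pbound_id (pbound_const 1)).
  - by move=> c b a; rewrite sz_cons; lia.
by move=> a; elim: (f a) (g a) => [|x l IH] l' //=; rewrite IH.
Qed.

Lemma pf_rev A B {EA : Enc A} {EB : Enc B} (f : A -> seq B) :
  polyfun f -> polyfun (fun a => rev (f a)).
Proof. by move=> Pf; apply: (pf_catrev Pf); exact: pf_const. Qed.

Lemma pf_cat A B {EA : Enc A} {EB : Enc B} (f g : A -> seq B) :
  polyfun f -> polyfun g -> polyfun (fun a => f a ++ g a).
Proof.
move=> Pf Pg; apply: polyfun_eq (pf_catrev (pf_rev Pf) Pg) _ => a.
by rewrite catrevE revK.
Qed.

Lemma pf_map A B C {EA : Enc A} {EB : Enc B} {EC : Enc C} (f : C -> A -> B) (l : C -> seq A) :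
  polyfun l -> polyfun (fun x : C * A => f x.1 x.2) -> polyfun (fun c => map (f c) (l c)).
Proof.
move=> Pl Pf; have [F PF HF] := polyfun_sz Pf.
apply: (@polyfun_eq _ _ _ _ (fun c => rev (foldl (fun b x => f c x :: b) [::] (l c)))).
  apply: pf_rev.
  apply: (@pf_foldl_growth _ _ _ _ _ _ (fun c b x => f c x :: b) l (fun => [::])
    (fun b => sz b) 1 (fun n => F (n + 1) + 1)) => //.
  - by pfs.
  - apply: pf_cons; last by pfs.
    by apply: (@pf_comp2 _ _ _ _ _ _ _ _ (fun x : C * (seq B * A) => x.1) (fun x => x.2.2)); pfs.
  - by move=> b; lia.
  - apply: pbound_add (pbound_const 1).
    exact: (pbound_comp PF (pbound_add pbound_id (pbound_const 1))).
  - move=> c b a; rewrite sz_cons; have := HF (c, a).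
    by rewrite (_ : sz (c, a) = sz c + sz a + 1) /=; [lia | rewrite sz_pair addn1].
move=> c; rewrite -[RHS]revK; congr rev.
by rewrite -[RHS]cats0; elim: (l c) [::] => [|x s IH] b //=; rewrite IH rev_cons cat_rcons.
Qed.

Lemma pf_filter A C {EA : Enc A} {EC : Enc C} (f : C -> A -> bool) (l : C -> seq A) :
  polyfun l -> polyfun (fun x : C * A => f x.1 x.2) -> polyfun (fun c => filter (f c) (l c)).
Proof.
move=> Pl Pf.
apply: (@polyfun_eq _ _ _ _
  (fun c => rev (foldl (fun b x => if f c x then x :: b else b) [::] (l c)))).
  apply: pf_rev.
  apply: (@pf_foldl_growth _ _ _ _ _ _ (fun c b x => if f c x then x :: b else b) l
    (fun => [::]) (fun b => sz b) 1 (fun n => n + 1)) => //.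
  - by pfs.
  - apply: pf_if; [|by pfs|by pfs].
    by apply: (@pf_comp2 _ _ _ _ _ _ _ _ (fun x : C * (seq A * A) => x.1) (fun x => x.2.2)); pfs.
  - by move=> b; lia.
  - exact: (pbound_add pbound_id (pbound_const 1)).
  - by move=> c b a; case: ifP => _; rewrite ?sz_cons; lia.
move=> c; rewrite -[RHS]revK; congr rev.
rewrite -[RHS]cats0; elim: (l c) [::] => [|x s IH] b //=; rewrite IH.
by case: ifP; rewrite ?rev_cons ?cat_rcons.
Qed.

Lemma pf_has A C {EA : Enc A} {EC : Enc C} (f : C -> A -> bool) (l : C -> seq A) :
  polyfun l -> polyfun (fun x : C * A => f x.1 x.2) -> polyfun (fun c => has (f c) (l c)).
Proof.
move=> Pl Pf.
apply: (@polyfun_eq _ _ _ _ (fun c => if filter (f c) (l c) is x :: l' then true else false)).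
  apply: (@pf_case _ _ _ _ _ _ (fun c => filter (f c) (l c)) (fun => false) (fun => true));
    [exact: pf_filter|by pfs|by pfs].
by move=> c; elim: (l c) => //= x s <-; case: (f c x).
Qed.

Lemma pf_all A C {EA : Enc A} {EC : Enc C} (f : C -> A -> bool) (l : C -> seq A) :
  polyfun l -> polyfun (fun x : C * A => f x.1 x.2) -> polyfun (fun c => all (f c) (l c)).
Proof.
move=> Pl Pf; apply: (@polyfun_eq _ _ _ _ (fun c => ~~ has (fun x => ~~ f c x) (l c))).
  by apply: pf_not; apply: (@pf_has _ _ _ _ (fun c x => ~~ f c x)) => //; exact: pf_not.
by move=> c; rewrite has_predC negbK.
Qed.

Lemma pf_flatten A B {EA : Enc A} {EB : Enc B} (f : A -> seq (seq B)) :
  polyfun f -> polyfun (fun a => flatten (f a)).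
Proof.
move=> Pf.
apply: (@polyfun_eq _ _ _ _ (fun a => foldl (fun b x => x ++ b) [::] (rev (f a)))).
  apply: (@pf_foldl_growth _ _ _ _ _ _ (fun _ b x => x ++ b) (fun a => rev (f a))
    (fun => [::]) (fun b => sz b) 1 id) => //.
  - exact: pf_rev.
  - by pfs.
  - by apply: pf_cat; pfs.
  - by move=> b; lia.
  - exact: pbound_id.
  - by move=> c b a; rewrite -(leq_add2r 1) sz_cat; lia.
by move=> a; rewrite foldl_rev; elim: (f a) => [|x s /= ->].
Qed.

Lemma pf_allpairs A B C D {EA : Enc A} {EB : Enc B} {EC : Enc C} {ED : Enc D}
    (f : A -> B -> C -> D) (l : A -> seq B) (m : A -> seq C) :
  polyfun l -> polyfun m ->
  polyfun (fun x : A * (B * C) => f x.1 x.2.1 x.2.2) ->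
  polyfun (fun a => [seq f a x y | x <- l a, y <- m a]).
Proof.
move=> Pl Pm Pf; apply: pf_flatten.
apply: (@pf_map _ _ _ _ _ _ (fun a x => [seq f a x y | y <- m a])) => //.
apply: (@pf_map _ _ _ _ _ _ (fun (ax : A * B) y => f ax.1 ax.2 y) (fun ax => m ax.1)).
  by apply: (@pf_comp _ _ _ _ _ _ (fun ax : A * B => ax.1) m) => //; pfs.
by apply: (@pf_comp3 _ _ _ _ _ _ _ _ _ _ (fun z : A * B * C => z.1.1)
   (fun z => z.1.2) (fun z => z.2)); pfs.
Qed.

Lemma pf_behead A B {EA : Enc A} {EB : Enc B} (f : A -> seq B) :
  polyfun f -> polyfun (fun a => behead (f a)).
Proof.
move=> Pf; apply: (@polyfun_eq _ _ _ _ (fun a => if f a is x :: l then l else [::])).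
  by apply: (@pf_case _ _ _ _ _ _ f (fun => [::]) (fun x => x.2.2)); pfs.
by move=> a; case: (f a).
Qed.

Lemma pf_head A B {EA : Enc A} {EB : Enc B} (x0 : B) (f : A -> seq B) :
  polyfun f -> polyfun (fun a => head x0 (f a)).
Proof.
move=> Pf; apply: (@polyfun_eq _ _ _ _ (fun a => if f a is x :: l then x else x0)).
  by apply: (@pf_case _ _ _ _ _ _ f (fun => x0) (fun x => x.2.1)); pfs.
by move=> a; case: (f a).
Qed.

Ltac pf_ext_list := lazymatch goal with
  | |- polyfun (fun x => ~~ @?f x) => refine (@pf_not _ _ f _)
  | |- polyfun (fun x => @?f x && @?g x) => refine (@pf_and _ _ f g _ _)
  | |- polyfun (fun x => @?f x || @?g x) => refine (@pf_or _ _ f g _ _)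
  | |- polyfun (fun x => rev (@?f x)) => refine (@pf_rev _ _ _ _ f _)
  | |- polyfun (fun x => @?f x ++ @?g x) => refine (@pf_cat _ _ _ _ f g _ _)
  | |- polyfun (fun x => map (@?f x) (@?g x)) => refine (@pf_map _ _ _ _ _ _ f g _ _)
  | |- polyfun (fun x => filter (@?f x) (@?g x)) => refine (@pf_filter _ _ _ _ f g _ _)
  | |- polyfun (fun x => has (@?f x) (@?g x)) => refine (@pf_has _ _ _ _ f g _ _)
  | |- polyfun (fun x => all (@?f x) (@?g x)) => refine (@pf_all _ _ _ _ f g _ _)
  | |- polyfun (fun x => flatten (@?f x)) => refine (@pf_flatten _ _ _ _ f _)
  | |- polyfun (fun x => behead (@?f x)) => refine (@pf_behead _ _ _ _ f _)
  | |- polyfun (fun x => head ?x0 (@?f x)) => refine (@pf_head _ _ _ _ x0 f _)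
  end.


Ltac pf_ext ::= pf_ext_list.

(** * Polynomial-time binary arithmetic *)

Definition bits (m : nat) : seq bool :=
  match N.of_nat m with N0 => [::] | Npos q => pos_bits q end.
(** These are the bits that [enc_nat] writes, and passing from a number to its bits leaves the code
    unchanged. *)
#[export] Instance enc_natural : Enc nat := fun m => enc (bits m).

Definition consbit (b : bool) (v : nat) : nat := b + v.*2.
Definition unbits (l : seq bool) : nat := foldr consbit 0 l.

Lemma bits_consbit b v :
  bits (consbit b v) = if b || (0 < v) then b :: bits v else [::].
Proof.
rewrite /bits /consbit.
have -> : N.of_nat (b + v.*2) = (N.b2n b + 2 * N.of_nat v)%num.
  by rewrite -muln2; case: b; rewrite /nat_of_bool /N.b2n; lia.
case: v => [|v]; first by case: b.
by rewrite orbT /=; case: b => /=.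
Qed.

Lemma consbit_half n : n = consbit (odd n) n./2.
Proof. by rewrite /consbit odd_double_half. Qed.

Lemma bitsE n : 0 < n -> bits n = odd n :: bits n./2.
Proof.
move=> h; rewrite {1}[n]consbit_half bits_consbit.
by rewrite ifT //; case: n h => [|[|n]] //= _; rewrite orbT.
Qed.

Lemma unbitsK n : unbits (bits n) = n.
Proof.
elim/ltn_ind: n => n IH; case: (posnP n) => [->|h] //.
by rewrite bitsE //= IH -?consbit_half //; lia.
Qed.

Lemma unbits_lt l : unbits l < 2 ^ size l.
Proof. by elim: l => [|b l IH] //=; rewrite /consbit expnS -muln2; case: b; lia. Qed.

Lemma bits_lt n : n < 2 ^ size (bits n).
Proof. by rewrite -{1}[n]unbitsK unbits_lt. Qed.

Lemma size_bits_le n k : n < 2 ^ k -> size (bits n) <= k.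
Proof.
elim: k n => [|k IH] n; first by case: n => [|n].
case: (posnP n) => [->|h] // hn; rewrite bitsE //=; apply: IH.
by move: hn; rewrite expnS; lia.
Qed.

Lemma size_bits_mono m n : m <= n -> size (bits m) <= size (bits n).
Proof. by move=> h; apply: size_bits_le; apply: leq_ltn_trans h (bits_lt n). Qed.

Lemma size_bits_add m n : size (bits (m + n)) <= size (bits m) + size (bits n) + 1.
Proof.
apply: size_bits_le; have hm := bits_lt m; have hn := bits_lt n.
have h1 : 2 ^ size (bits m) <= 2 ^ (size (bits m) + size (bits n)).
  by rewrite leq_exp2l // leq_addr.
have h2 : 2 ^ size (bits n) <= 2 ^ (size (bits m) + size (bits n)).
  by rewrite leq_exp2l // leq_addl.
by rewrite addn1 expnS; lia.
Qed.

Lemma size_bits_mul m n : size (bits (m * n)) <= size (bits m) + size (bits n).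
Proof.
case: (posnP m) => [->|m0] //; case: (posnP n) => [->|n0]; first by rewrite muln0.
by apply: size_bits_le; rewrite expnD ltn_mul ?bits_lt.
Qed.

Lemma sz_nat_bits n : 2 * size (bits n) + 1 <= sz n <= 4 * size (bits n) + 4.
Proof.
rewrite /sz /enc /enc_natural -/(sz (bits n)).
by elim: (bits n) => [|b l IH] //=; rewrite sz_cons; have := sz_bool b; lia.
Qed.

Lemma size_bits_sz n : size (bits n) <= sz n.
Proof. by have := sz_nat_bits n; lia. Qed.

Lemma size_bits_id n : size (bits n) <= n.
Proof. by apply: size_bits_le; exact: ltn_expl. Qed.

Lemma size_bits_consbit b v : size (bits (consbit b v)) <= (size (bits v)).+1.
Proof. by rewrite bits_consbit; case: ifP. Qed.

Lemma pf_bits A {EA : Enc A} (f : A -> nat) : polyfun f -> polyfun (fun a => bits (f a)).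
Proof. by move=> Pf; exact: (pf_enc Pf). Qed.

(** Prefixing [false] to the empty bit list would give a code of 0 that is not canonical, hence the
    test. *)
Lemma pf_consbit A {EA : Enc A} (f : A -> bool) (g : A -> nat) :
  polyfun f -> polyfun g -> polyfun (fun a => consbit (f a) (g a)).
Proof.
move=> Pf Pg; apply: (@pf_enc _ _ _ _ _ _ (fun a =>
  if f a then f a :: bits (g a)
  else if bits (g a) is x :: l then f a :: bits (g a) else [::])).
  have Pb := pf_bits Pg; apply: pf_if => //; first by pfs.
  apply: (@pf_case _ _ _ _ _ _ (fun a => bits (g a)) (fun => [::])
    (fun x => f x.1 :: bits (g x.1))); [by [] | by pfs |].
  apply: pf_cons.
  - by apply: (@pf_comp _ _ _ _ _ _ (fun x : A * (bool * seq bool) => x.1) f) => //; pfs.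
  - by apply: (@pf_comp _ _ _ _ _ _ (fun x : A * (bool * seq bool) => x.1)
      (fun a => bits (g a))) => //; pfs.
move=> a; rewrite /enc /enc_natural bits_consbit; case: (f a) => //=.
case: (posnP (g a)) => [->|h] //=.
by rewrite bitsE.
Qed.

Lemma pf_unbits A {EA : Enc A} (f : A -> seq bool) :
  polyfun f -> polyfun (fun a => unbits (f a)).
Proof.
move=> Pf.
apply: (@polyfun_eq _ _ _ _ (fun a => foldl (fun v b => consbit b v) 0 (rev (f a)))).
  apply: (@pf_foldl_growth _ _ _ _ _ _ (fun _ v b => consbit b v) (fun a => rev (f a))
    (fun => 0) (fun v => size (bits v)) 4 (fun => 1)).
  - by pfs.
  - by pfs.
  - by apply: pf_consbit; pfs.
  - by move=> b; have := sz_nat_bits b; lia.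
  - exact: pbound_const.
  - by move=> c b a; rewrite addn1; exact: size_bits_consbit.
by move=> a; rewrite foldl_rev.
Qed.

Lemma pf_bool3 A B {EA : Enc A} {EB : Enc B} (g : bool -> bool -> bool -> B)
    (f1 f2 f3 : A -> bool) : polyfun f1 -> polyfun f2 -> polyfun f3 ->
  polyfun (fun a => g (f1 a) (f2 a) (f3 a)).
Proof.
move=> P1 P2 P3; apply: (@polyfun_eq _ _ _ _ (fun a =>
  if f1 a then if f2 a then if f3 a then g true true true else g true true false
                else if f3 a then g true false true else g true false false
  else if f2 a then if f3 a then g false true true else g false true false
                else if f3 a then g false false true else g false false false)); first by pfs.
by move=> a; case: (f1 a); case: (f2 a); case: (f3 a).
Qed.

Section Serial.
Variable g : bool -> bool -> bool -> bool * bool.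

(* A bit-serial automaton with carry [c], reading two numbers from the low end. *)
Fixpoint serial (c : bool) (x y : seq bool) (n : nat) : seq bool * bool :=
  if n is n'.+1 then
    let r := g c (head false x) (head false y) in
    let z := serial r.1 (behead x) (behead y) n' in (r.2 :: z.1, z.2)
  else ([::], c).

Definition serial_step (st : bool * (seq bool * (seq bool * seq bool))) (_ : bool) :=
  let r := g st.1 (head false st.2.1) (head false st.2.2.1) in
  (r.1, (behead st.2.1, (behead st.2.2.1, r.2 :: st.2.2.2))).

Lemma serial_stepE c x y o z :
  let st := foldl serial_step (c, (x, (y, o))) z in
  let r := serial c x y (size z) in (st.2.2.2, st.1) = (rev r.1 ++ o, r.2).
Proof.
elim: z c x y o => [|b z IH] c x y o //=.
by rewrite rev_cons cat_rcons -IH.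
Qed.

(** The fold runs over [x ++ y ++ [:: true]] for its length only: it is longer than both arguments,
    so the last step takes up the final carry. *)
Lemma pf_serial A {EA : Enc A} c (x y : A -> seq bool) : polyfun x -> polyfun y ->
  polyfun (fun a => serial c (x a) (y a) (size (x a ++ y a ++ [:: true]))).
Proof.
move=> Px Py.
pose F a := foldl serial_step (c, (x a, (y a, [::]))) (x a ++ y a ++ [:: true]).
have PF : polyfun F.
  apply: (@pf_foldl_growth _ _ _ _ _ _ (fun _ => serial_step)
    (fun a => x a ++ y a ++ [:: true]) (fun a => (c, (x a, (y a, [::]))))
    (fun b => sz b) 1 (fun => 10)).
  - by pfs.
  - by pfs.
  - have P3 : polyfun (fun st : A * (bool * (seq bool * (seq bool * seq bool)) * bool) =>
      g st.2.1.1 (head false st.2.1.2.1) (head false st.2.1.2.2.1)).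
      by apply: (pf_bool3 g); pfs.
    by rewrite /serial_step; pfs.
  - by move=> b; lia.
  - exact: pbound_const.
  - move=> a [c' [x' [y' o']]] b; rewrite /serial_step !sz_pair /=.
    have h1 : forall l : seq bool, sz (behead l) <= sz l.
      by case=> [|e l] //=; rewrite sz_cons; lia.
    have := h1 x'; have := h1 y'; rewrite sz_cons.
    have := sz_bool (g c' (head false x') (head false y')).1.
    have := sz_bool (g c' (head false x') (head false y')).2.
    have := sz_bool c'; lia.
apply: (@polyfun_eq _ _ _ _ (fun a => (rev (F a).2.2.2, (F a).1))); first by pfs.
move=> a; have := serial_stepE c (x a) (y a) [::] (x a ++ y a ++ [:: true]).
by rewrite -/(F a) /= => -[-> ->]; rewrite cats0 revK -surjective_pairing.
Qed.
End Serial.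

Definition add_bit (c a b : bool) := (if a then b || c else b && c, a (+) b (+) c).
Definition sub_bit (c a b : bool) := (if a then b && c else b || c, a (+) b (+) c).
(** The carry is the verdict on the lower bits, which a differing higher bit overrides. *)
Definition leq_bit (c a b : bool) := (if a == b then c else b, true).

Lemma unbits_head l : unbits l = head false l + (unbits (behead l)).*2.
Proof. by case: l. Qed.

Lemma serial_add (c : bool) x y n : size x < n -> size y < n ->
  unbits (serial add_bit c x y n).1 = c + unbits x + unbits y.
Proof.
elim: n c x y => [|n IH] c x y // hx hy; rewrite (unbits_head x) (unbits_head y) /= /consbit.
case: n IH hx hy => [|n] IH hx hy.
  by case: x y hx hy => [|a x] [|b y] //= _ _; case: c.
rewrite IH /= ?size_behead; [|lia|lia].
by case: c (head false x) (head false y) => [] [] [] /=; lia.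
Qed.

Lemma serial_sub (c : bool) x y n : size x < n -> size y < n -> c + unbits y <= unbits x ->
  unbits (serial sub_bit c x y n).1 = unbits x - (c + unbits y).
Proof.
elim: n c x y => [|n IH] c x y // hx hy; rewrite (unbits_head x) (unbits_head y) /= /consbit.
case: n IH hx hy => [|n] IH hx hy.
  by case: x y hx hy => [|a x] [|b y] //= _ _; case: c.
move=> h; rewrite IH /= ?size_behead; [|lia|lia|];
  by move: h; case: c (head false x) (head false y) => [] [] [] /=; lia.
Qed.

Lemma serial_leq (c : bool) x y n : size x < n -> size y < n ->
  (serial leq_bit c x y n).2 = (unbits x < unbits y) || (unbits x == unbits y) && c.
Proof.
elim: n c x y => [|n IH] c x y // hx hy; rewrite (unbits_head x) (unbits_head y) /= /consbit.
case: n IH hx hy => [|n] IH hx hy.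
  by case: x y hx hy => [|a x] [|b y] //= _ _; case: c.
rewrite IH /= ?size_behead; [|lia|lia].
by case: c (head false x) (head false y) => [] [] [] /=; lia.
Qed.

Section Arith.
Context {A : Type} {EA : Enc A}.
Implicit Types f g : A -> nat.

Lemma pf_addn f g : polyfun f -> polyfun g -> polyfun (fun a => f a + g a).
Proof.
move=> Pf Pg; have P := pf_serial add_bit false (pf_bits Pf) (pf_bits Pg).
apply: polyfun_eq (pf_unbits (pf_fst P)) _ => a.
by rewrite serial_add ?unbitsK // !size_cat /=; lia.
Qed.

Lemma pf_leq f g : polyfun f -> polyfun g -> polyfun (fun a => f a <= g a).
Proof.
move=> Pf Pg; have P := pf_serial leq_bit true (pf_bits Pf) (pf_bits Pg).
apply: polyfun_eq (pf_snd P) _ => a.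
by rewrite serial_leq ?unbitsK; [lia|rewrite !size_cat /=; lia|rewrite !size_cat /=; lia].
Qed.

Lemma pf_ltn f g : polyfun f -> polyfun g -> polyfun (fun a => f a < g a).
Proof.
move=> Pf Pg; apply: polyfun_eq (pf_not (pf_leq Pg Pf)) _ => a.
by rewrite ltnNge.
Qed.

Lemma pf_eqn f g : polyfun f -> polyfun g -> polyfun (fun a => f a == g a).
Proof.
move=> Pf Pg; apply: polyfun_eq (pf_and (pf_leq Pf Pg) (pf_leq Pg Pf)) _ => a.
by rewrite -eqn_leq.
Qed.

Lemma pf_subn f g : polyfun f -> polyfun g -> polyfun (fun a => f a - g a).
Proof.
move=> Pf Pg; have P := pf_serial sub_bit false (pf_bits Pf) (pf_bits Pg).
apply: (polyfun_eq (pf_if (pf_leq Pg Pf) (pf_unbits (pf_fst P)) (pf_const 0))) => a.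
case: leqP => h; last by apply/esym/eqP; rewrite subn_eq0 ltnW.
by rewrite serial_sub ?unbitsK // !size_cat /=; lia.
Qed.

Lemma pf_double f : polyfun f -> polyfun (fun a => (f a).*2).
Proof.
by move=> Pf; apply: polyfun_eq (pf_addn Pf Pf) _ => a; rewrite addnn.
Qed.

End Arith.

Ltac pf_ext_nat := lazymatch goal with
  | |- polyfun (fun x => bits (@?f x)) => refine (@pf_bits _ _ f _)
  | |- polyfun (fun x => unbits (@?f x)) => refine (@pf_unbits _ _ f _)
  | |- polyfun (fun x => consbit (@?f x) (@?g x)) => refine (@pf_consbit _ _ f g _ _)
  | |- polyfun (fun x => @?f x + @?g x) => refine (@pf_addn _ _ f g _ _)
  | |- polyfun (fun x => @?f x - @?g x) => refine (@pf_subn _ _ f g _ _)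
  | |- polyfun (fun x => @?f x < @?g x) => refine (@pf_ltn _ _ f g _ _)
  | |- polyfun (fun x => @?f x <= @?g x) => refine (@pf_leq _ _ f g _ _)
  | |- polyfun (fun x => @?f x == @?g x) => refine (@pf_eqn _ _ f g _ _)
  | |- polyfun (fun x => (@?f x).*2) => refine (@pf_double _ _ f _)
  end.
Ltac pf_ext ::= first [pf_ext_list | pf_ext_nat].

Section Arith2.
Context {A : Type} {EA : Enc A}.
Implicit Types f g : A -> nat.

Lemma pf_muln f g : polyfun f -> polyfun g -> polyfun (fun a => f a * g a).
Proof.
move=> Pf Pg; have [k Hk] := polyfun_sz_pow Pg.
apply: (@polyfun_eq _ _ _ _ (fun a => foldl (fun v (x : bool) => (if x then g a else 0) + v.*2)
  0 (rev (bits (f a))))).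
  apply: (@pf_foldl_growth _ _ _ _ _ _ (fun a v (x : bool) => (if x then g a else 0) + v.*2)
    (fun a => rev (bits (f a))) (fun => 0) (fun v => size (bits v)) 4
    (fun n => (n + 2) ^ k + 2)).
  - by pfs.
  - by pfs.
  - have Pg' : polyfun (fun x : A * (nat * bool) => g x.1).
      by apply: (@pf_comp _ _ _ _ _ _ (fun x : A * (nat * bool) => x.1)) => //; pfs.
    by pfs.
  - by move=> b; have := sz_nat_bits b; lia.
  - by pb.
  - move=> a v x; have h1 := size_bits_add (if x then g a else 0) v.*2.
    have h2 := size_bits_consbit false v; rewrite /consbit add0n in h2.
    have h3 : size (bits (if x then g a else 0)) <= (sz a + 2) ^ k.
      by case: x {h1} => //; apply: leq_trans (Hk a); exact: size_bits_sz.
    have h4 : (sz a + 2) ^ k <= (sz a + sz x + 2) ^ k by apply: leq_exp2w; lia.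
    lia.
move=> a; rewrite foldl_rev -{2}[f a]unbitsK; elim: (bits (f a)) => [|b l /= ->] //.
by rewrite /consbit mulnDl -!muln2; case: b; lia.
Qed.

(** Long division from the highest bit: the state holds quotient and remainder of the part already
    read. *)
Definition div_step (d : nat) (s : nat * nat) (x : bool) : nat * nat :=
  let r := consbit x s.2 in
  if d <= r then (consbit true s.1, r - d) else (consbit false s.1, r).

Lemma div_stepE d n : 0 < d -> foldl (div_step d) (0, 0) (rev (bits n)) = (n %/ d, n %% d).
Proof.
move=> d0; rewrite foldl_rev -{2 3}[n]unbitsK; elim: (bits n) => [|b l /= ->].
  by rewrite /= div0n mod0n.
set m := unbits l; rewrite /div_step /=.
have hm := divn_eq m d; have hr := ltn_pmod m d0.
move: (m %/ d) (m %% d) hm hr => q r hm hr.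
have E : consbit b m = consbit false q * d + consbit b r.
  by rewrite /consbit hm -!muln2 add0n mulnDl addnCA addnA mulnAC; lia.
case: leqP => h.
- have hlt : consbit b r - d < d by move: hr h; rewrite /consbit -!muln2; case: (b); lia.
  have -> : consbit b m = consbit true q * d + (consbit b r - d).
    by rewrite E; move: h; rewrite /consbit -!muln2 add0n [(true + _) * _]mulnDl mul1n; lia.
  by rewrite divnMDl // modnMDl divn_small // modn_small // addn0.
- by rewrite E divnMDl // modnMDl divn_small // modn_small // addn0.
Qed.

(** This is the convention [modn0], so [pf_modn] needs no side condition. *)
Lemma div_step0 n s : (foldl (div_step 0) (s, 0) (rev (bits n))).2 = n.
Proof.
rewrite foldl_rev -{2}[n]unbitsK; elim: (bits n) => [|b l IH] //=.
by rewrite /div_step /= subn0 IH.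
Qed.

Lemma pf_divmod f g : polyfun f -> polyfun g ->
  polyfun (fun a => foldl (div_step (g a)) (0, 0) (rev (bits (f a)))).
Proof.
move=> Pf Pg.
apply: (@pf_foldl_growth _ _ _ _ _ _ (fun a => div_step (g a))
    (fun a => rev (bits (f a))) (fun => (0, 0))
    (fun v => size (bits v.1) + size (bits v.2)) 9 (fun => 2)).
- by pfs.
- by pfs.
- have Pg' : polyfun (fun x : A * (nat * nat * bool) => g x.1).
    by apply: (@pf_comp _ _ _ _ _ _ (fun x : A * (nat * nat * bool) => x.1)) => //; pfs.
  by rewrite /div_step; pfs.
- move=> [q r]; rewrite sz_pair /=; have := sz_nat_bits q; have := sz_nat_bits r; lia.
- exact: pbound_const.
- move=> a [q r] x; rewrite /div_step /=.
  have h1 := size_bits_consbit true q; have h2 := size_bits_consbit false q.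
  have h3 := size_bits_consbit x r.
  have h4 := size_bits_mono (leq_subr (g a) (consbit x r)).
  by case: ifP => _ /=; lia.
Qed.

Lemma pf_modn f g : polyfun f -> polyfun g -> polyfun (fun a => f a %% g a).
Proof.
move=> Pf Pg; apply: polyfun_eq (pf_snd (pf_divmod Pf Pg)) _ => a.
case: (posnP (g a)) => [->|h]; first by rewrite div_step0 modn0.
by rewrite div_stepE.
Qed.

Lemma pf_divn f g : polyfun f -> polyfun g -> polyfun (fun a => f a %/ g a).
Proof.
move=> Pf Pg.
apply: (polyfun_eq (pf_if (pf_eqn Pg (pf_const 0)) (pf_const 0)
  (pf_fst (pf_divmod Pf Pg)))) => a.
by case: eqP => [->|/eqP h] //; rewrite div_stepE // lt0n.
Qed.

End Arith2.

Definition gcd_step (s : nat * nat) (_ : bool) : nat * nat :=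
  if s.2 == 0 then s else (s.2, s.1 %% s.2).

(** Every Euclidean step shortens the pair by at least one bit, because [x %% y] is at most half of
    [x]. *)
Lemma gcd_stepE l x y : y <= x -> size (bits x) + size (bits y) <= size l ->
  (foldl gcd_step (x, y) l).1 = gcdn x y.
Proof.
elim: l x y => [|b l IH] x y hyx /= hl.
  by case: x hyx hl => [|x] hyx hl; [case: y hyx {hl} | rewrite bitsE in hl].
rewrite {2}/gcd_step /=; case: (posnP y) => [->|y0].
  rewrite gcdn0; elim: l {IH hl} => //= c l; rewrite {2}/gcd_step //=.
have hm := ltn_pmod x y0.
have h2 : (x %% y).*2 <= x.
  have := divn_eq x y; have : 0 < x %/ y by rewrite divn_gt0.
  by move: (x %/ y) => q q0 e; rewrite -muln2; nia.
rewrite IH; [by rewrite gcdn_modr gcdnC | by rewrite ltnW | ].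
have : (size (bits (x %% y))).+1 <= size (bits x).
  case: (posnP (x %% y)) => [->|r0].
    by rewrite (bitsE (leq_trans y0 hyx)).
  apply: leq_trans (size_bits_mono h2).
  by have := bits_consbit false (x %% y); rewrite /consbit add0n r0 /= => ->.
lia.
Qed.

Section Arith3.
Context {A : Type} {EA : Enc A}.
Implicit Types f g : A -> nat.

Lemma pf_gcdn f g : polyfun f -> polyfun g -> polyfun (fun a => gcdn (f a) (g a)).
Proof.
move=> Pf Pg.
(* The list leaves room for an additional first step, which merely exchanges the arguments when
   [f a < g a]. *)
pose F a := foldl gcd_step (f a, g a) (bits (f a) ++ bits (g a) ++ bits (g a) ++ [:: true]).
have PF : polyfun F.
  have [Ff PFf Hf] := polyfun_sz Pf; have [Fg PFg Hg] := polyfun_sz Pg.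
  apply: (@pf_foldl _ _ _ _ _ _ (fun _ => gcd_step)
    (fun a => bits (f a) ++ bits (g a) ++ bits (g a) ++ [:: true]) (fun a => (f a, g a))
    (fun n => 9 * (Ff n + Fg n) + 9)).
  - by pfs.
  - by pfs.
  - by rewrite /gcd_step; pfs; apply: pf_modn; pfs.
  - by pb.
  - move=> a m.
    have H : forall l x y, x <= f a + g a -> y <= f a + g a ->
       (foldl gcd_step (x, y) l).1 <= f a + g a /\ (foldl gcd_step (x, y) l).2 <= f a + g a.
      elim=> [|b l IH] x y hx hy //=; rewrite /gcd_step /=.
      case: ifP => _; apply: IH => //.
      by apply: leq_trans (leq_mod _ _) _.
    have [] := H (take m (bits (f a) ++ bits (g a) ++ bits (g a) ++ [:: true])) (f a) (g a).
    + by lia.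
    + by lia.
    case: foldl => x y /= hx hy; rewrite sz_pair /=.
    have := size_bits_mono hx; have := size_bits_mono hy; have := size_bits_add (f a) (g a).
    have := sz_nat_bits x; have := sz_nat_bits y; have := Hf a; have := Hg a.
    have := sz_nat_bits (f a); have := sz_nat_bits (g a); lia.
apply: polyfun_eq (pf_fst PF) _ => a; rewrite /F.
set x := f a; set y := g a.
case: (leqP y x) => h; first by rewrite gcd_stepE // !size_cat; lia.
have y0 : 0 < y by apply: leq_ltn_trans h.
have [b [l [El hl]]] : exists b l, bits x ++ bits y ++ bits y ++ [:: true] = b :: l /\
    size (bits x) + size (bits y) <= size l.
  have := erefl (size (bits x ++ bits y ++ bits y ++ [:: true])).
  case: {1 3}(_ ++ _) => [|b l]; rewrite !size_cat /= => hs; first by lia.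
  by exists b, l; split=> //; lia.
rewrite El /= {2}/gcd_step /= (gtn_eqF y0) modn_small // gcd_stepE; first by rewrite gcdnC.
  exact: ltnW.
lia.
Qed.

Lemma pf_size B {EB : Enc B} (l : A -> seq B) : polyfun l -> polyfun (fun a => size (l a)).
Proof.
move=> Pl.
apply: (@polyfun_eq _ _ _ _ (fun a => foldl (fun n _ => n + 1) 0 (l a))).
  apply: (@pf_foldl_growth _ _ _ _ _ _ (fun _ n _ => n + 1) l (fun => 0)
    (fun v => size (bits v)) 4 (fun => 2)) => //.
  - by pfs.
  - by pfs.
  - by move=> b; have := sz_nat_bits b; lia.
  - exact: pbound_const.
  - by move=> c b _; have := size_bits_add b 1; rewrite /=; lia.
have H (s : seq B) n : foldl (fun n _ => n + 1) n s = n + size s.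
  by elim: s n => [|x s IH] n /=; rewrite ?addn0 // IH; lia.
by move=> a; rewrite H.
Qed.

Lemma pf_iota B {EB : Enc B} (l : A -> seq B) :
  polyfun l -> polyfun (fun a => iota 0 (size (l a))).
Proof.
move=> Pl; have [Fl PFl Hl] := polyfun_sz Pl.
pose st (s : nat * seq nat) (_ : B) := (s.1 + 1, s.1 :: s.2).
have E : forall s, foldl st (0, [::]) s = (size s, rev (iota 0 (size s))).
  elim/last_ind=> [|s x IH] //.
  by rewrite foldl_rcons IH /st size_rcons -[in RHS]addn1 iotaD rev_cat add0n addn1.
have P : polyfun (fun a => foldl st (0, [::]) (l a)).
  apply: (@pf_foldl _ _ _ _ _ _ (fun _ => st) l (fun => (0, [::]))
    (fun n => (4 * Fl n + 4) + (Fl n * (4 * Fl n + 5) + 2))) => //.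
  - by pfs.
  - by rewrite /st; pfs.
  - by pb.
  - move=> a m; rewrite E sz_pair /=; set k := size _.
    have hk : k <= Fl (sz a).
      by apply: leq_trans (Hl a); apply: leq_trans (size_sz _) (sz_take _ _).
    have h1 : forall i, i <= k -> sz i <= 4 * Fl (sz a) + 4.
      by move=> i hi; have := sz_nat_bits i; have := size_bits_id i; lia.
    have h2 : sz (rev (iota 0 k)) <= k * (4 * Fl (sz a) + 5) + 1.
      have h3 : forall s : seq nat, all (fun i => i <= k) s ->
         sz s <= size s * (4 * Fl (sz a) + 5) + 1.
        elim=> [|i s IH] //= /andP[hi /IH hs]; rewrite sz_cons.
        by have := h1 i hi; lia.
      have := h3 (rev (iota 0 k)); rewrite size_rev size_iota; apply.
      by apply/allP => i; rewrite mem_rev mem_iota; lia.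
    have := h1 k (leqnn k); nia.
apply: polyfun_eq (pf_rev (pf_snd P)) _ => a.
by rewrite E /= revK.
Qed.

Lemma pf_nth B {EB : Enc B} (x0 : B) (l : A -> seq B) (i : A -> nat) :
  polyfun l -> polyfun i -> polyfun (fun a => nth x0 (l a) (i a)).
Proof.
move=> Pl Pi.
pose st (k : nat) (s : nat * B) (x : B) := (s.1 + 1, if s.1 == k then x else s.2).
have P : polyfun (fun a => foldl (st (i a)) (0, x0) (l a)).
  apply: (@pf_foldl_growth _ _ _ _ _ _ (fun a => st (i a)) l (fun => (0, x0))
    (fun v => size (bits v.1) + sz v.2) 9 (fun n => n + 2)) => //.
  - by pfs.
  - have Pi' : polyfun (fun x : A * (nat * B * B) => i x.1).
      by apply: (@pf_comp _ _ _ _ _ _ (fun x : A * (nat * B * B) => x.1)) => //; pfs.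
    by rewrite /st; pfs.
  - by move=> [k b]; rewrite sz_pair /=; have := sz_nat_bits k; lia.
  - by pb.
  - move=> a [k b] x; rewrite /st /=; have := size_bits_add k 1.
    by case: ifP => _; rewrite /=; lia.
apply: polyfun_eq (pf_snd P) _ => a.
suff H : forall s n m, (foldl (st (n + m)) (n, x0) s).2 = nth x0 s m.
  by rewrite -[i a]add0n H add0n.
have H2 : forall s n m b, m < n -> (foldl (st m) (n, b) s).2 = b.
  elim=> [|x s IH] n m b h //=; rewrite {2}/st /= ifF; last by lia.
  by apply: IH; lia.
elim=> [|x s IH] n [|m] //=.
  by rewrite {2}/st /= addn0 eqxx H2 //; lia.
by rewrite {2}/st /= ifF; [rewrite -addSnnS -addn1 IH | lia].
Qed.

Lemma pf_sumn (l : A -> seq nat) : polyfun l -> polyfun (fun a => sumn (l a)).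
Proof.
move=> Pl.
apply: (@polyfun_eq _ _ _ _ (fun a => foldl addn 0 (l a))).
  apply: (@pf_foldl_growth _ _ _ _ _ _ (fun _ => addn) l (fun => 0)
    (fun v => size (bits v)) 4 (fun n => n + 1)) => //.
  - by pfs.
  - by pfs.
  - by move=> b; have := sz_nat_bits b; lia.
  - by pb.
  - by move=> c b x; have := size_bits_add b x; have := size_bits_sz x; lia.
by move=> a; rewrite sumnE foldlE big_cons.
Qed.

Definition prodn (s : seq nat) : nat := foldl muln 1 s.

Lemma pf_prodn (l : A -> seq nat) : polyfun l -> polyfun (fun a => prodn (l a)).
Proof.
move=> Pl.
apply: (@pf_foldl_growth _ _ _ _ _ _ (fun _ => muln) l (fun => 1)
  (fun v => size (bits v)) 4 (fun n => n + 1)) => //.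
- by pfs.
- by apply: pf_muln; pfs.
- by move=> b; have := sz_nat_bits b; lia.
- by pb.
- by move=> c b x; have := size_bits_mul b x; have := size_bits_sz x; lia.
Qed.

End Arith3.

Ltac pf_ext_arith := lazymatch goal with
  | |- polyfun (fun x => @?f x * @?g x) => refine (@pf_muln _ _ f g _ _)
  | |- polyfun (fun x => @?f x %/ @?g x) => refine (@pf_divn _ _ f g _ _)
  | |- polyfun (fun x => @?f x %% @?g x) => refine (@pf_modn _ _ f g _ _)
  | |- polyfun (fun x => gcdn (@?f x) (@?g x)) => refine (@pf_gcdn _ _ f g _ _)
  | |- polyfun (fun x => iota 0 (size (@?f x))) => refine (@pf_iota _ _ _ _ f _)
  | |- polyfun (fun x => size (@?f x)) => refine (@pf_size _ _ _ _ f _)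
  | |- polyfun (fun x => nth ?x0 (@?f x) (@?g x)) => refine (@pf_nth _ _ _ _ x0 f g _ _)
  | |- polyfun (fun x => sumn (@?f x)) => refine (@pf_sumn _ _ f _)
  | |- polyfun (fun x => prodn (@?f x)) => refine (@pf_prodn _ _ f _)
  end.
Ltac pf_ext ::= first [pf_ext_list | pf_ext_nat | pf_ext_arith].

(** * The algorithm *)

(* A box: index, width, height and profit with the centre, in common integer units. *)
Definition item := (nat * (nat * (nat * nat)))%type.
Definition ix (x : item) := x.1.
Definition wd (x : item) := x.2.1.
Definition ht (x : item) := x.2.2.1.
Definition pr (x : item) := x.2.2.2.

(** Comparison of the fractions [a / b] and [a' / b'] by cross multiplication; the index breaks
    ties, so that cuts are unambiguous. *)
Definition ltq (a b i a' b' i' : nat) : bool :=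
  (a * b' < a' * b) || (a * b' == a' * b) && (i < i').

Definition ltWH (x y : item) := ltq (wd x) (ht x) (ix x) (wd y) (ht y) (ix y).
Definition ltWP (x y : item) := ltq (wd x) (pr x) (ix x) (wd y) (pr y) (ix y).
Definition ltHP (x y : item) := ltq (ht x) (pr x) (ix x) (ht y) (pr y) (ix y).

Definition thresholds := (item * (item * (item * (item * item))))%type.

(* Roles: 0 = not placed at the centre; r in 1, 2, 3, 4 = inside the top, bottom, left, right
   side; r + 4 (resp. r + 8) = sticking out over the left or bottom (resp. right or top) end
   of that side.  A threshold equal
   to the centre [c] stands for infinity. *)
Definition role (c : nat) (G : seq (item * nat)) (T : thresholds) (x : item) : nat :=
  if ix x == c then 0
  else if has (fun e => ix e.1 == ix x) G then
    head 0 [seq e.2 | e <- G & ix e.1 == ix x]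
  else if has (fun e => (ix e.1 != c) && (pr e.1 < pr x)) G then 0
  else if [|| ix T.1 == ix x, ix T.2.1 == ix x, ix T.2.2.1 == ix x,
              ix T.2.2.2.1 == ix x | ix T.2.2.2.2 == ix x] then 0
  else if (ix T.1 == c) || ltWH x T.1 then
    if (ix T.2.1 == c) || ltWP x T.2.1 then 1
    else if (ix T.2.2.1 == c) || ltWP x T.2.2.1 then 2 else 0
  else
    if (ix T.2.2.2.1 == c) || ltHP x T.2.2.2.1 then 3
    else if (ix T.2.2.2.2 == c) || ltHP x T.2.2.2.2 then 4 else 0.

Definition roles (c : nat) (items : seq item) (GT : seq (item * nat) * thresholds) :=
  [seq (x, role c GT.1 GT.2 x) | x <- items].

Fixpoint words (B : Type) (k : nat) (l : seq B) : seq (seq B) :=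
  if k is k'.+1 then [seq x :: s | x <- l, s <- words k' l] else [:: [::]].

(* Besides the guessed boxes at most 9 boxes of an optimal solution are lost: 4 at the corners
   and the 5 thresholds.  Each is worth at most 1/27 of the guessed boxes, and
   1 - 9/27 = 2/3 >= 1 - 1/e. *)
Definition num_guess := 27.

(** For [n] items there are [(12 n)^27 n^5] candidates, a polynomial number since both exponents are
    constant. *)
Definition candidates (items : seq item) : seq (seq (item * nat) * thresholds) :=
  [seq (G, T) | G <- words num_guess [seq (x, r) | x <- items, r <- iota 1 12],
                T <- [seq (t, q) | t <- items, q <- [seq (t, q) | t <- items, q <-
                      [seq (t, q) | t <- items, q <- [seq (t, q) | t <- items, q <- items]]]]].

Definition lenW (r : nat) (RL : seq (item * nat)) : nat :=
  sumn [seq wd e.1 | e <- RL & e.2 == r].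
Definition lenH (r : nat) (RL : seq (item * nat)) : nat :=
  sumn [seq ht e.1 | e <- RL & e.2 == r].
Definition profit (RL : seq (item * nat)) : nat := sumn [seq pr e.1 | e <- RL & e.2 != 0].
Definition corner (a b : nat) (RL : seq (item * nat)) : bool :=
  size [seq e <- RL | (e.2 == a) || (e.2 == b)] <= 1.
(* A box sticking out needs an arbitrarily short piece of the side.  In our units all lengths
   are even, so there is room for it on a side as soon as 2 units are free. *)
Definition side (len cap r : nat) (RL : seq (item * nat)) : bool :=
  len + (if has (fun e => (e.2 == r + 4) || (e.2 == r + 8)) RL then 2 else 0) <= cap.

(** The pairs of roles meet at the top left, top right, bottom left and bottom right corner, in this
    order. *)
Definition feasible (cw ch : nat) (RL : seq (item * nat)) : bool :=
  [&& corner 5 11 RL, corner 9 12 RL, corner 6 7 RL, corner 10 8 RL,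
      side (lenW 1 RL) cw 1 RL, side (lenW 2 RL) cw 2 RL,
      side (lenH 3 RL) ch 3 RL & side (lenH 4 RL) ch 4 RL].

Definition better (cw ch : nat) (b RL : seq (item * nat)) : seq (item * nat) :=
  if feasible cw ch RL && (profit b < profit RL) then RL else b.

Definition scaled := (nat * (nat * (nat * (nat * seq item))))%type.

Definition solve (I : scaled) : seq (item * nat) :=
  foldl (better I.2.2.1 I.2.2.2.1) [seq (x, 0) | x <- I.2.2.2.2]
    [seq roles I.2.1 I.2.2.2.2 g | g <- candidates I.2.2.2.2].

Definition slack (len cap : nat) : nat := if len < cap then 1 else 0.

(** A box sticking out at the low end stops at [F + d], with [d] its share of the side. The inner
    boxes follow, and a box sticking out at the high end starts where they stop; by evenness a unit
    of the side is left for it. *)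
Definition along (F d len pre r0 r l : nat) : nat :=
  if r == r0 then F + d + pre else if r == r0 + 4 then F + d - l else F + d + len.

Definition preW (r i : nat) (RL : seq (item * nat)) : nat :=
  sumn [seq wd e.1 | e <- RL & (e.2 == r) && (ix e.1 < i)].
Definition preH (r i : nat) (RL : seq (item * nat)) : nat :=
  sumn [seq ht e.1 | e <- RL & (e.2 == r) && (ix e.1 < i)].

Definition onside (r0 r : nat) : bool := [|| r == r0, r == r0 + 4 | r == r0 + 8].

Definition alongW (F cw r0 r i l : nat) (RL : seq (item * nat)) : nat :=
  along F (slack (lenW r0 RL) cw) (lenW r0 RL) (preW r0 i RL) r0 r l.
Definition alongH (F ch r0 r i l : nat) (RL : seq (item * nat)) : nat :=
  along F (slack (lenH r0 RL) ch) (lenH r0 RL) (preH r0 i RL) r0 r l.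

(* The offset [F] keeps all coordinates nonnegative; boxes that do not touch the centre are put
   far to the right. *)
Definition place (F c cw ch : nat) (RL : seq (item * nat)) (e : item * nat) : nat * nat :=
  if ix e.1 == c then (F, F)
  else if onside 1 e.2 then (alongW F cw 1 e.2 (ix e.1) (wd e.1) RL, F + ch)
  else if onside 2 e.2 then (alongW F cw 2 e.2 (ix e.1) (wd e.1) RL, F - ht e.1)
  else if onside 3 e.2 then (F - wd e.1, alongH F ch 3 e.2 (ix e.1) (ht e.1) RL)
  else if onside 4 e.2 then (F + cw, alongH F ch 4 e.2 (ix e.1) (ht e.1) RL)
  else ((ix e.1 + 3) * F, 0).

(** [enc_rat] writes fractions in lowest terms, hence the gcd; the two leading bits are the sign of
    a nonnegative number. *)
Definition enc_frac (m D : nat) : seq bool :=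
  [:: false; false] ++ enc_nat (m %/ gcdn m D) ++ enc_nat (D %/ gcdn m D).

(** At least every width and every height, so the truncated subtractions in [place] and [along] are
    exact. *)
Definition frame (I : scaled) : nat := sumn [seq wd x + ht x | x <- I.2.2.2.2].

Definition output (I : scaled) : seq bool :=
  flatten [seq enc_frac (place (frame I) I.2.1 I.2.2.1 I.2.2.2.1 (solve I) e).1 I.1
            ++ enc_frac (place (frame I) I.2.1 I.2.2.1 I.2.2.2.1 (solve I) e).2 I.1
          | e <- solve I].

(** The two booleans say whether the first half of a two-bit group is pending and which bit it is;
    then come the current token, reversed, and the finished tokens, latest first. *)
Definition tok_state := ((bool * bool) * (seq bool * seq (seq bool)))%type.
Definition tok_step (s : tok_state) (b : bool) : tok_state :=
  if s.1.1 then
    if s.1.2 then ((false, false), ([::], rev s.2.1 :: s.2.2))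
    else ((false, false), (b :: s.2.1, s.2.2))
  else ((true, b), s.2).
Definition tokens (inp : seq bool) : seq (seq bool) :=
  rev (foldl tok_step ((false, false), ([::], [::])) inp).2.2.

(* The first bit of a numerator token is the sign, which is [false] in a valid instance. *)
Definition fracs (t : seq (seq bool)) : seq (nat * nat) :=
  [seq (unbits (behead (nth [::] t (k * 2 + 1))), unbits (nth [::] t (k * 2 + 2)))
  | k <- iota 0 (size t) & k * 2 + 2 < size t].
Definition num_boxes (t : seq (seq bool)) : nat := unbits (head [::] t).
(** On an arbitrary input [iota 0 n] may be exponential in the binary length of [n]. Cutting at the
    number of tokens keeps the list short and changes nothing on an encoded instance. *)
Definition indices (t : seq (seq bool)) : seq nat :=
  [seq i <- iota 0 (size t) | i < num_boxes t].
Definition pairs (idx : seq nat) : seq (nat * nat) :=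
  [seq ij <- [seq (i, j) | i <- idx, j <- idx] | ij.1 < ij.2].
Definition pair_profits (n : nat) (idx : seq nat) (q : seq (nat * nat)) :=
  [seq (nth (0, 0) (pairs idx) k, nth (0, 0) q (2 * n + k)) | k <- iota 0 (size (pairs idx))].
Definition center (idx : seq nat) (z : seq ((nat * nat) * (nat * nat))) : nat :=
  head 0 [seq i <- idx | all (fun e => [|| e.1.1 == i, e.1.2 == i | e.2.1 == 0]) z].
(* The factor 2 makes all scaled lengths even. *)
Definition unit_den (q : seq (nat * nat)) : nat := 2 * prodn [seq r.2 | r <- q].
Definition scale (D : nat) (r : nat * nat) : nat := r.1 * (D %/ r.2).
Definition mk_items (D : nat) (idx : seq nat) (q : seq (nat * nat))
    (z : seq ((nat * nat) * (nat * nat))) : seq item :=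
  [seq (i, (scale D (nth (0, 0) q (2 * i)), (scale D (nth (0, 0) q (2 * i + 1)),
        sumn [seq scale D e.2 | e <- z & (e.1.1 == i) || (e.1.2 == i)]))) | i <- idx].

Definition parse_input (inp : seq bool) : scaled :=
  let t := tokens inp in
  let q := fracs t in
  let idx := indices t in
  let z := pair_profits (num_boxes t) idx q in
  let c := center idx z in
  let D := unit_den q in
  (D, (c, (scale D (nth (0, 0) q (2 * c)), (scale D (nth (0, 0) q (2 * c + 1)),
    mk_items D idx q z)))).

Definition algorithm (inp : seq bool) : seq bool := output (parse_input inp).

(** * Polynomial running time of the algorithm *)

Lemma pf_words A B {EA : Enc A} {EB : Enc B} k (l : A -> seq B) :
  polyfun l -> polyfun (fun a => words k (l a)).
Proof.
move=> Pl; elim: k => [|k IH] /=; first by pfs.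
apply: (@pf_allpairs _ _ _ _ _ _ _ _ (fun _ x s => x :: s)) => //; by pfs.
Qed.

Ltac unfold_items := rewrite /ltWH /ltWP /ltHP /ltq /ix /wd /ht /pr.

Lemma pf_role A {EA : Enc A} (c : A -> nat) (G : A -> seq (item * nat)) (T : A -> thresholds)
    (x : A -> item) : polyfun c -> polyfun G -> polyfun T -> polyfun x ->
  polyfun (fun a => role (c a) (G a) (T a) (x a)).
Proof.
move=> Pc PG PT Px.
apply: (@pf_comp _ _ _ _ _ _ (fun a => (c a, (G a, (T a, x a))))
  (fun y : nat * (seq (item * nat) * (thresholds * item)) => role y.1 y.2.1 y.2.2.1 y.2.2.2)).
  by pfs.
by move: Pc PG PT Px => _ _ _ _; rewrite /role; unfold_items; pfs.
Qed.

Lemma pf_feasible A {EA : Enc A} (cw ch : A -> nat) (RL : A -> seq (item * nat)) :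
  polyfun cw -> polyfun ch -> polyfun RL ->
  polyfun (fun a => feasible (cw a) (ch a) (RL a)).
Proof.
move=> Pw Ph PR; apply: (@pf_comp3 _ _ _ _ _ _ _ _ _ _ cw ch RL feasible) => //.
by move: Pw Ph PR => _ _ _; rewrite /feasible /corner /side /lenW /lenH /wd /ht; pfs.
Qed.

Lemma pf_profit A {EA : Enc A} (RL : A -> seq (item * nat)) :
  polyfun RL -> polyfun (fun a => profit (RL a)).
Proof. by move=> PR; rewrite /profit /pr; pfs. Qed.

Lemma pf_candidates A {EA : Enc A} (l : A -> seq item) :
  polyfun l -> polyfun (fun a => candidates (l a)).
Proof.
move=> Pl; apply: (@pf_comp _ _ _ _ _ _ l candidates) => //.
rewrite /candidates.
have P0 : polyfun (fun l : seq item => l) by pfs.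
have P1 : polyfun (fun l : seq item => [seq (x, r) | x <- l, r <- iota 1 12]) by pfs.
have P2 := pf_words num_guess P1.
apply: (@pf_allpairs _ _ _ _ _ _ _ _ (fun _ G (T : thresholds) => (G, T))) => //.
all: by pfs.
Qed.

(** [better] returns one of its arguments, so the accumulator grows by at most the size of a
    candidate. *)
Lemma pf_solve : polyfun solve.
Proof.
apply: (@pf_foldl_growth _ _ _ _ _ _ (fun I : scaled => better I.2.2.1 I.2.2.2.1)
  (fun I : scaled => [seq roles I.2.1 I.2.2.2.2 g | g <- candidates I.2.2.2.2])
  (fun I : scaled => [seq (x, 0) | x <- I.2.2.2.2]) (fun b => sz b) 1 id).
- apply: (@pf_map _ _ _ _ _ _ (fun (I : scaled) g => roles I.2.1 I.2.2.2.2 g)).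
    by apply: pf_candidates; pfs.
  rewrite /roles.
  apply: (@pf_map _ _ _ _ _ _
    (fun (x : scaled * (seq (item * nat) * thresholds)) y => (y, role x.1.2.1 x.2.1 x.2.2 y))).
    by pfs.
  pfs; apply: (@pf_role _ _ (fun x : scaled * (seq (item * nat) * thresholds) * item =>
    x.1.1.2.1) (fun x => x.1.2.1) (fun x => x.1.2.2) (fun x => x.2)); by pfs.
- by pfs.
- rewrite /better.
  apply: pf_if; [apply: pf_and; [apply: (@pf_feasible _ _
     (fun x : scaled * (seq (item * nat) * seq (item * nat)) => x.1.2.2.1) (fun x => x.1.2.2.2.1)
     (fun x => x.2.2)) |apply: pf_ltn;
     [apply: (@pf_profit _ _ (fun x : scaled * (seq (item * nat) * seq (item * nat)) => x.2.1)) |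
      apply: (@pf_profit _ _
        (fun x : scaled * (seq (item * nat) * seq (item * nat)) => x.2.2)) ]]| |];
    by pfs.
- by move=> b; lia.
- exact: pbound_id.
- by move=> I b RL; rewrite /better; case: ifP => _; lia.
Qed.

Lemma pf_place A {EA : Enc A} (F c cw ch : A -> nat) (RL : A -> seq (item * nat))
    (e : A -> item * nat) :
  polyfun F -> polyfun c -> polyfun cw -> polyfun ch -> polyfun RL -> polyfun e ->
  polyfun (fun a => place (F a) (c a) (cw a) (ch a) (RL a) (e a)).
Proof.
move=> PF Pc Pw Ph PR Pe.
apply: (@pf_comp _ _ _ _ _ _ (fun a => (F a, (c a, (cw a, (ch a, (RL a, e a))))))
  (fun y : nat * (nat * (nat * (nat * (seq (item * nat) * (item * nat))))) =>
     place y.1 y.2.1 y.2.2.1 y.2.2.2.1 y.2.2.2.2.1 y.2.2.2.2.2)).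
  by pfs.
rewrite /place /alongW /alongH /along /onside /slack /lenW /lenH /preW /preH /ix /wd /ht.
by pfs.
Qed.

Lemma pf_enc_nat A {EA : Enc A} (f : A -> nat) : polyfun f -> polyfun (fun a => enc_nat (f a)).
Proof.
move=> Pf; apply: (@polyfun_eq _ _ _ _
  (fun a => flatten [seq [:: false; b] | b <- bits (f a)] ++ [:: true; true])); last by [].
by pfs.
Qed.

Lemma pf_enc_frac A {EA : Enc A} (f g : A -> nat) :
  polyfun f -> polyfun g -> polyfun (fun a => enc_frac (f a) (g a)).
Proof.
move=> Pf Pg; rewrite /enc_frac; apply: pf_cat; first by pfs.
by apply: pf_cat; apply: pf_enc_nat; pfs.
Qed.

Lemma pf_output : polyfun output.
Proof.
have Ps := pf_solve; rewrite /output; apply: pf_flatten.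
apply: (@pf_map _ _ _ _ _ _ (fun (I : scaled) e =>
  enc_frac (place (frame I) I.2.1 I.2.2.1 I.2.2.2.1 (solve I) e).1 I.1
            ++ enc_frac (place (frame I) I.2.1 I.2.2.1 I.2.2.2.1 (solve I) e).2 I.1)) => //.
have Ps' : polyfun (fun x : scaled * (item * nat) => solve x.1).
  by apply: (@pf_comp _ _ _ _ _ _ (fun x : scaled * (item * nat) => x.1) solve) => //; pfs.
have PP : polyfun (fun x : scaled * (item * nat) =>
    place (frame x.1) x.1.2.1 x.1.2.2.1 x.1.2.2.2.1 (solve x.1) x.2).
  refine (@pf_place _ _ (fun x : scaled * (item * nat) => frame x.1) (fun x => x.1.2.1)
    (fun x => x.1.2.2.1) (fun x => x.1.2.2.2.1) (fun x => solve x.1) (fun x => x.2)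
    _ _ _ _ _ _); rewrite /frame /wd /ht; by pfs.
pfs.
- by apply: (@pf_enc_frac _ _ (fun x : scaled * (item * nat) =>
    (place (frame x.1) x.1.2.1 x.1.2.2.1 x.1.2.2.2.1 (solve x.1) x.2).1) (fun x => x.1.1)); pfs.
- by apply: (@pf_enc_frac _ _ (fun x : scaled * (item * nat) =>
    (place (frame x.1) x.1.2.1 x.1.2.2.1 x.1.2.2.2.1 (solve x.1) x.2).2) (fun x => x.1.1)); pfs.
Qed.

Lemma pf_tokens : polyfun tokens.
Proof.
rewrite /tokens; apply: pf_rev; apply: pf_snd; apply: pf_snd.
apply: (@pf_foldl_growth _ _ _ _ _ _ (fun _ => tok_step) (fun inp : seq bool => inp)
  (fun => ((false, false), ([::], [::]))) (fun b => sz b) 1 (fun n => n + 10)).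
- by pfs.
- by pfs.
- by rewrite /tok_step; pfs.
- by move=> b; lia.
- by pb.
- move=> c [[h v] [cur ts]] b; rewrite /tok_step /=.
  have := sz_bool v; have := sz_bool b; have : sz true = 3 by []; have : sz false = 1 by [].
  by case: h; [case: v|]; rewrite !sz_pair /= ?sz_cons ?sz_rev ?sz_nil; lia.
Qed.

Lemma pf_parse_input : polyfun parse_input.
Proof.
have Pt := pf_tokens.
apply: (@pf_comp _ _ _ _ _ _ tokens (fun t => let q := fracs t in
  let idx := indices t in let z := pair_profits (num_boxes t) idx q in
  let c := center idx z in let D := unit_den q in
  (D, (c, (scale D (nth (0, 0) q (2 * c)), (scale D (nth (0, 0) q (2 * c + 1)),
    mk_items D idx q z)))))) => //.
have P1 : polyfun (fun t => (fracs t, (indices t, num_boxes t))).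
  by rewrite /indices /fracs /num_boxes; pfs.
apply: (pf_comp P1 (g := fun y : seq (nat * nat) * (seq nat * nat) =>
  let z := pair_profits y.2.2 y.2.1 y.1 in let c := center y.2.1 z in
  let D := unit_den y.1 in
  (D, (c, (scale D (nth (0, 0) y.1 (2 * c)), (scale D (nth (0, 0) y.1 (2 * c + 1)),
    mk_items D y.2.1 y.1 z)))))).
have P2 : polyfun (fun y : seq (nat * nat) * (seq nat * nat) =>
    (y.1, (y.2.1, (unit_den y.1, pair_profits y.2.2 y.2.1 y.1)))).
  by rewrite /unit_den /pair_profits /pairs; pfs.
apply: (pf_comp P2 (g := fun y :
    seq (nat * nat) * (seq nat * (nat * seq ((nat * nat) * (nat * nat)))) =>
  let c := center y.2.1 y.2.2.2 in
  (y.2.2.1, (c, (scale y.2.2.1 (nth (0, 0) y.1 (2 * c)),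
    (scale y.2.2.1 (nth (0, 0) y.1 (2 * c + 1)), mk_items y.2.2.1 y.2.1 y.1 y.2.2.2)))))).
by rewrite /mk_items /center /scale /=; pfs.
Qed.

Lemma pf_algorithm : polyfun algorithm.
Proof. exact: (pf_comp pf_parse_input pf_output). Qed.

(** * The approximation ratio *)

Section Exchange.
Variable n : nat.
Local Notation I := 'I_n.
Implicit Types (a b : I -> nat) (X Y Z Q V : {set I}).

(** Summing the pairwise inequality over [X] and [Y] gives an inequality between products of sums,
    from which the sums of [a] cancel. If the sum of [a] over [Y] is 0, positivity forces [X] to be
    empty. *)
Lemma exchange a b X Y : (forall x, x \in X -> 0 < a x) ->
  (forall x y, x \in X -> y \in Y -> a y * b x <= a x * b y) ->
  \sum_(x in X) a x <= \sum_(y in Y) a y -> \sum_(x in X) b x <= \sum_(y in Y) b y.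
Proof.
move=> apos H le.
have H2 : (\sum_(y in Y) a y) * (\sum_(x in X) b x) <= (\sum_(x in X) a x) * (\sum_(y in Y) b y).
  rewrite mulnC !big_distrlr /=; apply: leq_sum => x Xx; apply: leq_sum => y Yy.
  by rewrite mulnC; exact: H.
case: (posnP (\sum_(y in Y) a y)) => [a0|apos'].
  rewrite a0 leqn0 sum_nat_eq0 in le; rewrite big1 // => x Xx.
  by have := forall_inP le x Xx; have := apos x Xx; case: (a x).
rewrite -(leq_pmul2l apos'); apply: leq_trans H2 _.
by rewrite leq_mul2r le orbT.
Qed.

Lemma exchange_sets a b Q V : (forall x, 0 < a x) ->
  (forall x y, x \in Q :\: V -> y \in V :\: Q -> a y * b x <= a x * b y) ->
  \sum_(x in Q) a x <= \sum_(x in V) a x -> \sum_(x in Q) b x <= \sum_(x in V) b x.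
Proof.
move=> apos Hab; rewrite !(big_setID V (A := Q)) !(big_setID Q (A := V)) /= (setIC V) !leq_add2l.
exact: exchange.
Qed.

Definition lto a b (i j : I) : bool := ltq (a i) (b i) i (a j) (b j) j.

Lemma lto_irr a b i : lto a b i i = false.
Proof. by rewrite /lto /ltq ltnn ltnn andbF. Qed.

Lemma lto_le a b i j : lto a b i j -> a i * b j <= a j * b i.
Proof. by rewrite /lto /ltq; lia. Qed.

Lemma lto_total a b i j : i != j -> lto a b i j || lto a b j i.
Proof. by rewrite /lto /ltq -val_eqE /=; lia. Qed.

Lemma lto_asym a b i j : lto a b i j -> lto a b j i = false.
Proof. by rewrite /lto /ltq; lia. Qed.

Lemma lto_trans a b j i k : 0 < b i -> 0 < b j -> 0 < b k ->
  lto a b i j -> lto a b j k -> lto a b i k.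
Proof.
rewrite /lto /ltq; move: (a i) (a j) (a k) (b i) (b j) (b k) => ai aj ak bi bj bk bi0 bj0 bk0.
move: (nat_of_ord i) (nat_of_ord j) (nat_of_ord k) => x y z.
have E1 : (ai * bk < ak * bi) = (ai * bj * bk < ak * bj * bi).
  by rewrite !(mulnAC _ bj) ltn_pmul2r.
have E2 : (ai * bk == ak * bi) = (ai * bj * bk == ak * bj * bi).
  by rewrite !(mulnAC _ bj) eqn_pmul2r.
rewrite {}E1 {}E2.
have -> : (ai * bj < aj * bi) = (ai * bj * bk < aj * bi * bk) by rewrite ltn_pmul2r.
have -> : (ai * bj == aj * bi) = (ai * bj * bk == aj * bi * bk) by rewrite eqn_pmul2r.
have -> : (aj * bk < ak * bj) = (aj * bi * bk < ak * bj * bi).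
  by rewrite (mulnAC aj) ltn_pmul2r.
have -> : (aj * bk == ak * bj) = (aj * bi * bk == ak * bj * bi).
  by rewrite (mulnAC aj) eqn_pmul2r.
lia.
Qed.

Lemma lto_max a b X : X != set0 -> (forall x, x \in X -> 0 < b x) ->
  exists2 u, u \in X & forall x, x \in X -> x != u -> lto a b x u.
Proof.
move: {2}#|X| (leqnn #|X|) => m; elim: m X => [|m IH] X.
  by rewrite leqn0 cards_eq0 => /eqP->; rewrite eqxx.
move=> hm /set0Pn[v Xv] bpos.
case: (eqVneq (X :\ v) set0) => [e|ne].
  exists v => // x Xx xv; have : x \in X :\ v by rewrite in_setD1 xv.
  by rewrite e in_set0.
have [||u] := IH _ _ ne.
- by have := cardsD1 v X; rewrite Xv; lia.
- by move=> x /setD1P[_ /bpos].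
rewrite in_setD1 => /andP[uv Xu] hu.
case/orP: (lto_total a b uv) => h.
- exists v => // x Xx xv; case: (eqVneq x u) => [->//|xu].
  by apply: lto_trans (hu _ _ xu) h; rewrite ?bpos // in_setD1 xv.
- exists u => // x Xx xu; case: (eqVneq x v) => [->//|xv].
  by apply: hu => //; rewrite in_setD1 xv.
Qed.

(** Induction by removing the largest element: a cut of the remaining set is still a cut, and if the
    remaining set fits, the only place to cut is at the largest element. *)
Lemma prefix_cut a b X m : (forall x, x \in X -> 0 < b x) ->
  \sum_(x in X) a x <= m \/
  exists2 u, u \in X & \sum_(x in X | lto a b x u) a x <= m
                       < \sum_(x in X | lto a b x u) a x + a u.
Proof.
move: {2}#|X| (leqnn #|X|) => k; elim: k X => [|k IH] X.
  by rewrite leqn0 cards_eq0 => /eqP-> _; left; rewrite big_set0.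
move=> hk bpos; case: (eqVneq X set0) => [->|ne]; first by left; rewrite big_set0.
have [u Xu hu] := lto_max a ne bpos.
have E : \sum_(x in X :\ u) a x = \sum_(x in X | lto a b x u) a x.
  apply: eq_bigl => x; rewrite in_setD1 andbC; case Xx: (x \in X) => //=.
  by case: (eqVneq x u) => [->|xu]; rewrite ?lto_irr ?hu.
have E2 : \sum_(x in X) a x = a u + \sum_(x in X :\ u) a x by rewrite (big_setD1 u).
have [||h|[v]] := IH (X :\ u).
- by have := cardsD1 u X; rewrite Xu; lia.
- by move=> x /setD1P[_ /bpos].
- case: (leqP (\sum_(x in X) a x) m) => h'; first by left.
  by right; exists u => //; rewrite -E h addnC -E2.
rewrite in_setD1 => /andP[vu Xv] h; right; exists v => //.
rewrite [X in X <= _](_ : _ = \sum_(x in X :\ u | lto a b x v) a x); last first.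
  apply: eq_bigl => x; rewrite in_setD1; case: (eqVneq x u) => [->|//].
  by rewrite (lto_asym (hu v Xv vu)) andbF.
rewrite [X in _ < X + _](_ : _ = \sum_(x in X :\ u | lto a b x v) a x) //.
apply: eq_bigl => x; rewrite in_setD1; case: (eqVneq x u) => [->|//].
by rewrite (lto_asym (hu v Xv vu)) andbF.
Qed.

Variables (c : I) (W H P : I -> nat).
Hypotheses (Wpos : forall i, 0 < W i) (Hpos : forall i, 0 < H i)
  (Ppos : forall i, i != c -> 0 < P i).

Definition before a b (t x : I) : bool := (t == c) || lto a b x t.

Lemma cut_sides (A B : {set I}) : c \notin A -> c \notin B -> [disjoint A & B] ->
  exists2 t, (t == c) || (t \in A :|: B) &
    \sum_(x in A :|: B | (x != t) && before W H t x) W x <= \sum_(x in A) W x /\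
    \sum_(x in A :|: B | (x != t) && ~~ before W H t x) H x <= \sum_(x in B) H x.
Proof.
move=> cA cB dAB; have [X XE] : exists X, X = A :|: B by eexists.
rewrite -XE.
have [|h|[u Xu /andP[h1 h2]]] := @prefix_cut W H X (\sum_(x in A) W x).
- by move=> x _; exact: Hpos.
- exists c; rewrite ?eqxx //; split.
    apply: leq_trans h; rewrite [X in _ <= X](bigID (fun x => (x != c) && before W H c x)) /=.
    exact: leq_addr.
  by rewrite big1 // => x; rewrite /before eqxx andbF andbF.
have uc : u != c by apply: contraTneq Xu => ->; rewrite XE in_setU negb_or cA.
exists u; first by rewrite Xu orbT.
rewrite /before (negbTE uc) /=; split.
  apply: leq_trans h1; rewrite [X in X <= _](eq_bigl (fun x => (x \in X) && lto W H x u)) //.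
  by move=> x; case: (eqVneq x u) => [->|//]; rewrite lto_irr !andbF.
(* [V], the prefix with its cut box, is at least as wide as [A] and has the smallest ratios. By
   exchange its total height is at least that of [A], so its complement is at most as high as
   [B]. *)
pose V := [set x in X | (x == u) || lto W H x u].
have VX : V \subset X by apply/subsetP => x; rewrite inE => /andP[].
have leW : \sum_(x in A) W x <= \sum_(x in V) W x.
  apply: ltnW; apply: leq_trans h2 _; rewrite (big_setD1 u) /= ?inE ?Xu ?eqxx // addnC leq_add2l.
  rewrite leq_eqVlt; apply/orP; left; apply/eqP; apply: eq_bigl => x; rewrite !inE.
  by case: (eqVneq x u) => [->|xu]; rewrite ?lto_irr ?andbF.
have leH : \sum_(x in A) H x <= \sum_(x in V) H x.
  apply: exchange_sets leW => // x y; rewrite !in_setD !inE => /andP[nV Ax] /and3P[_ Xy hy].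
  have Xx : x \in X by rewrite XE in_setU Ax.
  move: nV; rewrite Xx /= negb_or => /andP[xu nlt].
  have ux : lto W H u x by case/orP: (lto_total W H xu) => //; rewrite (negbTE nlt).
  apply: (@lto_le W H y x).
  by case/orP: hy => [/eqP->//|hy]; apply: lto_trans hy ux; exact: Hpos.
have HX : \sum_(x in X) H x = \sum_(x in A) H x + \sum_(x in B) H x.
  by rewrite XE -bigU //; apply: eq_bigl => x; rewrite in_setU.
have HV : \sum_(x in X) H x = \sum_(x in V) H x +
    \sum_(x in X | (x != u) && ~~ lto W H x u) H x.
  rewrite (big_setID V) (setIidPr VX) /=; congr (_ + _); apply: eq_bigl => x.
  by rewrite !inE; case: (x \in X) => //=; rewrite ?andbF // andbT negb_or.
by rewrite -(leq_add2l (\sum_(x in V) H x)) -HV HX leq_add2r.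
Qed.

Definition profit1 (u : I) : nat := if u == c then 0 else P u.

(** [u1] and [u2] are the boxes at which the first and the second bin overflow, in the order of
    decreasing density. All boxes up to [u2] together exceed [m1 + m2], so by exchange they are
    worth at least as much as any [Q] that fits: the bound of the fractional knapsack. *)
Lemma greedy_fill (a : I -> nat) (Z : {set I}) m1 m2 :
  (forall i, 0 < a i) -> c \notin Z ->
  exists u1 u2, [/\ (u1 == c) || (u1 \in Z), (u2 == c) || (u2 \in Z),
    \sum_(x in Z | [&& x != u1, x != u2 & before a P u1 x]) a x <= m1,
    \sum_(x in Z | [&& x != u1, x != u2, ~~ before a P u1 x & before a P u2 x]) a x <= m2 &
    forall Q : {set I}, Q \subset Z -> \sum_(x in Q) a x <= m1 + m2 ->
      \sum_(x in Q) P x <=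
        \sum_(x in Z | [&& x != u1, x != u2 & before a P u1 x]) P x +
        \sum_(x in Z | [&& x != u1, x != u2, ~~ before a P u1 x & before a P u2 x]) P x +
        profit1 u1 + profit1 u2].
Proof.
move=> apos cZ.
have Zc x : x \in Z -> x != c by move=> Zx; apply: contraNneq cZ => <-.
have ZP x : x \in Z -> 0 < P x by move=> /Zc; exact: Ppos.
have subP (Q : {set I}) (R : pred I) : (forall x, x \in Q -> R x) ->
    \sum_(x in Q) P x <= \sum_(x | R x) P x.
  move=> h; rewrite [X in _ <= X](bigID (mem Q)) /=; apply: leq_trans (leq_addr _ _).
  by rewrite [X in _ <= X](eq_bigl (mem Q)) // => x; case Qx: (x \in Q); rewrite ?andbF // h.
have [h|[u1 Zu1 /andP[h1 h1']]] := prefix_cut a m1 ZP.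
  (* Everything fits into the first bin, so both thresholds are infinite. *)
  exists c, c; rewrite eqxx; split=> //.
  - rewrite (eq_bigl (mem Z)) // => x; rewrite /before eqxx /= andbT.
    by case Zx: (x \in Z) => //=; rewrite Zc.
  - by rewrite big1 // => x; rewrite /before eqxx !andbF.
  - move=> Q /subsetP QZ _; rewrite -!addnA; apply: leq_trans (leq_addr _ _).
    apply: subP => x Qx; rewrite /before eqxx QZ //= andbT; by rewrite Zc ?QZ.
pose Z2 := [set x in Z | (x != u1) && ~~ lto a P x u1].
have u1c := Zc _ Zu1.
have Z2Z x : x \in Z2 -> x \in Z by rewrite inE => /andP[].
have Z2lt x : x \in Z2 -> lto a P u1 x.
  rewrite inE => /and3P[Zx xu nlt]; case/orP: (lto_total a P xu) => //.
  by rewrite (negbTE nlt).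
have [|h|[u2 Zu2 /andP[h2 h2']]] := @prefix_cut a P Z2 m2.
- by move=> x /Z2Z /ZP.
(* Everything but [u1] fits into the two bins. *)
- exists u1, c; rewrite eqxx Zu1 orbT /before (negbTE u1c) eqxx /=; split=> //.
  + rewrite (eq_bigl (fun x => (x \in Z) && lto a P x u1)) // => x.
    case Zx: (x \in Z) => //=; rewrite Zc //=.
    by case: (eqVneq x u1) => [->|//]; rewrite lto_irr.
  + rewrite (eq_bigl (mem Z2)) // => x; rewrite !inE andbT; case Zx: (x \in Z) => //=.
    by rewrite Zc.
  + move=> Q /subsetP QZ _; rewrite /profit1 (negbTE u1c) eqxx addn0 [_ + P u1]addnC.
    apply: leq_trans (_ : \sum_(x in Z) P x <= _); first exact: subP.
    rewrite (bigD1 u1) //= leq_add2l (bigID (fun x => lto a P x u1)) /=.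
    apply: leq_add; rewrite leq_eqVlt; apply/orP; left; apply/eqP; apply: eq_bigl => x.
      by case Zx: (x \in Z) => //=; rewrite Zc.
    by case Zx: (x \in Z) => //=; rewrite Zc //= andbT.
have u2c : u2 != c by apply: Zc; exact: Z2Z.
have lt12 := Z2lt _ Zu2.
exists u1, u2; rewrite Zu1 (Z2Z _ Zu2) !orbT /before (negbTE u1c) (negbTE u2c) /=.
have E1 (f : I -> nat) : \sum_(x in Z | [&& x != u1, x != u2 & lto a P x u1]) f x =
    \sum_(x in Z | lto a P x u1) f x.
  apply: eq_bigl => x; case Zx: (x \in Z) => //=.
  case: (eqVneq x u1) => [->|_]; first by rewrite lto_irr.
  by case: (eqVneq x u2) => [->|//]; rewrite (lto_asym lt12).
have E2 (f : I -> nat) :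
    \sum_(x in Z | [&& x != u1, x != u2, ~~ lto a P x u1 & lto a P x u2]) f x =
    \sum_(x in Z2 | lto a P x u2) f x.
  apply: eq_bigl => x; rewrite inE; case Zx: (x \in Z) => //=.
  case: (eqVneq x u1) => //= _; case: (eqVneq x u2) => [->|//] /=.
  by rewrite lto_irr andbF.
rewrite !{}E1 !{}E2; split=> // Q /subsetP QZ hQ.
(* The boxes up to and including [u2], which overflow the two bins together. *)
pose V := [set x in Z | (x == u2) || lto a P x u2].
have EV (f : I -> nat) : \sum_(x in V) f x =
   \sum_(x in Z | lto a P x u1) f x + \sum_(x in Z2 | lto a P x u2) f x + f u1 + f u2.
  have Vu2 : u2 \in V by rewrite inE Z2Z //= eqxx.
  have u12 : u1 != u2 by apply/eqP => e; move: lt12; rewrite e lto_irr.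
  have Vu1 : u1 \in V :\ u2 by rewrite !inE u12 Zu1 lt12 orbT.
  rewrite (big_setD1 u2) //= (big_setD1 u1) //= addnC; congr (_ + _).
  rewrite addnC; congr (_ + _).
  rewrite (bigID (fun x => lto a P x u1)) /=; congr (_ + _); apply: eq_bigl => x; rewrite !inE.
    case: (eqVneq x u1) => [->|xu1] /=; first by rewrite lto_irr andbF.
    case: (eqVneq x u2) => [->|xu2] /=; first by rewrite (lto_asym lt12) andbF.
    case Zx: (x \in Z) => //=; case lx: (lto a P x u1); rewrite ?andbF ?andbT //.
    by apply: lto_trans lx lt12; apply: ZP => //; exact: Z2Z.
  case: (eqVneq x u1) => [->|xu1] /=; first by rewrite andbF.
  case: (eqVneq x u2) => [->|xu2] /=; first by rewrite lto_irr andbF.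
  by case: (x \in Z); case: (lto a P x u1); case: (lto a P x u2).
rewrite /profit1 (negbTE u1c) (negbTE u2c) -(EV P).
have hV : \sum_(x in Q) a x <= \sum_(x in V) a x.
  rewrite EV; apply: leq_trans hQ _; move: (\sum_(x in Z | _) _) (\sum_(x in Z2 | _) _) h1' h2'.
  by move=> s1 s2; lia.
apply: (exchange_sets apos _ hV) => x y; rewrite !inE.
move=> /andP[nV Qx] /andP[_ /andP[Zy hy]].
move: nV; rewrite (QZ x Qx) /= negb_or => /andP[xu nlt].
have ux : lto a P u2 x by case/orP: (lto_total a P xu) => //; rewrite (negbTE nlt).
apply: (@lto_le a P y x).
case/orP: hy => [/eqP->//|hy]; apply: lto_trans hy ux; apply: ZP => //.
  exact: Z2Z.
exact: QZ.
Qed.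

Lemma top_subset (S : {set I}) k : k <= #|S| ->
  exists2 G : {set I}, G \subset S & #|G| = k /\
    forall g s, g \in G -> s \in S :\: G -> P s <= P g.
Proof.
elim: k => [|k IH] hk.
  by exists set0; rewrite ?sub0set ?cards0 //; split=> // g s; rewrite in_set0.
have [G GS [cG hG]] := IH (ltnW hk).
have : 0 < #|S :\: G| by rewrite cardsDS // cG subn_gt0.
case/card_gt0P=> m0 hm0; case: (@arg_maxnP _ m0 (fun i => i \in S :\: G) P hm0) => m Dm hm.
have [Sm nGm] : m \in S /\ m \notin G by move: Dm; rewrite in_setD => /andP[].
exists (m |: G); first by rewrite subUset sub1set Sm.
rewrite cardsU1 nGm cG; split=> // g s; rewrite !inE negb_or.
move=> /orP[/eqP->|Gg] /andP[/andP[sm Gs] Ss].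
  by apply: hm; rewrite !inE Gs.
by apply: hG => //; rewrite inE Gs.
Qed.

End Exchange.

(** * Completeness of the search *)

Lemma mem_words (B : eqType) k (l s : seq B) :
  size s = k -> {subset s <= l} -> s \in words k l.
Proof.
elim: k s => [|k IH] [|x s] //= [hs] sub.
apply/allpairsP; exists (x, s) => /=; split=> //; first by apply: sub; rewrite mem_head.
by apply: IH => // y ys; apply: sub; rewrite in_cons ys orbT.
Qed.

Section Guess.
Variable n : nat.
Local Notation I := 'I_n.
Variables (c : I) (W H P : I -> nat).

Definition item_of (i : I) : item := (i : nat, (W i, (H i, P i))).
Definition assign (rho : I -> nat) : seq (item * nat) :=
  [seq (item_of i, rho i) | i <- enum 'I_n].

Lemma sumn_assign (rho : I -> nat) (f : item -> nat) (g : item * nat -> bool) :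
  sumn [seq f e.1 | e <- assign rho & g e] =
  \sum_(i | g (item_of i, rho i)) f (item_of i).
Proof. by rewrite sumnE big_map big_filter big_map big_enum_cond. Qed.

Lemma lenW_assign rho r : lenW r (assign rho) = \sum_(i | rho i == r) W i.
Proof. exact: sumn_assign. Qed.
Lemma lenH_assign rho r : lenH r (assign rho) = \sum_(i | rho i == r) H i.
Proof. exact: sumn_assign. Qed.
Lemma profit_assign rho : profit (assign rho) = \sum_(i | rho i != 0) P i.
Proof. exact: (sumn_assign rho pr (fun e => e.2 != 0)). Qed.
Lemma preW_assign rho r i :
  preW r i (assign rho) = \sum_(j : I | (rho j == r) && (j < i)) W j.
Proof. exact: (sumn_assign rho wd (fun e => (e.2 == r) && (ix e.1 < i))). Qed.
Lemma preH_assign rho r i :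
  preH r i (assign rho) = \sum_(j : I | (rho j == r) && (j < i)) H j.
Proof. exact: (sumn_assign rho ht (fun e => (e.2 == r) && (ix e.1 < i))). Qed.

Lemma corner_assign rho a b :
  corner a b (assign rho) = (#|[set i | (rho i == a) || (rho i == b)]| <= 1).
Proof.
rewrite /corner -sum1_size big_filter big_map big_enum_cond /= sum1dep_card.
by rewrite cardsE.
Qed.

Lemma has_assign rho (g : nat -> bool) :
  has (fun e => g e.2) (assign rho) = [exists i, g (rho i)].
Proof.
rewrite has_map; apply/hasP/existsP => [[i _ hi]|[i hi]]; first by exists i.
by exists i => //; rewrite mem_enum.
Qed.

Lemma side_assign rho len cap r : side len cap r (assign rho) =
  (len + (if [exists i, (rho i == r + 4) || (rho i == r + 8)] then 2 else 0) <= cap).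
Proof. by rewrite /side (has_assign rho (fun x => (x == r + 4) || (x == r + 8))). Qed.

Lemma roles_assign GT : roles c [seq item_of i | i <- enum 'I_n] GT =
  assign (fun i => role c GT.1 GT.2 (item_of i)).
Proof. by rewrite /roles -map_comp. Qed.

Hypotheses (Wpos : forall i, 0 < W i) (Hpos : forall i, 0 < H i)
  (Ppos : forall i, i != c -> 0 < P i).
Variable rho : I -> nat.
Hypotheses (rho_c : rho c = 0) (rho_le : forall i, rho i <= 12)
  (rho_feasible : feasible (W c) (H c) (assign rho)).

Section WithGuess.
Variables (G : {set I}) (t u1 u2 v1 v2 : I).
Hypothesis Gc : c \notin G.
Hypothesis Gsize : #|G| <= num_guess.
Hypothesis Grho : forall g, g \in G -> rho g != 0.

(** The search tries words of length exactly 27. A smaller guess is padded with the centre, which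
    [role] sends to 0 before consulting the list and skips when comparing profits. *)
Definition guess_list : seq (item * nat) :=
  [seq (item_of i, rho i) | i <- enum G] ++ nseq (num_guess - #|G|) (item_of c, 1).
Definition guess : seq (item * nat) * thresholds :=
  (guess_list, (item_of t, (item_of u1, (item_of u2, (item_of v1, item_of v2))))).

Lemma guess_candidate : guess \in candidates [seq item_of i | i <- enum 'I_n].
Proof.
have mI i : item_of i \in [seq item_of i | i <- enum 'I_n].
  by apply: map_f; rewrite mem_enum.
apply/allpairsP; exists guess; split; last by [].
- rewrite -[guess.1]/guess_list; apply: mem_words.
    by rewrite size_cat size_map size_nseq -cardE subnKC.
  move=> e; rewrite mem_cat => /orP[/mapP[i Gi ->]|/nseqP[-> _]].
    apply/allpairsP; exists (item_of i, rho i); split=> //=.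
    rewrite mem_enum in Gi; have := Grho Gi; have := rho_le i.
    by case: (rho i) => [|[|[|[|[|[|[|[|[|[|[|[|[|k]]]]]]]]]]]]].
  by apply/allpairsP; exists (item_of c, 1); split=> //=.
- apply/allpairsP; exists (item_of t, (item_of u1, (item_of u2, (item_of v1, item_of v2)))).
  split=> //=.
  apply/allpairsP; exists (item_of u1, (item_of u2, (item_of v1, item_of v2))); split=> //=.
  apply/allpairsP; exists (item_of u2, (item_of v1, item_of v2)); split=> //=.
  by apply/allpairsP; exists (item_of v1, item_of v2); split=> /=.
Qed.

Lemma has_guess (i : I) : i != c ->
  has (fun e => ix e.1 == ix (item_of i)) guess_list = (i \in G).
Proof.
move=> ic; rewrite has_cat has_nseq has_map.
rewrite [(c : nat) == _](_ : _ = false); last by apply/negbTE; rewrite eq_sym.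
rewrite andbF orbF; apply/hasP/idP => [[j]|Gi].
  by rewrite mem_enum => Gj /eqP/val_inj<-.
by exists i; rewrite ?mem_enum //= eqxx.
Qed.

Lemma head_guess (i : I) : i \in G ->
  head 0 [seq e.2 | e <- guess_list & ix e.1 == ix (item_of i)] = rho i.
Proof.
move=> Gi; rewrite filter_cat map_cat.
have : i \in enum G by rewrite mem_enum.
elim: (enum G) => [|j s IH] //; rewrite in_cons /= eq_sym.
case: (eqVneq j i) => [-> _|ne /= Hs]; first by rewrite eqxx.
rewrite ifF; last by apply: contra_neqF ne => /eqP /val_inj.
exact: IH.
Qed.

Lemma has_guess_lt (i : I) :
  has (fun e => (ix e.1 != c) && (pr e.1 < pr (item_of i))) guess_list =
  [exists g in G, P g < P i].
Proof.
rewrite has_cat has_nseq has_map /= eqxx andbF orbF.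
apply/hasP/existsP => [[g]|[g /andP[Gg hg]]].
  by rewrite mem_enum => Gg /andP[_ h]; exists g; rewrite Gg.
exists g; rewrite ?mem_enum //=; apply/andP; split=> //.
by apply: contraNneq Gc => /val_inj <-.
Qed.

Definition rest : {set I} :=
  [set i | [&& i != c, i \notin G & ~~ [exists g in G, P g < P i]]].

Lemma role_guess (i : I) : role c guess.1 guess.2 (item_of i) =
  if i \in G then rho i
  else if i \notin rest then 0
  else if i \in [:: t; u1; u2; v1; v2] then 0
  else if before c W H t i then if before c W P u1 i then 1 else if before c W P u2 i then 2 else 0
  else if before c H P v1 i then 3 else if before c H P v2 i then 4 else 0.
Proof.
rewrite /role; case: (eqVneq i c) => [->|ic].
  by rewrite eqxx (negbTE Gc) inE eqxx.
rewrite ifF; last by apply: contra_neqF ic => /eqP/val_inj.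
rewrite has_guess //; case Gi: (i \in G); first exact: head_guess.
rewrite has_guess_lt inE ic Gi /=; case: existsP => //= _.
have E (j : I) : (ix (item_of j) == ix (item_of i)) = (i == j) by rewrite eq_sym.
have E' (j : I) : (ix (item_of j) == c) = (j == c) by [].
rewrite [X in if X then 0 else _](_ : _ = (i \in [:: t; u1; u2; v1; v2])) //.
by rewrite !E !in_cons orbF.
Qed.

End WithGuess.

Lemma feasibleE r : feasible (W c) (H c) (assign r) ->
  [/\ forall a b, (a, b) \in [:: (5, 11); (9, 12); (6, 7); (10, 8)] ->
        #|[set i | (r i == a) || (r i == b)]| <= 1,
      forall s, s \in [:: 1; 2] -> \sum_(i | r i == s) W i +
        (if [exists i, (r i == s + 4) || (r i == s + 8)] then 2 else 0) <= W c &
      forall s, s \in [:: 3; 4] -> \sum_(i | r i == s) H i +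
        (if [exists i, (r i == s + 4) || (r i == s + 8)] then 2 else 0) <= H c].
Proof.
rewrite /feasible !corner_assign !side_assign !lenW_assign !lenH_assign.
case/and5P=> h1 h2 h3 h4 /and4P[h5 h6 h7 h8]; split.
- by move=> a b; rewrite !in_cons orbF => /or4P[] /eqP[-> ->].
- by move=> s; rewrite !in_cons orbF => /orP[] /eqP ->.
- by move=> s; rewrite !in_cons orbF => /orP[] /eqP ->.
Qed.

Lemma feasibleI r :
  (forall a b, (a, b) \in [:: (5, 11); (9, 12); (6, 7); (10, 8)] ->
        #|[set i | (r i == a) || (r i == b)]| <= 1) ->
  (forall s, s \in [:: 1; 2] -> \sum_(i | r i == s) W i +
        (if [exists i, (r i == s + 4) || (r i == s + 8)] then 2 else 0) <= W c) ->
  (forall s, s \in [:: 3; 4] -> \sum_(i | r i == s) H i +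
        (if [exists i, (r i == s + 4) || (r i == s + 8)] then 2 else 0) <= H c) ->
  feasible (W c) (H c) (assign r).
Proof.
move=> h1 h2 h3; rewrite /feasible !corner_assign !side_assign !lenW_assign !lenH_assign.
by rewrite !h1 // !h2 // !h3.
Qed.

Lemma sum_le_sub (f : I -> nat) (A B : pred I) : (forall i, A i -> B i) ->
  \sum_(i | A i) f i <= \sum_(i | B i) f i.
Proof.
move=> sub; rewrite [X in _ <= X](bigID A) /=; apply: leq_trans (leq_addr _ _).
rewrite leq_eqVlt; apply/orP; left; apply/eqP; apply: eq_bigl => i.
by case Ai: (A i); rewrite ?andbF ?sub.
Qed.

Theorem good_guess : exists2 GT, GT \in candidates [seq item_of i | i <- enum 'I_n] &
  feasible (W c) (H c) (roles c [seq item_of i | i <- enum 'I_n] GT) /\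
  2 * profit (assign rho) <= 3 * profit (roles c [seq item_of i | i <- enum 'I_n] GT).
Proof.
have arith (g o a v w : nat) : g + o + a <= w -> v <= w - (g + o) -> g + v + o <= w by lia.
have big_role (x a b : nat) : x <= 4 -> 4 < a -> 4 < b -> (x == a) || (x == b) = false by lia.
(* The balance of profits: [g] guessed, [o] sticking out and unguessed, [a] unguessed inside the
   sides, [q1] and [q2] the parts of [a] on either side of the cut, [s12] and [s34] the greedy
   fillings, [p1] to [p5] the thresholds. The 4 + 5 losses are worth at most [g / 3]. *)
have final (g a o q1 q2 p1 p2 p3 p4 p5 s12 s34 rr : nat) :
    g + s12 + s34 <= rr -> a <= p1 + q1 + q2 -> q1 <= s12 + p2 + p3 -> q2 <= s34 + p4 + p5 ->
    27 * p1 <= g -> 27 * p2 <= g -> 27 * p3 <= g -> 27 * p4 <= g -> 27 * p5 <= g ->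
    27 * o <= 4 * g -> 2 * (g + (a + o)) <= 3 * rr.
  by lia.
have lt4 s : 0 < s -> 4 < s + 4 by lia.
have lt8 s : 0 < s -> 4 < s + 8 by lia.
have [hcor hW hH] := feasibleE rho_feasible.
pose S := [set i | rho i != 0].
have cS : c \notin S by rewrite inE rho_c.
have [G GS [cG topG]] := top_subset P (geq_minl #|S| num_guess).
have Gc : c \notin G by apply: contra cS; exact: (subsetP GS).
have Gsize : #|G| <= num_guess by rewrite cG geq_minr.
have Grho g : g \in G -> rho g != 0 by move/(subsetP GS); rewrite inE.
pose A := [set i in S :\: G | (rho i == 1) || (rho i == 2)].
pose B := [set i in S :\: G | (rho i == 3) || (rho i == 4)].
pose O := [set i in S :\: G | 4 < rho i].
pose Z := rest G.
have SZ : S :\: G \subset Z.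
  apply/subsetP => i; rewrite in_setD => /andP[iG iS]; rewrite inE iG /=.
  rewrite (_ : i != c) /=; last by apply: contraNneq cS => <-.
  apply/existsP => -[g /andP[Gg]]; rewrite ltnNge => /negP; apply.
  by apply: topG => //; rewrite in_setD iG.
have cZ : c \notin Z by rewrite inE eqxx.
have AS : A \subset S :\: G by apply/subsetP => i; rewrite inE => /andP[].
have BS : B \subset S :\: G by apply/subsetP => i; rewrite inE => /andP[].
have OS : O \subset S :\: G by apply/subsetP => i; rewrite inE => /andP[].
have AZ := subset_trans AS SZ; have BZ := subset_trans BS SZ.
have cA : c \notin A by apply: contra cZ; exact: (subsetP AZ).
have cB : c \notin B by apply: contra cZ; exact: (subsetP BZ).
have dAB : [disjoint A & B].
  rewrite -setI_eq0; apply/eqP/setP => i; rewrite !inE.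
  by case: (rho i) => [|[|[|[|[|k]]]]]; rewrite ?andbF.
have [t ht [leA leB]] := cut_sides Wpos Hpos cA cB dAB.
(* In the new assignment boxes stick out only if guessed. The 2 units that they need on a side are
   reserved, with the guessed lengths, before the greedy filling. *)
pose ov s := if [exists i in G, (rho i == s + 4) || (rho i == s + 8)] then 2 else 0.
pose GW s := \sum_(i in G | rho i == s) W i.
pose GH s := \sum_(i in G | rho i == s) H i.
(* The whole pool is split at [t], not only the boxes of [rho]: each half contains the corresponding
   part of [A :|: B], with which the greedy filling competes. *)
pose Zh := [set x in Z | (x != t) && before c W H t x].
pose Zv := [set x in Z | (x != t) && ~~ before c W H t x].
have cZh : c \notin Zh by apply: contra cZ; rewrite inE => /andP[].
have cZv : c \notin Zv by apply: contra cZ; rewrite inE => /andP[].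
have [u1 [u2 [hu1 hu2 m1 m2 hu]]] :=
  greedy_fill Ppos (W c - (GW 1 + ov 1)) (W c - (GW 2 + ov 2)) Wpos cZh.
have [v1 [v2 [hv1 hv2 m3 m4 hv]]] :=
  greedy_fill Ppos (H c - (GH 3 + ov 3)) (H c - (GH 4 + ov 4)) Hpos cZv.
exists (guess G t u1 u2 v1 v2); first exact: guess_candidate.
pose V1 x := (x \in Zh) && [&& x != u1, x != u2 & before c W P u1 x].
pose V2 x := (x \in Zh) && [&& x != u1, x != u2, ~~ before c W P u1 x & before c W P u2 x].
pose V3 x := (x \in Zv) && [&& x != v1, x != v2 & before c H P v1 x].
pose V4 x := (x \in Zv) && [&& x != v1, x != v2, ~~ before c H P v1 x & before c H P v2 x].
rewrite roles_assign !profit_assign; set r := fun i => _.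
have rG i : i \in G -> r i = rho i by move=> Gi; rewrite /r role_guess // Gi.
have rV i : i \notin G ->
    r i = if V1 i then 1 else if V2 i then 2 else if V3 i then 3 else if V4 i then 4 else 0.
  move=> nG; rewrite /r role_guess // (negbTE nG) /V1 /V2 /V3 /V4 -/Z.
  have -> : (i \in Zh) = (i \in Z) && ((i != t) && before c W H t i) by rewrite in_set.
  have -> : (i \in Zv) = (i \in Z) && ((i != t) && ~~ before c W H t i) by rewrite in_set.
  case Zi: (i \in Z) => //=.
  have ic : i != c by apply: contraNneq cZ => <-.
  rewrite !in_cons orbF; case: (eqVneq i t) => [->//|it] /=.
  (* A threshold of one half is infinite or lies in that half, so it discards no box of the other
     half. *)
  have noth (v : I) (X : {set I}) : (v == c) || (v \in X) -> i \notin X -> (i == v) = false.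
    move=> /orP[/eqP->|Xv] nX; first exact: negbTE.
    by apply: contraNF nX => /eqP->.
  case bi: (before c W H t i) => /=.
  - have nZv : i \notin Zv by rewrite in_set Zi it bi.
    rewrite (noth v1 _ hv1 nZv) (noth v2 _ hv2 nZv) !orbF.
    case: (eqVneq i u1) => //= _; case: (eqVneq i u2) => //= _.
    by case: (before c W P u1 i).
  - have nZh : i \notin Zh by rewrite in_set Zi it bi.
    rewrite (noth u1 _ hu1 nZh) (noth u2 _ hu2 nZh) /=.
    case: (eqVneq i v1) => //= _; case: (eqVneq i v2) => //= _.
    by case: (before c H P v1 i).
have ZG i : i \in Z -> i \notin G by rewrite inE => /and3P[].
have V1G i : V1 i -> i \notin G by rewrite /V1 inE => /andP[/andP[/ZG]].
have V2G i : V2 i -> i \notin G by rewrite /V2 inE => /andP[/andP[/ZG]].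
have V3G i : V3 i -> i \notin G by rewrite /V3 inE => /andP[/andP[/ZG]].
have V4G i : V4 i -> i \notin G by rewrite /V4 inE => /andP[/andP[/ZG]].
have V12 i : V1 i -> V2 i = false.
  by rewrite /V1 /V2 => /andP[-> /and3P[_ _ ->]]; rewrite /= !andbF.
have V34 i : V3 i -> V4 i = false.
  by rewrite /V3 /V4 => /andP[-> /and3P[_ _ ->]]; rewrite /= !andbF.
have Zhv i : i \in Zh -> i \in Zv = false.
  by rewrite !in_set => /and3P[-> -> ->].
have VhNv i : (i \in Zv) = false -> V3 i = false /\ V4 i = false by rewrite /V3 /V4 => ->.
have VvNh i : (i \in Zh) = false -> V1 i = false /\ V2 i = false by rewrite /V1 /V2 => ->.
have rs i : i \notin G -> [/\ (r i == 1) = V1 i, (r i == 2) = V2 i, (r i == 3) = V3 i &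
    (r i == 4) = V4 i].
  move=> nG; rewrite rV //.
  case Zhi: (i \in Zh).
    have [-> ->] := VhNv i (Zhv i Zhi); have := V12 i.
    by case: (V1 i) => [->//|_]; case: (V2 i).
  have [-> ->] := VvNh i Zhi; have := V34 i.
  by case: (V3 i) => [->//|_]; case: (V4 i).
have split_s s (V : pred I) (f : I -> nat) : (forall i, V i -> i \notin G) ->
    (forall i, i \notin G -> (r i == s) = V i) ->
    \sum_(i | r i == s) f i = \sum_(i in G | rho i == s) f i + \sum_(i | V i) f i.
  move=> VG hV; rewrite (bigID (mem G)) /=; congr (_ + _); apply: eq_bigl => i.
    by rewrite andbC; case Gi: (i \in G) => //=; rewrite rG.
  case Gi: (i \in G); last by rewrite andbT hV ?Gi.
  by rewrite andbF; case Vi: (V i) => //; rewrite (negbTE (VG i Vi)) in Gi.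
have r4 i : i \notin G -> r i <= 4.
  by move=> nG; rewrite rV //; case: (V1 i); case: (V2 i); case: (V3 i); case: (V4 i).
have ovE s : 0 < s -> (if [exists i, (r i == s + 4) || (r i == s + 8)] then 2 else 0) = ov s.
  move=> s0; rewrite /ov; congr (if _ then _ else _); apply/existsP/existsP => -[i].
    case Gi: (i \in G); first by rewrite rG // => h; exists i; rewrite Gi.
    by rewrite (big_role _ _ _ (r4 i (negbT Gi)) (lt4 s s0) (lt8 s s0)).
  by case/andP=> Gi h; exists i; rewrite rG.
have ov_le s : ov s <= if [exists i, (rho i == s + 4) || (rho i == s + 8)] then 2 else 0.
  rewrite /ov; case: ifP => // /existsP[i /andP[_ hi]].
  by case: ifP => // /existsP; case; exists i.
have GA s (f : I -> nat) (X : {set I}) : X \subset S :\: G ->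
    \sum_(i in G | rho i == s) f i + \sum_(i in X | rho i == s) f i <= \sum_(i | rho i == s) f i.
  move=> /subsetP XS; rewrite [X in _ <= X](bigID (mem G)) /=; apply: leq_add.
    by apply: sum_le_sub => i /andP[-> ->].
  by apply: sum_le_sub => i /andP[/XS]; rewrite in_setD => /andP[-> _] ->.
have capW s : s \in [:: 1; 2] -> GW s + ov s + \sum_(i in A | rho i == s) W i <= W c.
  move=> hs; apply: leq_trans (hW s hs); rewrite addnAC; apply: leq_add (ov_le s).
  exact: GA.
have capH s : s \in [:: 3; 4] -> GH s + ov s + \sum_(i in B | rho i == s) H i <= H c.
  move=> hs; apply: leq_trans (hH s hs); rewrite addnAC; apply: leq_add (ov_le s).
  exact: GA.
split.
  apply: feasibleI.
  - move=> a b ab; apply: leq_trans (hcor a b ab); apply: subset_leq_card.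
    apply/subsetP => i; rewrite !inE; case Gi: (i \in G); first by rewrite rG.
    have h4 : r i <= 4 by rewrite r4 ?Gi.
    by move: ab; rewrite !in_cons orbF => /or4P[] /eqP[-> ->]; rewrite big_role.
  - move=> s; rewrite !in_cons orbF => /orP[] /eqP ->; rewrite ovE //.
    + rewrite (split_s 1 V1) // => [|i /rs[]//].
      exact: arith (capW 1 isT) m1.
    + rewrite (split_s 2 V2) // => [|i /rs[]//].
      exact: arith (capW 2 isT) m2.
  - move=> s; rewrite !in_cons orbF => /orP[] /eqP ->; rewrite ovE //.
    + rewrite (split_s 3 V3) // => [|i /rs[]//].
      exact: arith (capH 3 isT) m3.
    + rewrite (split_s 4 V4) // => [|i /rs[]//].
      exact: arith (capH 4 isT) m4.
have sumWA : \sum_(i in A) W i <= (W c - (GW 1 + ov 1)) + (W c - (GW 2 + ov 2)).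
  rewrite (bigID (fun i => rho i == 1)) /=; apply: leq_add.
    by rewrite leq_subRL; [exact: capW | apply: leq_trans (capW 1 isT); exact: leq_addr].
  rewrite (eq_bigl (fun i => (i \in A) && (rho i == 2))); last first.
    by move=> i; rewrite inE -!andbA; congr (_ && _); case: (rho i) => [|[|[|k]]].
  by rewrite leq_subRL; [exact: capW | apply: leq_trans (capW 2 isT); exact: leq_addr].
have sumHB : \sum_(i in B) H i <= (H c - (GH 3 + ov 3)) + (H c - (GH 4 + ov 4)).
  rewrite (bigID (fun i => rho i == 3)) /=; apply: leq_add.
    by rewrite leq_subRL; [exact: capH | apply: leq_trans (capH 3 isT); exact: leq_addr].
  rewrite (eq_bigl (fun i => (i \in B) && (rho i == 4))); last first.
    by move=> i; rewrite inE -!andbA; congr (_ && _); case: (rho i) => [|[|[|[|[|k]]]]].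
  by rewrite leq_subRL; [exact: capH | apply: leq_trans (capH 4 isT); exact: leq_addr].
have ABZ x : x \in A :|: B -> x \in Z.
  by rewrite in_setU => /orP[]; [exact: (subsetP AZ) | exact: (subsetP BZ)].
pose Q1 := [set x in A :|: B | (x != t) && before c W H t x].
pose Q2 := [set x in A :|: B | (x != t) && ~~ before c W H t x].
have sumQ (f : I -> nat) : \sum_(x in Q1) f x =
    \sum_(x in A :|: B | (x != t) && before c W H t x) f x.
  by apply: eq_bigl => x; rewrite inE.
have sumQ' (f : I -> nat) : \sum_(x in Q2) f x =
    \sum_(x in A :|: B | (x != t) && ~~ before c W H t x) f x.
  by apply: eq_bigl => x; rewrite inE.
have hQ1 : \sum_(x in Q1) P x <= \sum_(x | V1 x) P x + \sum_(x | V2 x) P x +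
    profit1 c P u1 + profit1 c P u2.
  apply: hu.
    apply/subsetP => x; rewrite [x \in Q1]in_set [x \in Zh]in_set => /andP[/ABZ -> ->] //.
  by rewrite sumQ; apply: leq_trans leA sumWA.
have hQ2 : \sum_(x in Q2) P x <= \sum_(x | V3 x) P x + \sum_(x | V4 x) P x +
    profit1 c P v1 + profit1 c P v2.
  apply: hv.
    apply/subsetP => x; rewrite [x \in Q2]in_set [x \in Zv]in_set => /andP[/ABZ -> ->] //.
  by rewrite sumQ'; apply: leq_trans leB sumHB.
have hAB : \sum_(x in A :|: B) P x <=
    profit1 c P t + \sum_(x in Q1) P x + \sum_(x in Q2) P x.
  rewrite (bigID (fun x => x == t)) /= -addnA; apply: leq_add.
    have tc : t \in A :|: B -> t == c = false.
      by move/ABZ => Zt; apply: contraNF cZ => /eqP<-.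
    rewrite /profit1; case ABt: (t \in A :|: B).
      rewrite tc // (eq_bigl (fun x => x == t)) ?big_pred1_eq // => x.
      by case: eqP => [->|]; rewrite ?ABt ?andbF.
    by rewrite big1 // => x /andP[ABx /eqP xt]; rewrite xt ABt in ABx.
  rewrite (bigID (fun x => before c W H t x)) /= sumQ sumQ'.
  by apply: leq_add; apply: sum_le_sub => x; rewrite andbA.
have hS : \sum_(i | rho i != 0) P i =
    \sum_(i in G) P i + (\sum_(x in A :|: B) P x + \sum_(x in O) P x).
  rewrite (bigID (mem G)) /=; congr (_ + _).
    by apply: eq_bigl => i; rewrite andbC; case Gi: (i \in G) => //=; rewrite Grho.
  rewrite (bigID (fun i => rho i <= 4)) /=; congr (_ + _); apply: eq_bigl => i; rewrite !inE.
    by case: (i \in G) => /=; case: (rho i) => [|[|[|[|[|k]]]]].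
  by rewrite -ltnNge [X in X && _]andbC.
have hr : \sum_(i in G) P i + (\sum_(x | V1 x) P x + \sum_(x | V2 x) P x) +
    (\sum_(x | V3 x) P x + \sum_(x | V4 x) P x) <= \sum_(i | r i != 0) P i.
  rewrite [X in _ <= X](bigID (mem G)) /= -addnA; apply: leq_add.
    by apply: sum_le_sub => i Gi; rewrite rG // Grho.
  have hV (V V' : pred I) : (forall i, V i -> V' i = false) ->
      \sum_(x | V x) P x + \sum_(x | V' x) P x <= \sum_(x | V x || V' x) P x.
    move=> dV; rewrite [X in _ <= X](bigID V) /=; apply: leq_add; apply: sum_le_sub => i.
      by move=> ->.
    by case Vi: (V i); rewrite ?(dV i Vi) // => ->.
  apply: leq_trans (leq_add (hV V1 V2 V12) (hV V3 V4 V34)) _.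
  apply: leq_trans (hV _ _ _) _.
    move=> i h; have Zhi : i \in Zh by case/orP: h => /andP[].
    by have [-> ->] := VhNv i (Zhv i Zhi).
  apply: sum_le_sub => i h.
  have nG : i \notin G by case/orP: h => /orP[]; [exact: V1G|exact: V2G|exact: V3G|exact: V4G].
  rewrite nG andbT rV //; move: h.
  by case: (V1 i); case: (V2 i); case: (V3 i); case: (V4 i).
(* If fewer than 27 boxes are placed, all of them are guessed and nothing is lost. *)
case: (ltnP #|S| num_guess) => hSn.
  have GSe : G = S.
    by apply/eqP; rewrite eqEcard GS cG leq_min leqnn (ltnW hSn).
  have E0 (X : {set I}) : X \subset S :\: G -> \sum_(x in X) P x = 0.
    by rewrite GSe setDv subset0 => /eqP->; rewrite big_set0.
  have ABS : A :|: B \subset S :\: G by rewrite subUset AS BS.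
  rewrite hS (E0 _ ABS) (E0 _ OS).
  rewrite !addn0; apply: leq_mul => //; apply: leq_trans hr; rewrite -addnA; exact: leq_addr.
have cG27 : #|G| = num_guess by rewrite cG (minn_idPr hSn).
have top z : z \in Z -> 27 * P z <= \sum_(i in G) P i.
  move=> Zz; rewrite -[27]/num_guess -cG27 -sum_nat_const; apply: leq_sum => g Gg.
  rewrite leqNgt; move: Zz; rewrite inE => /and3P[_ _]; apply: contra => h.
  by apply/existsP; exists g; rewrite Gg.
have top1 (u : I) (X : {set I}) : (u == c) || (u \in X) -> X \subset Z ->
    27 * profit1 c P u <= \sum_(i in G) P i.
  rewrite /profit1 => h XZ; case: eqP h => [//|_] /= Xu; apply: top; exact: (subsetP XZ).
have ZhZ : Zh \subset Z by apply/subsetP => x; rewrite inE => /andP[].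
have ZvZ : Zv \subset Z by apply/subsetP => x; rewrite inE => /andP[].
(* The eight roles above 4 fall into four corners, each used at most once. *)
have cardO : #|O| <= 4.
  have hO : O \subset [set i | (rho i == 5) || (rho i == 11)] :|:
      [set i | (rho i == 9) || (rho i == 12)] :|: [set i | (rho i == 6) || (rho i == 7)] :|:
      [set i | (rho i == 10) || (rho i == 8)].
    apply/subsetP => i; rewrite !inE => /andP[_]; have := rho_le i.
    by case: (rho i) => [|[|[|[|[|[|[|[|[|[|[|[|[|k]]]]]]]]]]]]].
  apply: leq_trans (subset_leq_card hO) _.
  have u4 (X Y : {set I}) a : #|X| <= a -> #|Y| <= 1 -> #|X :|: Y| <= a + 1.
    by move=> hx hy; apply: leq_trans (leq_card_setU _ _) _; exact: leq_add.
  by apply: (u4 _ _ 3); [apply: (u4 _ _ 2); [apply: (u4 _ _ 1)|]|]; exact: hcor.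
have hO27 : 27 * \sum_(x in O) P x <= 4 * \sum_(i in G) P i.
  rewrite big_distrr /=; apply: leq_trans (_ : \sum_(x in O) \sum_(i in G) P i <= _).
    by apply: leq_sum => x Ox; apply: top; apply: (subsetP SZ); exact: (subsetP OS).
  by rewrite sum_nat_const leq_mul2r cardO orbT.
rewrite hS; apply: (final _ _ _ _ _ _ _ _ _ _ _ _ _ hr hAB hQ1 hQ2 _ _ _ _ _ hO27).
- by apply: top1 ht _; rewrite subUset AZ BZ.
- exact: top1 hu1 ZhZ.
- exact: top1 hu2 ZhZ.
- exact: top1 hv1 ZvZ.
- exact: top1 hv2 ZvZ.
Qed.
End Guess.

(** * The placement of the boxes *)

Lemma foldl_better cw ch l b : feasible cw ch b ->
  [/\ feasible cw ch (foldl (better cw ch) b l),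
      (foldl (better cw ch) b l = b) \/ (foldl (better cw ch) b l \in l),
      profit b <= profit (foldl (better cw ch) b l) &
      forall x, x \in l -> feasible cw ch x -> profit x <= profit (foldl (better cw ch) b l)].
Proof.
elim: l b => [|y l IH] b fb /=; first by split=> //; left.
have fy : feasible cw ch (better cw ch b y).
  by rewrite /better; case: ifP => // /andP[].
have [h1 h2 h3 h4] := IH _ fy.
have hb : profit b <= profit (better cw ch b y).
  by rewrite /better; case: ifP => // /andP[_ /ltnW].
split=> //.
- case: h2 => [->|h2]; last by right; rewrite in_cons h2 orbT.
  by rewrite /better; case: ifP => _; [right; rewrite mem_head | left].
- exact: leq_trans hb h3.
- move=> x; rewrite in_cons => /orP[/eqP->|xl] fx; last exact: h4.
  apply: leq_trans h3; rewrite /better fx; case: ifP => //= /negbT.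
  by rewrite -leqNgt.
Qed.

Lemma words_sub (B : eqType) k (l s : seq B) : s \in words k l -> {subset s <= l}.
Proof.
elim: k s => [|k IH] s /=; first by rewrite inE => /eqP->.
case/allpairsP=> -[x s'] /= [xl hs' ->] y; rewrite in_cons => /orP[/eqP->//|].
exact: IH.
Qed.

Lemma role_le12 c items GT x : GT \in candidates items -> role c GT.1 GT.2 x <= 12.
Proof.
case/allpairsP=> -[G T] [hG _ ->]; rewrite -[(G, T).1]/G -[(G, T).2]/T in hG *.
have hle e : e \in G -> e.2 <= 12.
  move/(words_sub hG); case/allpairsP=> -[y r] /= [_ hr ->] /=.
  by move: hr; rewrite !inE; do 12 (case: eqP => [->//|_]).
rewrite /role /=; case: ifP => // _; case: ifP => [_|_]; last first.
  by case: ifP => // _; case: ifP => // _; case: ifP => _; case: ifP => // _; case: ifP.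
have : {subset [seq e <- G | ix e.1 == ix x] <= G} by move=> e; rewrite mem_filter => /andP[].
by case: filter => [|e s] //= sub; apply: hle; apply: sub; rewrite mem_head.
Qed.

(** * Coordinates along one side of the centre *)

Section Layout.
Variable n : nat.
Local Notation I := 'I_n.
Variables (F cap r0 : nat) (L : I -> nat) (rho : I -> nat).
Let len := \sum_(j | rho j == r0) L j.
Let pre (i : I) := \sum_(j : I | (rho j == r0) && (j < i)) L j.
Let a (i : I) := along F (slack len cap) len (pre i) r0 (rho i) (L i).
Hypotheses (Lpos : forall i, 0 < L i) (LF : forall i, L i <= F)
  (capOK : len + (if [exists i, (rho i == r0 + 4) || (rho i == r0 + 8)] then 2 else 0) <= cap)
  (low1 : forall i j, rho i = r0 + 4 -> rho j = r0 + 4 -> i = j)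
  (high1 : forall i j, rho i = r0 + 8 -> rho j = r0 + 8 -> i = j).

Lemma pre_step (i j : I) : rho i = r0 -> i < j -> pre i + L i <= pre j.
Proof.
move=> ri ij; rewrite /pre [X in _ <= X](bigID (fun k : I => k < i)) /=; apply: leq_add.
  by apply: sum_le_sub => k /andP[-> h]; rewrite h (ltn_trans h ij).
by rewrite (bigD1 i) /= ?ri ?eqxx ?ij ?ltnn // leq_addr.
Qed.

Lemma pre_len (i : I) : rho i = r0 -> pre i + L i <= len.
Proof.
move=> ri; rewrite /pre /len [X in _ <= X](bigID (fun k : I => k < i)) /=; apply: leq_add => //.
by rewrite (bigD1 i) /= ?ri ?eqxx ?ltnn // leq_addr.
Qed.

Lemma len_cap : len <= cap.
Proof. exact: leq_trans (leq_addr _ _) capOK. Qed.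

Lemma over_cap (i : I) : (rho i == r0 + 4) || (rho i == r0 + 8) -> len + 2 <= cap.
Proof.
by move=> h; move: capOK; rewrite ifT //; apply/existsP; exists i.
Qed.

(** A box sticking out forces two free units and thus slack 1: at the low end it covers the first
    unit of the side, at the high end it starts at least one unit before the end. *)
Lemma along_cases (i : I) : onside r0 (rho i) ->
  [\/ rho i = r0 /\ a i = F + slack len cap + pre i,
      [/\ rho i = r0 + 4, a i + L i = F + 1, slack len cap = 1 & len + 2 <= cap] |
      [/\ rho i = r0 + 8, a i = F + 1 + len, slack len cap = 1 & len + 2 <= cap]].
Proof.
rewrite /onside => h; rewrite /a /along.
have [e|ne] := eqVneq (rho i) r0; first by constructor 1.
have [e4|ne4] := eqVneq (rho i) (r0 + 4).
  have oc : len + 2 <= cap by apply: (@over_cap i); rewrite e4 eqxx.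
  have sl : slack len cap = 1 by rewrite /slack ifT //; lia.
  by constructor 2; split=> //; rewrite sl; have := LF i; lia.
have e8 : rho i = r0 + 8 by move: h; rewrite (negbTE ne) (negbTE ne4) /= => /eqP.
have oc : len + 2 <= cap by apply: (@over_cap i); rewrite e8 eqxx orbT.
have sl : slack len cap = 1 by rewrite /slack ifT //; lia.
by constructor 3; split=> //; rewrite sl.
Qed.

Lemma slack_le : len + slack len cap <= cap.
Proof. by rewrite /slack; have := len_cap; case: ltnP; lia. Qed.

Lemma along_touch i : onside r0 (rho i) -> F < a i + L i /\ a i < F + cap.
Proof.
have sl := slack_le; have Li := Lpos i.
case/along_cases=> [[ri ->]|[ri e _ oc]|[ri -> _ oc]]; [|lia|lia].
have := pre_len ri; lia.
Qed.

Lemma along_ge i : onside r0 (rho i) -> rho i != r0 + 4 -> F <= a i.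
Proof. by case/along_cases=> [[ri ->]|[-> *]|[ri -> _ oc]]; rewrite ?eqxx //; lia. Qed.

Lemma along_le i : onside r0 (rho i) -> rho i != r0 + 8 -> a i + L i <= F + cap.
Proof.
have sl := slack_le.
move=> /along_cases[[ri ->]|[_ e _ oc]|[-> _ _ _]] h.
- by have := pre_len ri; lia.
- by lia.
- by rewrite eqxx in h.
Qed.

Lemma along_disjoint i j : i != j -> onside r0 (rho i) -> onside r0 (rho j) ->
  (a i + L i <= a j) || (a j + L j <= a i).
Proof.
move=> ij /along_cases hi /along_cases hj.
have sl := slack_le.
case: hi => [[ri ei]|[ri ei si ci]|[ri ei si ci]];
  case: hj => [[rj ej]|[rj ej sj cj]|[rj ej sj cj]].
- rewrite ei ej; case: (ltngtP i j) => h.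
  + by have := pre_step ri h; lia.
  + by have := pre_step rj h; lia.
  + by move/val_inj: h => h; rewrite h eqxx in ij.
- by rewrite ei; lia.
- by rewrite ei ej; have := pre_len ri; lia.
- by rewrite ej; lia.
- by rewrite (low1 ri rj) eqxx in ij.
- by rewrite ej; lia.
- by rewrite ei ej; have := pre_len rj; lia.
- by rewrite ei; lia.
- by rewrite (high1 ri rj) eqxx in ij.
Qed.
End Layout.

Section Placement.
Variable n : nat.
Local Notation I := 'I_n.
Variables (c : I) (W H P : I -> nat) (rho : I -> nat).
Hypotheses (Wpos : forall i, 0 < W i) (Hpos : forall i, 0 < H i).
Hypotheses (rho_c : rho c = 0) (rho_feas : feasible (W c) (H c) (assign W H P rho)).

Let F := \sum_i (W i + H i).
Let RL := assign W H P rho.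
Definition placed (i : I) : nat * nat := place F c (W c) (H c) RL (item_of W H P i, rho i).
Let X i := (placed i).1.
Let Y i := (placed i).2.

Lemma width_le_frame i : W i <= F.
Proof. by rewrite /F (bigD1 i) //= -addnA leq_addr. Qed.
Lemma height_le_frame i : H i <= F.
Proof. by rewrite /F (bigD1 i) //= addnAC leq_addl. Qed.

Let aW r (i : I) := along F (slack (\sum_(j | rho j == r) W j) (W c))
  (\sum_(j | rho j == r) W j) (\sum_(j : I | (rho j == r) && (j < i)) W j) r (rho i) (W i).
Let aH r (i : I) := along F (slack (\sum_(j | rho j == r) H j) (H c))
  (\sum_(j | rho j == r) H j) (\sum_(j : I | (rho j == r) && (j < i)) H j) r (rho i) (H i).

Variant spot (i : I) : Prop :=
  | SpotC of i = c & X i = F & Y i = F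
  | SpotT of i <> c & onside 1 (rho i) & X i = aW 1 i & Y i = F + H c
  | SpotB of i <> c & onside 2 (rho i) & X i = aW 2 i & Y i + H i = F
  | SpotL of i <> c & onside 3 (rho i) & X i + W i = F & Y i = aH 3 i
  | SpotR of i <> c & onside 4 (rho i) & X i = F + W c & Y i = aH 4 i
  | SpotFar of i <> c & X i = (i + 3) * F
      & [&& ~~ onside 1 (rho i), ~~ onside 2 (rho i), ~~ onside 3 (rho i) & ~~ onside 4 (rho i)].

Lemma spotP i : spot i.
Proof.
have := erefl (placed i); rewrite {2}/placed /place /alongW /alongH.
rewrite !lenW_assign !lenH_assign !preW_assign !preH_assign /=.
case: eqP => [/val_inj e|ne] E; first by constructor 1; rewrite // /X /Y E.
have {}ne : i <> c by move=> e; apply: ne; rewrite e.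
case o1: (onside 1 (rho i)) E => E; first by constructor 2; rewrite // /X /Y E.
case o2: (onside 2 (rho i)) E => E.
  by constructor 3; rewrite // /X /Y E //=; apply: subnK; exact: height_le_frame.
case o3: (onside 3 (rho i)) E => E.
  by constructor 4; rewrite // /X /Y E //=; apply: subnK; exact: width_le_frame.
case o4: (onside 4 (rho i)) E => E; first by constructor 5; rewrite // /X /Y E.
by constructor 6; rewrite // ?o1 ?o2 ?o3 ?o4 // /X E.
Qed.

Definition apart (i j : I) : bool :=
  [|| X i + W i <= X j, X j + W j <= X i, Y i + H i <= Y j | Y j + H j <= Y i].

Lemma apart_sym i j : apart i j = apart j i.
Proof.
rewrite /apart; move: (X i + W i <= X j) (X j + W j <= X i) (Y i + H i <= Y j) (Y j + H j <= Y i).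
by do 4 case.
Qed.

Lemma corner_excl a b i j : (a, b) \in [:: (5, 11); (9, 12); (6, 7); (10, 8)] ->
  (rho i == a) || (rho i == b) -> (rho j == a) || (rho j == b) -> i = j.
Proof.
have [hc _ _] := feasibleE rho_feas => /hc/card_le1_eqP h hi hj.
by apply: h; rewrite inE.
Qed.

Lemma corner_uniq r i j : 5 <= r <= 12 -> rho i = r -> rho j = r -> i = j.
Proof.
move=> hr ei ej.
have [h|[h|[h|h]]] : (r == 5) || (r == 11) \/ (r == 9) || (r == 12) \/
    (r == 6) || (r == 7) \/ (r == 10) || (r == 8) by lia.
- by apply: (@corner_excl 5 11); rewrite ?ei ?ej.
- by apply: (@corner_excl 9 12); rewrite ?ei ?ej.
- by apply: (@corner_excl 6 7); rewrite ?ei ?ej.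
- by apply: (@corner_excl 10 8); rewrite ?ei ?ej.
Qed.

Lemma capW_ok r : r \in [:: 1; 2] -> \sum_(i | rho i == r) W i +
  (if [exists i, (rho i == r + 4) || (rho i == r + 8)] then 2 else 0) <= W c.
Proof. by have [_ h _] := feasibleE rho_feas; exact: h. Qed.
Lemma capH_ok r : r \in [:: 3; 4] -> \sum_(i | rho i == r) H i +
  (if [exists i, (rho i == r + 4) || (rho i == r + 8)] then 2 else 0) <= H c.
Proof. by have [_ _ h] := feasibleE rho_feas; exact: h. Qed.

Section SideFacts.
Variable r : nat.
Hypothesis r4 : 0 < r <= 4.

Lemma low_uniq i j : rho i = r + 4 -> rho j = r + 4 -> i = j.
Proof. by apply: corner_uniq; lia. Qed.
Lemma high_uniq i j : rho i = r + 8 -> rho j = r + 8 -> i = j.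
Proof. by apply: corner_uniq; lia. Qed.
End SideFacts.

(** Boxes at the centre end at abscissa [3 * F] at the latest; the others start there or later, at
    distances of at least [F], so their abscissas alone separate them. Boxes on two adjacent sides
    can conflict only at the common corner. *)
Lemma placed_apart : forall i j, i != j -> apart i j.
Proof.
have WcF := width_le_frame c; have HcF := height_le_frame c; have Wc0 := Wpos c; have Hc0 := Hpos c.
have Wt r i0 hr := @along_touch n F (W c) r W rho Wpos width_le_frame (@capW_ok r hr) i0.
have Ht r i0 hr := @along_touch n F (H c) r H rho Hpos height_le_frame (@capH_ok r hr) i0.
have Wge r i0 hr := @along_ge n F (W c) r W rho width_le_frame (@capW_ok r hr) i0.
have Hge r i0 hr := @along_ge n F (H c) r H rho height_le_frame (@capH_ok r hr) i0.
have Wle r i0 hr := @along_le n F (W c) r W rho width_le_frame (@capW_ok r hr) i0.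
have Hle r i0 hr := @along_le n F (H c) r H rho height_le_frame (@capH_ok r hr) i0.
have farmul (k m : nat) : k < m -> (k + 3) * F + F <= (m + 3) * F.
  by move=> km; rewrite -mulSnr leq_mul2r; apply/orP; right; lia.
have far3 (k : nat) : 3 * F <= (k + 3) * F by rewrite leq_mul2r; apply/orP; right; lia.
have near_far k m : X k + W k <= 3 * F -> X m = (m + 3) * F -> apart k m.
  by move=> h e; rewrite /apart e (leq_trans h (far3 m)).
have nearC k : k = c -> X k = F -> X k + W k <= 3 * F.
  by move=> -> ->; rewrite !mulSn; lia.
have nearW k : X k < F + W c -> X k + W k <= 3 * F.
  by move=> h; have := width_le_frame k; rewrite !mulSn; lia.
have CT i j : i = c -> X i = F -> Y i = F -> Y j = F + H c -> apart i j.
  by move=> -> eX eY eY'; rewrite /apart eY eY' leqnn !orbT.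
have CB i j : Y i = F -> Y j + H j = F -> apart i j.
  by move=> e e'; rewrite /apart e e' leqnn !orbT.
have CL i j : X i = F -> X j + W j = F -> apart i j.
  by move=> e e'; rewrite /apart e e' leqnn !orbT.
have CR i j : i = c -> X i = F -> X j = F + W c -> apart i j.
  by move=> -> e e'; rewrite /apart e e' leqnn.
have TB i j : Y i = F + H c -> Y j + H j = F -> apart i j.
  by move=> e e'; rewrite /apart e e' leq_addr !orbT.
have LR i j : X i + W i = F -> X j = F + W c -> apart i j.
  by move=> e e'; rewrite /apart e e' leq_addr.
have TT r i j : r \in [:: 1; 2] -> i != j -> onside r (rho i) -> onside r (rho j) ->
    X i = aW r i -> X j = aW r j -> apart i j.
  move=> hr ij oi oj ei ej; rewrite /apart ei ej orbA /aW.
  have hr4 : 0 < r <= 4 by move: hr; rewrite !inE; lia.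
  by rewrite (along_disjoint width_le_frame (capW_ok hr) (low_uniq hr4) (high_uniq hr4)).
have LL r i j : r \in [:: 3; 4] -> i != j -> onside r (rho i) -> onside r (rho j) ->
    Y i = aH r i -> Y j = aH r j -> apart i j.
  move=> hr ij oi oj ei ej; rewrite /apart ei ej /aH.
  have hr4 : 0 < r <= 4 by move: hr; rewrite !inE; lia.
  by rewrite (along_disjoint height_le_frame (capH_ok hr) (low_uniq hr4) (high_uniq hr4)) ?orbT.
have excl a b i j : (a, b) \in [:: (5, 11); (9, 12); (6, 7); (10, 8)] -> i != j ->
    rho i = a -> rho j != b.
  move=> ab ij ei; apply: contraNneq ij => ej; apply/eqP.
  by apply: (corner_excl ab); rewrite ?ei ?ej eqxx ?orbT.
(* If the top box does not stick out to the left, it starts no further left than the centre. If it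
   does, the corner is taken, and the left box ends no higher than the centre. The other three
   corners are alike. *)
have TL i j : i != j -> onside 1 (rho i) -> onside 3 (rho j) -> X i = aW 1 i -> Y i = F + H c ->
    X j + W j = F -> Y j = aH 3 j -> apart i j.
  move=> ij oi oj eX eY eX' eY'; rewrite /apart eX' eX eY eY'.
  have [e|ne] := eqVneq (rho i) 5; last by rewrite (Wge 1 i isT oi ne) !orbT.
  by rewrite (Hle 3 j isT oj (excl 5 11 i j isT ij e)) !orbT.
have TR i j : i != j -> onside 1 (rho i) -> onside 4 (rho j) -> X i = aW 1 i -> Y i = F + H c ->
    X j = F + W c -> Y j = aH 4 j -> apart i j.
  move=> ij oi oj eX eY eX' eY'; rewrite /apart eX' eX eY eY'.
  have [e|ne] := eqVneq (rho i) 9; last by rewrite (Wle 1 i isT oi ne).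
  by rewrite (Hle 4 j isT oj (excl 9 12 i j isT ij e)) !orbT.
have BL i j : i != j -> onside 2 (rho i) -> onside 3 (rho j) -> X i = aW 2 i -> Y i + H i = F ->
    X j + W j = F -> Y j = aH 3 j -> apart i j.
  move=> ij oi oj eX eY eX' eY'; rewrite /apart eX' eX eY eY'.
  have [e|ne] := eqVneq (rho i) 6; last by rewrite (Wge 2 i isT oi ne) !orbT.
  by rewrite (Hge 3 j isT oj (excl 6 7 i j isT ij e)) !orbT.
have BR i j : i != j -> onside 2 (rho i) -> onside 4 (rho j) -> X i = aW 2 i -> Y i + H i = F ->
    X j = F + W c -> Y j = aH 4 j -> apart i j.
  move=> ij oi oj eX eY eX' eY'; rewrite /apart eX' eX eY eY'.
  have [e|ne] := eqVneq (rho i) 10; last by rewrite (Wle 2 i isT oi ne).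
  by rewrite (Hge 4 j isT oj (excl 10 8 i j isT ij e)) !orbT.
have nT r i : r \in [:: 1; 2] -> onside r (rho i) -> X i = aW r i -> X i + W i <= 3 * F.
  by move=> hr oi e; apply: nearW; rewrite e; have [] := Wt r i hr oi.
have nL i : X i + W i = F -> X i + W i <= 3 * F by move=> ->; rewrite leq_pmull.
have nR i : X i = F + W c -> X i + W i <= 3 * F.
  by move=> ->; have := width_le_frame i; rewrite !mulSn; lia.
have FF i j : i != j -> X i = (i + 3) * F -> X j = (j + 3) * F -> apart i j.
  move=> ij ei ej; rewrite /apart ei ej; case: (ltngtP i j) => h.
  - by rewrite (leq_trans _ (farmul _ _ h)) // leq_add2l width_le_frame.
  - by rewrite [X in _ || (X || _)](leq_trans _ (farmul _ _ h)) ?orbT // leq_add2l width_le_frame.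
  - by move/val_inj: h ij => ->; rewrite eqxx.
move=> i j ij; have ji : j != i by rewrite eq_sym.
case: (spotP i) => [ci Xi Yi|_ oi Xi Yi|_ oi Xi Yi|_ oi Xi Yi|_ oi Xi Yi|_ Xi _];
case: (spotP j) => [cj Xj Yj|_ oj Xj Yj|_ oj Xj Yj|_ oj Xj Yj|_ oj Xj Yj|_ Xj _].
- by rewrite ci cj eqxx in ij.
- exact: CT.
- exact: CB.
- exact: CL.
- exact: CR.
- exact: near_far (nearC _ ci Xi) Xj.
- by rewrite apart_sym; exact: CT.
- exact: (TT 1).
- exact: TB.
- exact: TL.
- exact: TR.
- exact: near_far (nT 1 _ isT oi Xi) Xj.
- by rewrite apart_sym; exact: CB.
- by rewrite apart_sym; exact: TB.
- exact: (TT 2).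
- exact: BL.
- exact: BR.
- exact: near_far (nT 2 _ isT oi Xi) Xj.
- by rewrite apart_sym; exact: CL.
- by rewrite apart_sym; exact: TL.
- by rewrite apart_sym; exact: BL.
- exact: (LL 3).
- exact: LR.
- exact: near_far (nL _ Xi) Xj.
- by rewrite apart_sym; exact: CR.
- by rewrite apart_sym; exact: TR.
- by rewrite apart_sym; exact: BR.
- by rewrite apart_sym; exact: LR.
- exact: (LL 4).
- exact: near_far (nR _ Xi) Xj.
- by rewrite apart_sym; exact: near_far (nearC _ cj Xj) Xi.
- by rewrite apart_sym; exact: near_far (nT 1 _ isT oj Xj) Xi.
- by rewrite apart_sym; exact: near_far (nT 2 _ isT oj Xj) Xi.
- by rewrite apart_sym; exact: near_far (nL _ Xj) Xi.
- by rewrite apart_sym; exact: near_far (nR _ Xj) Xi.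
- exact: FF.
Qed.

Definition meets (i j : I) : bool :=
  ((X i + W i == X j) || (X j + W j == X i)) && ((Y i < Y j + H j) && (Y j < Y i + H i))
  || ((Y i + H i == Y j) || (Y j + H j == Y i)) && ((X i < X j + W j) && (X j < X i + W i)).

Lemma placed_meets i : i != c -> 0 < rho i <= 12 -> meets i c /\ meets c i.
Proof.
move=> /eqP ic hr.
have [Xc Yc] : X c = F /\ Y c = F by case: (spotP c) => //.
have Wt r i0 hr0 := @along_touch n F (W c) r W rho Wpos width_le_frame (@capW_ok r hr0) i0.
have Ht r i0 hr0 := @along_touch n F (H c) r H rho Hpos height_le_frame (@capH_ok r hr0) i0.
rewrite /meets Xc Yc.
case: (spotP i) => [//|_ oi -> ->|_ oi -> ->|_ oi -> ->|_ oi -> ->|_ _].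
- have [h1 h2] := Wt 1 i isT oi; rewrite /aW eqxx h1 h2 !orbT; by split.
- have [h1 h2] := Wt 2 i isT oi; rewrite /aW eqxx h1 h2 !orbT; by split.
- have [h1 h2] := Ht 3 i isT oi; rewrite /aH eqxx h1 h2 !orbT; by split.
- have [h1 h2] := Ht 4 i isT oi; rewrite /aH eqxx h1 h2 !orbT; by split.
by rewrite /onside; lia.
Qed.
End Placement.

(** * The structure of an arbitrary representation *)

Theorem solve_spec n (c : 'I_n) (W H P : 'I_n -> nat) (D : nat) :
  (forall i, 0 < W i) -> (forall i, 0 < H i) -> (forall i, i != c -> 0 < P i) ->
  exists rho, [/\ solve (D, (c : nat, (W c, (H c, [seq item_of W H P i | i <- enum 'I_n]))))
                    = assign W H P rho,
      feasible (W c) (H c) (assign W H P rho), rho c = 0, forall i, rho i <= 12 &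
      forall rho', rho' c = 0 -> (forall i, rho' i <= 12) ->
        feasible (W c) (H c) (assign W H P rho') ->
        2 * profit (assign W H P rho') <= 3 * profit (assign W H P rho)].
Proof.
move=> Wpos Hpos Ppos; rewrite /solve /=.
set items := [seq item_of W H P i | i <- enum _].
have E0 : [seq (x, 0) | x <- items] = assign W H P (fun => 0) by rewrite /items -map_comp.
have F0 : feasible (W c) (H c) (assign W H P (fun => 0)).
  apply: feasibleI => [a b ab|s hs|s hs].
  - rewrite (_ : [set _ | _] = set0) ?cards0 //; apply/setP => i; rewrite !inE.
    by move: ab; rewrite !in_cons orbF => /or4P[] /eqP[-> ->].
  - rewrite big_pred0 => [|i]; last by move: hs; rewrite !in_cons orbF => /orP[] /eqP->.
    by rewrite ifF //; apply/negbTE/existsP => -[i]; rewrite !addnS.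
  - rewrite big_pred0 => [|i]; last by move: hs; rewrite !in_cons orbF => /orP[] /eqP->.
    by rewrite ifF //; apply/negbTE/existsP => -[i]; rewrite !addnS.
rewrite E0; have [h1 h2 _ h4] :=
  foldl_better [seq roles c items g | g <- candidates items] F0.
case: h2 => [e|/mapP[GT hGT e]]; last first.
  exists (fun i => role c GT.1 GT.2 (item_of W H P i)).
  rewrite -roles_assign -/items -e; split=> //.
  - by rewrite /role eqxx.
  - by move=> i; apply: role_le12 hGT.
  - move=> rho' r0 r12 rf.
    have [GT' hGT' [f' le']] := good_guess Wpos Hpos Ppos r0 r12 rf.
    apply: leq_trans le' _; rewrite leq_mul2l /=; apply: h4 f'; exact: map_f.
exists (fun => 0); split=> //; rewrite ?e // => rho' r0 r12 rf.
have [GT' hGT' [f' le']] := good_guess Wpos Hpos Ppos r0 r12 rf.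
apply: leq_trans le' _; rewrite leq_mul2l /= -e; apply: h4 f'; exact: map_f.
Qed.

(** * Disjoint intervals along one side *)

Section Packing.
Local Open Scope ring_scope.
Variables (T : realFieldType) (n : nat) (s l : 'I_n -> T).

(** The interval with the largest left end is removed and [be] lowered to that end. The empty set is
    a separate case because [be - al] may then be negative. *)
Lemma packing (A : {set 'I_n}) (al be : T) :
  (forall i, 0 < l i) ->
  (forall i, i \in A -> al <= s i /\ s i + l i <= be) ->
  (forall i j, i \in A -> j \in A -> i != j -> s i + l i <= s j \/ s j + l j <= s i) ->
  A = set0 \/ \sum_(i in A) l i <= be - al.
Proof.
move=> lpos; move: {2}#|A| (leqnn #|A|) => m.
elim: m A be => [|m IH] A be.
  by rewrite leqn0 cards_eq0 => /eqP->; left.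
move=> cA hA dA; have [->|/set0Pn[i0 Ai0]] := eqVneq A set0; first by left.
right; case: (@arg_maxP _ _ _ i0 (fun i => i \in A) s Ai0) => i Ai hmax.
rewrite (big_setD1 i) //=.
have [a1 b1] := hA i Ai.
have [||j|->|h] := IH (A :\ i) (s i).
- by have := cardsD1 i A; rewrite Ai; lia.
- move=> j; rewrite in_setD1 => /andP[ji Aj]; have [a2 b2] := hA j Aj; split=> //.
  have := hmax j Aj; have := lpos j; have := lpos i; rewrite /=.
  by case: (dA i j Ai Aj) => [|h|h]; rewrite 1?eq_sym //; lra.
- by move=> k; rewrite !in_setD1 => /andP[_ Aj] /andP[_ Ak]; exact: dA.
- by rewrite big_set0; lra.
- by lra.
Qed.

(* The boxes of [S] touch one side of the box [c], whose extent along the side is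
   [s c, s c + l c]; those sticking out over an end leave strictly less room. *)
Lemma side_room (c : 'I_n) (S : {set 'I_n}) :
  (forall i, 0 < l i) ->
  (forall i, i \in S -> s i < s c + l c /\ s c < s i + l i) ->
  (forall i j, i \in S -> j \in S -> i != j -> s i + l i <= s j \/ s j + l j <= s i) ->
  let inner := [set i in S | ~~ (s i < s c) && ~~ (s c + l c < s i + l i)] in
  \sum_(i in inner) l i <= l c /\
  ((exists2 i, i \in S & (s i < s c) || (s c + l c < s i + l i)) ->
    \sum_(i in inner) l i < l c).
Proof.
move=> lpos ov dis inner.
have innerP i : i \in inner -> [/\ i \in S, s c <= s i & s i + l i <= s c + l c].
  by rewrite inE -!leNgt => /and3P[].
have din i j : i \in inner -> j \in inner -> i != j -> s i + l i <= s j \/ s j + l j <= s i.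
  by move=> /innerP[Si _ _] /innerP[Sj _ _]; exact: dis.
have lc := lpos c.
split.
  have [|//|->|] := @packing inner (s c) (s c + l c) lpos.
  - by move=> i /innerP[].
  - by rewrite big_set0; lra.
  - by lra.
case=> k Sk; have [k1 k2] := ov k Sk.
have nk i : i \in inner -> (s k < s c) || (s c + l c < s k + l k) -> i != k.
  by move=> /innerP[_ h1 h2] h; apply/eqP => e; move: h1 h2 h; rewrite e; lra.
case lo: (s k < s c) => /= hk.
  have [|//|->|] := @packing inner (s k + l k) (s c + l c) lpos.
  - move=> i Ii; have [Si h1 h2] := innerP i Ii; split=> //.
    have li := lpos i; case: (dis i k Si Sk) => //; first by apply: nk; rewrite ?lo.
    by lra.
  - by rewrite big_set0; lra.
  - by lra.
have [|//|->|] := @packing inner (s c) (s k) lpos.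
- move=> i Ii; have [Si h1 h2] := innerP i Ii; split=> //.
  have li := lpos i; case: (dis i k Si Sk) => //; first by apply: nk; rewrite ?lo.
  by lra.
- by rewrite big_set0; lra.
- by lra.
Qed.
End Packing.

(** * Roles read off an arbitrary representation *)

Section Geometry.
Local Open Scope ring_scope.
Variables (T : realFieldType) (n : nat) (x y w h : 'I_n -> T) (c : 'I_n).
Hypotheses (wpos : forall i, 0 < w i) (hpos : forall i, 0 < h i).
Hypothesis dis : forall i j, i != j ->
  [|| x i + w i <= x j, x j + w j <= x i, y i + h i <= y j | y j + h j <= y i].

Definition overlapX i := (x i < x c + w c) && (x c < x i + w i).
Definition overlapY i := (y i < y c + h c) && (y c < y i + h i).
Definition at_side (s : nat) (i : 'I_n) : bool :=
  match s with
  | 1 => (y c + h c == y i) && overlapX i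
  | 2 => (y i + h i == y c) && overlapX i
  | 3 => (x i + w i == x c) && overlapY i
  | 4 => (x c + w c == x i) && overlapY i
  | _ => false
  end.
Definition sticks_low (s : nat) i := if (s <= 2)%N then x i < x c else y i < y c.
Definition sticks_high (s : nat) i :=
  if (s <= 2)%N then x c + w c < x i + w i else y c + h c < y i + h i.
(** A box sticking out over both ends is counted at the low end. *)
Definition offset (s : nat) i : nat :=
  if sticks_low s i then 4 else if sticks_high s i then 8 else 0.
Definition geo_role (i : 'I_n) : nat :=
  if i == c then 0%N
  else if at_side 1 i then (1 + offset 1 i)%N
  else if at_side 2 i then (2 + offset 2 i)%N
  else if at_side 3 i then (3 + offset 3 i)%N
  else if at_side 4 i then (4 + offset 4 i)%N else 0%N.

Lemma offset_cases s i : offset s i \in [:: 0; 4; 8]%N.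
Proof. by rewrite /offset; case: ifP => //; case: ifP. Qed.

Lemma geo_role_inv i (s o : nat) : (0 < s <= 4)%N -> o \in [:: 0; 4; 8]%N ->
  geo_role i = (s + o)%N -> [/\ i != c, at_side s i & offset s i = o].
Proof.
rewrite /geo_role => hs ho.
have arith (s' o' : nat) : (0 < s' <= 4)%N -> o' \in [:: 0; 4; 8]%N ->
    (s' + o' = s + o)%N -> s' = s /\ o' = o.
  by move: ho; rewrite !inE; lia.
case: (eqVneq i c) => [_|ic]; first by lia.
have fin s' : at_side s' i -> (0 < s' <= 4)%N -> (s' + offset s' i = s + o)%N ->
    [/\ true, at_side s i & offset s i = o].
  by move=> a hs' e; have [es eo] := arith _ _ hs' (offset_cases s' i) e; subst s.
case e1: (at_side 1 i); first exact: fin.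
case e2: (at_side 2 i); first exact: fin.
case e3: (at_side 3 i); first exact: fin.
case e4: (at_side 4 i); first exact: fin.
by lia.
Qed.

Lemma geo_role_c : geo_role c = 0%N.
Proof. by rewrite /geo_role eqxx. Qed.

Lemma geo_role_le12 i : (geo_role i <= 12)%N.
Proof.
have ho s : (offset s i <= 8)%N by have := offset_cases s i; rewrite !inE; lia.
rewrite /geo_role.
by have := (ho 1%N, ho 2%N, ho 3%N, ho 4%N) => -[[[? ?] ?] ?]; do 5 ?case: ifP => _ //; lia.
Qed.

Lemma geo_role_neq0 i s : i != c -> at_side s i -> geo_role i != 0%N.
Proof.
move=> ic; rewrite /geo_role (negbTE ic).
by case: s => [|[|[|[|[|s]]]]] // ->; do 3 ?case: ifP.
Qed.

(** Both boxes touch one line from the same side, so they overlap in the direction across it and can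
    be separated only along it. *)
Lemma side_along s i j : (0 < s <= 4)%N -> at_side s i -> at_side s j -> i != j ->
  if (s <= 2)%N then x i + w i <= x j \/ x j + w j <= x i
  else y i + h i <= y j \/ y j + h j <= y i.
Proof.
move=> hs + + ij; have := dis ij.
have hi := hpos i; have hj := hpos j; have wi := wpos i; have wj := wpos j.
case: s hs => [|[|[|[|[|s]]]]] //= _ /or4P d /andP[/eqP e1 _] /andP[/eqP e2 _];
  by case: d => d; (try by left); (try by right); exfalso; lra.
Qed.

Lemma geo_room s : (0 < s <= 4)%N ->
  let l := if (s <= 2)%N then w else h in
  \sum_(i | geo_role i == s) l i <= l c /\
  ([exists i, (geo_role i == (s + 4)%N) || (geo_role i == (s + 8)%N)] ->
    \sum_(i | geo_role i == s) l i < l c).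
Proof.
move=> hs l; pose st := if (s <= 2)%N then x else y.
pose S := [set i | (i != c) && at_side s i].
have [|||h1 h2] := @side_room T n st l c S.
- by move=> i; rewrite /l; case: ifP.
- move=> i; rewrite inE => /andP[_]; rewrite /st /l.
  by case: (s) hs => [|[|[|[|[|s']]]]] //= _ /andP[_ /andP[]].
- move=> i j; rewrite !inE => /andP[_ Si] /andP[_ Sj] ij.
  by have := side_along hs Si Sj ij; rewrite /st /l; case: ifP.
set inner := [set i in S | _] in h1 h2.
have stick i : (st i < st c) = sticks_low s i by rewrite /st /sticks_low; case: ifP.
have stick' i : (st c + l c < st i + l i) = sticks_high s i.
  by rewrite /st /l /sticks_high; case: ifP.
have sub i : geo_role i == s -> i \in inner.
  move=> /eqP; rewrite -[X in _ = X]addn0 => /geo_role_inv [] // ic ai oi.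
  rewrite !inE ic ai stick stick' /=; move: oi; rewrite /offset.
  by case: ifP => //; case: ifP.
have le : \sum_(i | geo_role i == s) l i <= \sum_(i in inner) l i.
  rewrite [X in _ <= X](bigID (fun i => geo_role i == s)) /=.
  rewrite [X in _ <= X + _](eq_bigl (fun i => geo_role i == s)).
    rewrite ler_wpDr // sumr_ge0 // => i _; rewrite /l; case: ifP => _; exact: ltW.
  by move=> i; case e: (geo_role i == s); rewrite ?andbF // sub.
split; first exact: le_trans le h1.
move=> /existsP[i hi]; apply: le_lt_trans le (h2 _).
have hi' : exists2 o, o \in [:: 4; 8]%N & geo_role i = (s + o)%N.
  by case/orP: hi => /eqP; [exists 4%N | exists 8%N].
case: hi' => o ho e; have [|ic ai oi] := geo_role_inv hs _ e.
  by move: ho; rewrite !inE; lia.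
exists i; first by rewrite inE ic.
rewrite stick stick'; move: oi ho; rewrite /offset.
by case: ifP => //; case: ifP => // _ _ <-.
Qed.

(** Near the corner, a box with either role covers the quadrant opposite to the centre, so two such
    boxes would overlap. *)
Lemma geo_corner a b : (a, b) \in [:: (5, 11); (9, 12); (6, 7); (10, 8)]%N ->
  (#|[set i | (geo_role i == a) || (geo_role i == b)]| <= 1)%N.
Proof.
move=> ab; apply/card_le1_eqP => i j; rewrite !inE => hi hj.
apply/eqP; apply/negPn/negP => ij.
have hi0 := hpos i; have hj0 := hpos j; have wi := wpos i; have wj := wpos j.
have hc := hpos c; have wc := wpos c.
have low s k : (0 < s <= 4)%N -> geo_role k = (s + 4)%N -> at_side s k /\ sticks_low s k.
  move=> hs e; have [//|_ -> oi] := geo_role_inv hs _ e.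
  by split=> //; move: oi; rewrite /offset; case: ifP => //; case: ifP.
have high s k : (0 < s <= 4)%N -> geo_role k = (s + 8)%N -> at_side s k /\ sticks_high s k.
  move=> hs e; have [//|_ -> oi] := geo_role_inv hs _ e.
  by split=> //; move: oi; rewrite /offset; case: ifP => //; case: ifP.
have facts k r : geo_role k = r -> match r with
  | 5%N => y c + h c = y k /\ x k < x c /\ x c < x k + w k
  | 6%N => y k + h k = y c /\ x k < x c /\ x c < x k + w k
  | 7%N => x k + w k = x c /\ y k < y c /\ y c < y k + h k
  | 8%N => x c + w c = x k /\ y k < y c /\ y c < y k + h k
  | 9%N => y c + h c = y k /\ x c + w c < x k + w k /\ x k < x c + w c
  | 10%N => y k + h k = y c /\ x c + w c < x k + w k /\ x k < x c + w c
  | 11%N => x k + w k = x c /\ y c + h c < y k + h k /\ y k < y c + h c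
  | 12%N => x c + w c = x k /\ y c + h c < y k + h k /\ y k < y c + h c
  | _ => True end.
  case: r => [|[|[|[|[|[|[|[|[|[|[|[|[|r]]]]]]]]]]]]] // e.
  - by case: (low 1%N k isT e) => /andP[/eqP e1 /andP[_ e2]] e3.
  - by case: (low 2%N k isT e) => /andP[/eqP e1 /andP[_ e2]] e3.
  - by case: (low 3%N k isT e) => /andP[/eqP e1 /andP[_ e2]] e3.
  - by case: (low 4%N k isT e) => /andP[/eqP e1 /andP[_ e2]] e3.
  - by case: (high 1%N k isT e) => /andP[/eqP e1 /andP[e2 _]] e3.
  - by case: (high 2%N k isT e) => /andP[/eqP e1 /andP[e2 _]] e3.
  - by case: (high 3%N k isT e) => /andP[/eqP e1 /andP[e2 _]] e3.
  - by case: (high 4%N k isT e) => /andP[/eqP e1 /andP[e2 _]] e3.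
have d := dis ij.
move: ab; rewrite !in_cons orbF => /or4P[] /eqP[ea eb]; move: hi hj; rewrite ea eb;
  case/orP=> /eqP/facts [f1 [f2 f3]]; case/orP=> /eqP/facts [f4 [f5 f6]];
  by case/or4P: d => d; lra.
Qed.

End Geometry.

(** * From encoded instances to encoded placements *)

Definition word (l : seq bool) : seq bool :=
  flatten [seq [:: false; b] | b <- l] ++ [:: true; true].

Lemma tokens_words (L : seq (seq bool)) : tokens (flatten [seq word l | l <- L]) = L.
Proof.
have H : forall (l cur : seq bool) ts rest,
    foldl tok_step ((false, false), (cur, ts)) (word l ++ rest) =
    foldl tok_step ((false, false), ([::], rev (rev l ++ cur) :: ts)) rest.
  elim=> [|b l IH] cur ts rest //=.
  by rewrite -[flatten _ ++ _]/(word l) IH rev_cons cat_rcons.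
have H2 : forall L ts, (foldl tok_step ((false, false), ([::], ts))
    (flatten [seq word l | l <- L])).2.2 = rev L ++ ts.
  elim=> [|l L' IH] ts //=; by rewrite H IH cats0 revK rev_cons cat_rcons.
by rewrite /tokens H2 cats0 revK.
Qed.

Definition frac (q : rat) : nat * nat := (`|numq q|, `|denq q|)%N.

(** The sign [[:: false; false]] of a nonnegative number reads as a data bit [false], so the sign
    and the numerator form one token. *)
Lemma enc_ratE q : (0 <= q)%R ->
  enc_rat q = word (false :: bits (frac q).1) ++ word (bits (frac q).2).
Proof.
move=> q0; rewrite /enc_rat /frac /=; have : (0 <= numq q)%R by rewrite numq_ge0.
by case: (numq q) => // m _.
Qed.

Lemma filter_iota m N : m <= N -> [seq k <- iota 0 N | k < m] = iota 0 m.
Proof.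
move=> h; rewrite -(subnKC h) iotaD filter_cat add0n.
rewrite (eq_in_filter (a2 := predT)) ?filter_predT => [|k]; last by rewrite mem_iota.
rewrite (eq_in_filter (a2 := pred0)) ?filter_pred0 ?cats0 // => k.
by rewrite mem_iota => /andP[hk _]; rewrite /= ltnNge hk.
Qed.

Lemma nth_flatten2 (A B : Type) (f g : A -> B) (x0 : B) (a0 : A) (s : seq A) k :
  k < size s ->
  nth x0 (flatten [seq [:: f a; g a] | a <- s]) (k * 2) = f (nth a0 s k) /\
  nth x0 (flatten [seq [:: f a; g a] | a <- s]) (k * 2 + 1) = g (nth a0 s k).
Proof.
elim: s k => [|a s IH] [|k] // hk; have [e1 e2] := IH k hk.
have -> : k.+1 * 2 = (k * 2).+2 by lia.
by rewrite !addSn.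
Qed.

Lemma size_flatten2 (A B : Type) (f g : A -> B) (s : seq A) :
  size (flatten [seq [:: f a; g a] | a <- s]) = size s * 2.
Proof. by elim: s => [|a s IH] //=; rewrite IH. Qed.

Lemma enc_fracE m D : 0 < D -> enc_frac m D = enc_rat (m%:R / D%:R)%R.
Proof.
move=> D0; set g := gcdn m D.
have g0 : 0 < g by rewrite gcdn_gt0 D0 orbT.
have em : m = (m %/ g * g) by rewrite divnK // dvdn_gcdl.
have eD : D = (D %/ g * g) by rewrite divnK // dvdn_gcdr.
have D'0 : 0 < D %/ g by rewrite divn_gt0 // dvdn_leq // dvdn_gcdr.
have co : coprime (m %/ g) (D %/ g).
  rewrite /coprime -(eqn_pmul2r g0) mul1n muln_gcdl -em -eD; exact: eqxx.
have -> : (m%:R / D%:R = (Posz (m %/ g))%:~R / (Posz (D %/ g))%:~R :> rat)%R.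
  rewrite {1}em {1}eD !natrM -!pmulrn -mulf_div divff ?mulr1 //.
  by rewrite pnatr_eq0 -lt0n.
rewrite /enc_rat coprimeq_num //= coprimeq_den //=.
rewrite gtr0_sg ?mul1r ?ltz_nat //.
by rewrite ifF //; lia.
Qed.

Lemma allpairs_map_pair (A B : Type) (f : A -> B) (s t : seq A) :
  [seq (i, j) | i <- [seq f i | i <- s], j <- [seq f i | i <- t]] =
  [seq (f ij.1, f ij.2) | ij <- [seq (i, j) | i <- s, j <- t]].
Proof. by elim: s => [|i s IH] //=; rewrite map_cat IH -!map_comp. Qed.

(** * Decoding an instance *)

Section Instance.
Variables (n : nat) (w h : 'I_n -> rat) (p : 'I_n -> 'I_n -> rat).
Hypothesis valid : valid_instance w h p.
Hypothesis star : star_support p.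

Let E := enum [pred ij : 'I_n * 'I_n | ij.1 < ij.2].
Let Q : seq rat := flatten [seq [:: w i; h i] | i <- enum 'I_n] ++ [seq p ij.1 ij.2 | ij <- E].
Let tokensL : seq (seq bool) := bits n ::
  flatten [seq [:: false :: bits (frac q).1; bits (frac q).2] | q <- Q].
Let fr := [seq frac q | q <- Q].

Lemma listed_ge0 q : q \in Q -> (0 <= q)%R.
Proof.
case: valid => wp hp pp _.
rewrite mem_cat => /orP[/flattenP[s /mapP[i _ ->]]|/mapP[ij _ ->]]; last exact: pp.
by rewrite !inE => /orP[] /eqP ->; exact: ltW.
Qed.

Lemma enc_instanceE : enc_instance w h p = flatten [seq word l | l <- tokensL].
Proof.
rewrite /enc_instance /=; congr (_ ++ _).
have -> : flatten [seq enc_rat (w i) ++ enc_rat (h i) | i <- enum 'I_n]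
   ++ flatten [seq enc_rat (p ij.1 ij.2) | ij <- E] = flatten [seq enc_rat q | q <- Q].
  rewrite /Q map_cat flatten_cat; congr (_ ++ _); last by rewrite -map_comp.
  by elim: (enum 'I_n) => [|i s IH] //=; rewrite IH catA.
have : {subset Q <= Q} by [].
elim: {1 3 4}Q => [|q s IH] sub //=; rewrite enc_ratE ?listed_ge0 ?sub ?mem_head //.
rewrite IH; last by move=> x xs; apply: sub; rewrite in_cons xs orbT.
by rewrite /= catA.
Qed.

Lemma tokens_instance : tokens (enc_instance w h p) = tokensL.
Proof. by rewrite enc_instanceE tokens_words. Qed.

Lemma size_tokensL : size tokensL = (size Q * 2).+1.
Proof. by rewrite /= size_flatten2. Qed.

Lemma size_listed : size Q = n * 2 + size E.
Proof. by rewrite size_cat size_flatten2 size_map -cardE card_ord. Qed.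

Lemma fracs_instance : fracs tokensL = fr.
Proof.
rewrite /fracs.
rewrite (eq_filter (a2 := fun k => k < size Q)); last first.
  by move=> k; rewrite size_tokensL; lia.
rewrite filter_iota; last by rewrite size_tokensL; lia.
apply: (@eq_from_nth _ (0, 0)); first by rewrite !size_map size_iota.
move=> k; rewrite size_map size_iota => hk.
rewrite (nth_map 0) ?size_iota // nth_iota // add0n (nth_map 0%R) //.
have [e1 e2] := @nth_flatten2 _ _ (fun q => false :: bits (frac q).1)
  (fun q => bits (frac q).2) [::] 0%R Q k hk.
rewrite addn1 (_ : k * 2 + 2 = (k * 2 + 1).+1); last by lia.
by rewrite /= e1 e2 /= !unbitsK.
Qed.

Lemma num_boxes_instance : num_boxes tokensL = n.
Proof. exact: unbitsK. Qed.

Lemma indices_instance : indices tokensL = iota 0 n.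
Proof.
rewrite /indices num_boxes_instance filter_iota //.
by rewrite size_tokensL size_listed; lia.
Qed.

Lemma enum_val_iota : iota 0 n = [seq val i | i <- enum 'I_n].
Proof. by rewrite val_enum_ord. Qed.

Lemma pairs_instance : pairs (iota 0 n) = [seq (val ij.1, val ij.2) | ij <- E].
Proof.
rewrite /pairs enum_val_iota.
(* The enumeration of pairs varies the second component fastest, as [pairs] does, so the filtered
   lists agree in order. *)
have -> : E = [seq ij : 'I_n * 'I_n <- [seq (i, j) | i <- enum 'I_n, j <- enum 'I_n] | ij.1 < ij.2].
  by rewrite /E {1}/enum_mem [Finite.enum]unlock /=.
have -> : [seq (i, j) | i <- [seq val i | i <- enum 'I_n], j <- [seq val i | i <- enum 'I_n]]
   = [seq (val ij.1, val ij.2) | ij <- [seq (i, j) | i <- enum 'I_n, j <- enum 'I_n]].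
  exact: allpairs_map_pair.
by rewrite filter_map.
Qed.

Lemma nth_fracs (i : 'I_n) : nth (0, 0) fr (2 * i) = frac (w i) /\
  nth (0, 0) fr (2 * i + 1) = frac (h i).
Proof.
have hi : i < size (enum 'I_n) by rewrite size_enum_ord.
have [e1 e2] := @nth_flatten2 _ _ w h 0%R i (enum 'I_n) i hi.
rewrite nth_ord_enum in e1 e2.
have hsz : i * 2 + 1 < size (flatten [seq [:: w i; h i] | i <- enum 'I_n]).
  by rewrite size_flatten2 size_enum_ord; have := ltn_ord i; lia.
have hQ : i * 2 + 1 < size Q by rewrite size_cat ltn_addr.
have hlt : i * 2 < i * 2 + 1 by rewrite addn1.
have hsz0 := ltn_trans hlt hsz; have hQ0 := ltn_trans hlt hQ.
rewrite mulnC; split.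
- by rewrite (nth_map 0%R) // nth_cat hsz0 e1.
- by rewrite (nth_map 0%R) // nth_cat hsz e2.
Qed.

Lemma pair_profits_instance :
  pair_profits n (iota 0 n) fr =
  [seq ((val ij.1, val ij.2), frac (p ij.1 ij.2)) | ij <- E].
Proof.
rewrite /pair_profits pairs_instance; apply: (@eq_from_nth _ ((0, 0), (0, 0))).
  by rewrite !size_map size_iota.
move=> k; rewrite !size_map size_iota => hk.
rewrite (nth_map 0) ?size_iota ?size_map // nth_iota ?size_map // add0n.
have [ij0 _] : exists ij0, ij0 \in E by case: (E) hk => [|e s] // _; exists e; rewrite mem_head.
rewrite !(nth_map ij0) //; congr pair.
rewrite mulnC /fr (nth_map 0%R) ?size_listed ?ltn_add2l //.
rewrite nth_cat size_flatten2 size_enum_ord ltnNge leq_addr /= addKn.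
by rewrite (nth_map ij0).
Qed.

Let D := unit_den fr.
Let W i := scale D (frac (w i)).
Let H i := scale D (frac (h i)).
Let S i j := scale D (frac (p i j)).

Lemma prodn_dvd (s : seq nat) x : x \in s -> x %| prodn s.
Proof.
have -> : prodn s = \prod_(y <- s) y by rewrite /prodn foldlE big_cons [LHS]mul1n.
by move=> xs; rewrite (big_rem x) //= dvdn_mulr.
Qed.

Lemma prodn_gt0 (s : seq nat) : (forall x, x \in s -> 0 < x) -> 0 < prodn s.
Proof.
have -> : prodn s = \prod_(y <- s) y by rewrite /prodn foldlE big_cons [LHS]mul1n.
by move=> hs; rewrite big_seq; apply: prodn_cond_gt0 => x /hs.
Qed.

Lemma unit_gt0 : 0 < D.
Proof.
rewrite /D /unit_den muln_gt0 /=; apply: prodn_gt0 => x /mapP[r /mapP[q _ ->] ->].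
by rewrite /frac /= absz_gt0 denq_neq0.
Qed.

(** Each denominator divides the product inside [D], so the scaling is exact; the remaining factor 2
    makes the result even. *)
Lemma scaleE q : q \in Q -> ((scale D (frac q))%:R = q * D%:R :> rat)%R /\
  ~~ odd (scale D (frac q)).
Proof.
move=> Qq; have d : (frac q).2 %| prodn [seq r.2 | r <- fr].
  by apply: prodn_dvd; apply: map_f; apply: map_f.
have d0 : 0 < (frac q).2 by rewrite /frac /= absz_gt0 denq_neq0.
rewrite /scale /D /unit_den -muln_divA //; split; last by rewrite oddM oddM /= andbF.
set m := prodn _ in d *; have em : m = m %/ (frac q).2 * (frac q).2 by rewrite divnK.
rewrite {2}em !natrM.
have eq : (((frac q).1)%:R = q * ((frac q).2)%:R :> rat)%R.
  rewrite -{2}[q]divq_num_den /frac /=.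
  have -> : (`|numq q|%:R = (numq q)%:~R :> rat)%R.
    by rewrite natr_absz ger0_norm // numq_ge0 listed_ge0.
  have -> : (`|denq q|%:R = (denq q)%:~R :> rat)%R by rewrite natr_absz gtr0_norm.
  by rewrite divfK // intr_eq0 denq_neq0.
rewrite eq -!mulrA; congr (_ * _)%R; rewrite mulrC -!mulrA; congr (_ * _)%R.
Qed.

Lemma listed_width i : w i \in Q.
Proof.
rewrite mem_cat; apply/orP; left; apply/flattenP; exists [:: w i; h i]; last exact: mem_head.
by apply: map_f; rewrite mem_enum.
Qed.
Lemma listed_height i : h i \in Q.
Proof.
rewrite mem_cat; apply/orP; left; apply/flattenP; exists [:: w i; h i].
  by apply: map_f; rewrite mem_enum.
by rewrite !inE eqxx orbT.
Qed.
Lemma listed_profit i j : i != j -> p i j \in Q.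
Proof.
case: valid => _ _ _ psym ij; rewrite mem_cat; apply/orP; right.
case: (ltngtP i j) => [lt|gt|/val_inj e]; last by rewrite e eqxx in ij.
- by apply/mapP; exists (i, j); rewrite ?mem_enum.
- by apply/mapP; exists (j, i); rewrite ?mem_enum // psym.
Qed.

Let Z := [seq ((val ij.1, val ij.2), frac (p ij.1 ij.2)) | ij <- E].

(** With two boxes both are centres, so the index found may differ from the witness of [star]. It
    suffices that all profit is on pairs containing it and that every other box has positive profit
    with it. *)
Lemma center_instance : exists2 c : 'I_n, center (iota 0 n) Z = c &
  (forall i j, i != j -> i != c -> j != c -> p i j = 0%R) /\
  (forall i, i != c -> (0 < p i c)%R).
Proof.
case: valid => _ _ pge0 psym; case: (star) => cs hcs.
pose ok i := all (fun e : (nat * nat) * (nat * nat) => [|| e.1.1 == i, e.1.2 == i | e.2.1 == 0]) Z.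
have oks : ok cs.
  apply/allP => e /mapP[[i j]]; rewrite mem_enum inE /= => ij -> /=.
  case ei: (val i == cs) => //=; case ej: (val j == cs) => //=.
  have ne : i != j by apply/eqP => e'; rewrite e' ltnn in ij.
  have [h1 _] := hcs i j ne.
  have np : ~~ (0 < p i j)%R by apply/negP => /h1; rewrite -!val_eqE ei ej.
  have : p i j = 0%R by apply/eqP; rewrite eq_le pge0 andbT leNgt.
  by move=> ->.
have : (cs : nat) \in [seq i <- iota 0 n | ok i].
  by rewrite mem_filter oks mem_iota /=.
rewrite /center -/ok; case F: [seq i <- iota 0 n | ok i] => [|k s] // _.
have : k \in [seq i <- iota 0 n | ok i] by rewrite F mem_head.
rewrite mem_filter mem_iota /= add0n => /andP[okk kn].
pose c := Ordinal kn.
have zero i j : i != j -> i != c -> j != c -> p i j = 0%R.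
  have lt_case (i' j' : 'I_n) : i' < j' -> i' != c -> j' != c -> p i' j' = 0%R.
    move=> ij ic jc; have := allP okk ((val i', val j'), frac (p i' j')).
    have ic' : (val i' == k) = false := negbTE ic.
    have jc' : (val j' == k) = false := negbTE jc.
    rewrite /= ic' jc' /= => h0.
    have {}h0 : numq (p i' j') = 0%R.
      apply/eqP; rewrite -absz_eq0; apply: h0.
      by apply/mapP; exists (i', j'); rewrite ?mem_enum.
    by apply/eqP; rewrite -numq_eq0 h0.
  move=> ij ic jc; case: (ltngtP i j) => [lt|gt|/val_inj e]; first exact: lt_case.
    by rewrite psym; exact: lt_case.
  by rewrite e eqxx in ij.
exists c => //; split=> // i ic.
case: (eqVneq i cs) => [e|ics]; first by apply/(hcs i c ic); rewrite e eqxx.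
have pos : (0 < p i cs)%R by apply/(hcs i cs ics); rewrite eqxx orbT.
case: (eqVneq cs c) => [<-//|csc].
by move: pos; rewrite zero // ltxx.
Qed.

Variable c : 'I_n.
Hypotheses (centerE : center (iota 0 n) Z = c)
  (zero : forall i j, i != j -> i != c -> j != c -> p i j = 0%R)
  (ppos : forall i, i != c -> (0 < p i c)%R).

Let P (i : 'I_n) := sumn [seq scale D e.2 | e <- Z & (e.1.1 == i :> nat) || (e.1.2 == i :> nat)].

Lemma leaf_profitE i : i != c -> P i = S i c.
Proof.
case: valid => _ _ _ psym ic.
have S0 i' j' : i' != j' -> i' != c -> j' != c -> S i' j' = 0.
  by move=> h1 h2 h3; rewrite /S zero.
have Ssym i' j' : S i' j' = S j' i' by rewrite /S psym.
rewrite /P sumnE big_map big_filter big_map big_enum_cond /=.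
have zero_other (ij : 'I_n * 'I_n) : ij.1 < ij.2 -> (ij.1 == i) || (ij.2 == i) ->
    ij != (i, c) -> ij != (c, i) -> S ij.1 ij.2 = 0.
  case: ij => a b /= ab hi n1 n2.
  have nab : a != b by apply/eqP => e; rewrite e ltnn in ab.
  case/orP: hi => /eqP e; subst.
  - by apply: S0 => //; apply: contraNneq n1 => ->.
  - by apply: S0 => //; apply: contraNneq n2 => ->.
case: (ltngtP i c) => [lt|gt|/val_inj e]; last by rewrite e eqxx in ic.
- rewrite (bigD1 (i, c)) /=; last by rewrite inE /= lt eqxx.
  rewrite big1 ?addn0 // => ij /andP[/andP[h1 h2] h3]; apply: zero_other => //.
  by apply: contraTneq h1 => ->; rewrite inE /= -leqNgt ltnW.
- rewrite (bigD1 (c, i)) /=; last by rewrite inE /= gt eqxx orbT.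
  rewrite big1 ?addn0 ?[S c i]Ssym // => ij /andP[/andP[h1 h2] h3]; apply: zero_other => //.
  by apply: contraTneq h1 => ->; rewrite inE /= -leqNgt ltnW.
Qed.

Lemma parse_instance : parse_input (enc_instance w h p) =
  (D, (c : nat, (W c, (H c, [seq item_of W H P i | i <- enum 'I_n])))).
Proof.
rewrite /parse_input tokens_instance fracs_instance num_boxes_instance indices_instance.
rewrite pair_profits_instance -/Z centerE.
have [-> ->] := nth_fracs c; rewrite -/D.
congr (_, (_, (_, (_, _)))).
rewrite /mk_items enum_val_iota -map_comp; apply: eq_map => i.
by rewrite /= /item_of /W /H; have [-> ->] := nth_fracs i.
Qed.

Lemma scaled_width_gt0 i : 0 < W i.
Proof.
case: valid => wp _ _ _; have [e _] := scaleE (listed_width i).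
by rewrite -(ltr_nat rat) e mulr_gt0 ?ltr0n ?unit_gt0.
Qed.
Lemma scaled_height_gt0 i : 0 < H i.
Proof.
case: valid => _ hp _ _; have [e _] := scaleE (listed_height i).
by rewrite -(ltr_nat rat) e mulr_gt0 ?ltr0n ?unit_gt0.
Qed.
Lemma leaf_profit_gt0 i : i != c -> 0 < P i.
Proof.
move=> ic; rewrite leaf_profitE //; have [e _] := scaleE (listed_profit ic).
by rewrite -(ltr_nat rat) e mulr_gt0 ?ltr0n ?unit_gt0 ?ppos.
Qed.

Let d : R := (D%:R)%R.

Lemma unitR_gt0 : (0 < d)%R.
Proof. by rewrite ltr0n unit_gt0. Qed.

Lemma ratr_scale q : q \in Q -> (ratr q = (scale D (frac q))%:R / d :> R)%R.
Proof.
move=> Qq; have [e _] := scaleE Qq.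
have -> : (q = (scale D (frac q))%:R / D%:R)%R.
  by rewrite e mulfK // pnatr_eq0 -lt0n unit_gt0.
rewrite fmorph_div /= !ratr_nat.
by rewrite {1}e mulfK // pnatr_eq0 -lt0n unit_gt0.
Qed.

Lemma touch_sym (pos : 'I_n -> R * R) i j : touch w h pos i j = touch w h pos j i.
Proof.
rewrite /touch; set b1 := _ == _; set b2 := _ == _; set b3 := (_ < _)%R; set b4 := (_ < _)%R.
set b5 := _ == _; set b6 := _ == _; set b7 := (_ < _)%R; set b8 := (_ < _)%R.
by rewrite [b2 || b1]orbC [b4 && b3]andbC [b6 || b5]orbC [b8 && b7]andbC.
Qed.

(** The pair of a leaf and the centre is counted in the row of the smaller index; the profits of all
    other pairs vanish. *)
Lemma total_profitE (pos : 'I_n -> R * R) :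
  (total_profit w h p pos = \sum_(i | (i != c) && touch w h pos i c) ratr (p i c))%R.
Proof.
case: valid => _ _ _ psym; rewrite /total_profit.
pose g i j : R := (if touch w h pos i j then ratr (p i j) else 0)%R.
have gsym i j : g i j = g j i by rewrite /g touch_sym psym.
have g0 i j : i != j -> i != c -> j != c -> g i j = 0%R.
  by move=> h1 h2 h3; rewrite /g zero // raddf0 if_same.
under eq_bigr do rewrite big_mkcondr /=.
rewrite (bigD1 c) //= [in RHS]big_mkcondr /= [RHS](bigID (fun i : 'I_n => c < i)) /=.
congr (_ + _)%R.
  apply: eq_big => [i|i _]; last by rewrite -/(g c i) gsym.
  by case: (ltngtP c i) => [lt|//|]; rewrite ?andbT ?andbF // -val_eqE /= gtn_eqF.
rewrite [RHS]big_mkcondr /=; apply: eq_bigr => i ic; rewrite -leqNgt.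
transitivity (if (i < c)%N then g i c else 0%R); last first.
  by rewrite ltn_neqAle (ic : (i : nat) != c).
case: ifP => lt.
  rewrite (bigD1 c) //= -/(g i c) big1 ?addr0 // => j /andP[ij jc].
  by rewrite -/(g i j) g0 //; apply/eqP => e; rewrite e ltnn in ij.
rewrite big1 // => j ij; rewrite -/(g i j) g0 //.
  by apply/eqP => e; rewrite e ltnn in ij.
by apply: contraFneq lt => <-.
Qed.

Let rep (r : 'I_n -> nat) (i : 'I_n) : rat * rat :=
  let q := placed c W H P r i in (q.1%:R / D%:R, q.2%:R / D%:R)%R.

Lemma le_unit (a b : nat) : ((a%:R / d <= b%:R / d :> R) = (a <= b)%N)%R.
Proof. by rewrite ler_pM2r ?invr_gt0 ?unitR_gt0 // ler_nat. Qed.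
Lemma lt_unit (a b : nat) : ((a%:R / d < b%:R / d :> R) = (a < b)%N)%R.
Proof. by rewrite ltr_pM2r ?invr_gt0 ?unitR_gt0 // ltr_nat. Qed.
Lemma eq_unit (a b : nat) : ((a%:R / d == b%:R / d :> R) = (a == b)%N)%R.
Proof. by rewrite eq_le !le_unit eqn_leq. Qed.
Lemma add_unit (a b : nat) : (a%:R / d + b%:R / d = (a + b)%:R / d :> R)%R.
Proof. by rewrite -mulrDl -natrD. Qed.

Lemma ratr_frac (a : nat) : (ratr (a%:R / D%:R) = a%:R / d :> R)%R.
Proof. by rewrite fmorph_div /= !ratr_nat. Qed.

Lemma rep_disjoint r i j :
  interiors_disjoint w h (ratr2 (rep r)) i j = apart c W H P r i j.
Proof.
rewrite /interiors_disjoint /ratr2 /rep /= !ratr_frac.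
rewrite !(ratr_scale (listed_width _)) !(ratr_scale (listed_height _)).
by rewrite !add_unit !le_unit.
Qed.

Lemma rep_touch r i j : touch w h (ratr2 (rep r)) i j = meets c W H P r i j.
Proof.
rewrite /touch /ratr2 /rep /= !ratr_frac.
rewrite !(ratr_scale (listed_width _)) !(ratr_scale (listed_height _)).
by rewrite !add_unit !lt_unit !eq_unit.
Qed.

Lemma profit_ratr r : r c = 0 ->
  ((profit (assign W H P r))%:R / d = \sum_(i | r i != 0%N) ratr (p i c) :> R)%R.
Proof.
move=> rc; rewrite profit_assign natr_sum mulr_suml; apply: eq_bigr => i ri.
have ic : i != c by apply: contraNneq ri => ->; rewrite rc.
by rewrite leaf_profitE // (ratr_scale (listed_profit ic)).
Qed.

(** After scaling both sides are even, so a strict inequality leaves at least 2 units. This is what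
    turns an arbitrarily short real overlap into the integer condition of [side]. *)
Lemma room_nat (r : 'I_n -> nat) (s : nat) (q : 'I_n -> rat) : (forall i, q i \in Q) ->
  (\sum_(i | r i == s) (ratr (q i) : R) <= ratr (q c))%R ->
  ([exists i, (r i == s + 4) || (r i == s + 8)] ->
     (\sum_(i | r i == s) (ratr (q i) : R) < ratr (q c))%R) ->
  \sum_(i | r i == s) scale D (frac (q i)) +
    (if [exists i, (r i == s + 4) || (r i == s + 8)] then 2 else 0) <= scale D (frac (q c)).
Proof.
move=> Qq.
have -> : (\sum_(i | r i == s) (ratr (q i) : R) =
    (\sum_(i | r i == s) scale D (frac (q i)))%:R / d)%R.
  by rewrite natr_sum mulr_suml; apply: eq_bigr => i _; rewrite ratr_scale.
rewrite ratr_scale // le_unit lt_unit; set m := \sum_(i | _) _.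
have em : ~~ odd m.
  rewrite /m; elim/big_ind: _ => // [x y hx hy|i _]; first by rewrite oddD (negbTE hx) (negbTE hy).
  by have [] := scaleE (Qq i).
have [_ ec] := scaleE (Qq c).
by case: ifP => [_ _ /(_ isT)|_ hm _]; lia.
Qed.

Lemma geo_feasible (opt : 'I_n -> R * R) : is_representation w h opt ->
  exists r, [/\ r c = 0, forall i, r i <= 12, feasible (W c) (H c) (assign W H P r) &
    forall i, i != c -> touch w h opt i c -> r i != 0].
Proof.
case: valid => wp hp _ _ rep_opt.
pose x i := (opt i).1; pose y i := (opt i).2.
pose wr i : R := ratr (w i); pose hr i : R := ratr (h i).
have wrp i : (0 < wr i)%R by rewrite /wr ltr0q.
have hrp i : (0 < hr i)%R by rewrite /hr ltr0q.
have dis i j : i != j -> [|| x i + wr i <= x j, x j + wr j <= x i,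
    y i + hr i <= y j | y j + hr j <= y i]%R by exact: rep_opt.
exists (geo_role x y wr hr c); split.
- exact: geo_role_c.
- exact: geo_role_le12.
- apply: feasibleI => [a b ab|s hs|s hs].
  + exact: geo_corner.
  + have hs4 : 0 < s <= 4 by move: hs; rewrite !inE; lia.
    have hs2 : s <= 2 by move: hs; rewrite !inE; lia.
    have /= := geo_room c wrp hrp dis hs4; rewrite hs2 => -[h1 h2].
    exact: (room_nat listed_width h1 h2).
  + have hs4 : 0 < s <= 4 by move: hs; rewrite !inE; lia.
    have hs2 : (s <= 2) = false by move: hs; rewrite !inE; lia.
    have /= := geo_room c wrp hrp dis hs4; rewrite hs2 => -[h1 h2].
    exact: (room_nat listed_height h1 h2).
- move=> i ic; rewrite /touch -/(x i) -/(y i) -/(x c) -/(y c) -/(wr i) -/(wr c) -/(hr i) -/(hr c).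
  have at_s s : at_side x y wr hr c s i -> geo_role x y wr hr c i != 0.
    exact: geo_role_neq0.
  case/orP=> /andP[/orP[] e o].
  + by apply: (at_s 3); rewrite /= e.
  + by apply: (at_s 4); rewrite /= e.
  + by apply: (at_s 2); rewrite /= e.
  + by apply: (at_s 1); rewrite /= e.
Qed.

(** Equivalent to e being at most 3. *)
Lemma one_minus_inv_e_le : (one_minus_inv_e <= 2 / 3 :> R)%R.
Proof.
have e0 : (0 < exp 1 :> R)%R by apply/RltP; exact: exp_pos.
have e3 : (exp 1 <= 3 :> R)%R by apply/RleP; have := exp_le_3; rewrite !RealsE.
have : (3^-1 <= (exp 1)^-1 :> R)%R by rewrite lef_pV2 // posrE ltr0n.
rewrite /one_minus_inv_e; move: (exp 1)^-1%R => t ht.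
have -> : (2 / 3 = 1 - 3^-1 :> R)%R by lra.
by rewrite lerD2l lerN2.
Qed.

Theorem algorithm_correct : exists pos : 'I_n -> rat * rat,
  [/\ algorithm (enc_instance w h p) = enc_placement pos,
      is_representation w h (ratr2 pos) &
      forall opt : 'I_n -> R * R, is_representation w h opt ->
        (one_minus_inv_e * total_profit w h p opt <= total_profit w h p (ratr2 pos))%R].
Proof.
have [r [sol feas rc r12 best]] := solve_spec D scaled_width_gt0 scaled_height_gt0 leaf_profit_gt0.
exists (rep r); split.
- rewrite /algorithm parse_instance /output sol /frame /=.
  have -> : sumn [seq wd x + ht x | x <- [seq item_of W H P i | i <- enum 'I_n]] =
      \sum_i (W i + H i).
    by rewrite sumnE big_map big_map big_enum.
  rewrite /enc_placement /assign -map_comp; congr flatten; apply: eq_map => i.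
  by rewrite /rep [(_, _).1]/= [(_, _).2]/= -!enc_fracE ?unit_gt0.
- move=> i j ij; rewrite rep_disjoint.
  exact: (placed_apart scaled_width_gt0 scaled_height_gt0 rc feas).
move=> opt rep_opt; have [r' [rc' r12' feas' touch']] := geo_feasible rep_opt.
have le := best r' rc' r12' feas'.
have pge0 i : (0 <= ratr (p i c) :> R)%R by case: valid => _ _ pp _; rewrite ler0q.
(* The profit of [opt] is bounded above through the roles that it induces, that of the output below
   through the roles from which it is built. *)
have up : (total_profit w h p opt <= (profit (assign W H P r'))%:R / d)%R.
  rewrite profit_ratr // total_profitE.
  rewrite [X in (_ <= X)%R](bigID (fun i => (i != c) && touch w h opt i c)) /=.
  rewrite [X in (_ <= X + _)%R](eq_bigl (fun i => (i != c) && touch w h opt i c)).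
    by rewrite lerDl sumr_ge0.
  move=> i; case tc: ((i != c) && touch w h opt i c); rewrite ?andbF //.
  by rewrite andbT; case/andP: tc; exact: touch'.
have lo : ((profit (assign W H P r))%:R / d <= total_profit w h p (ratr2 (rep r)))%R.
  rewrite profit_ratr // total_profitE [X in (_ <= X)%R](bigID (fun i => r i != 0)) /=.
  rewrite [X in (_ <= X + _)%R](eq_bigl (fun i => r i != 0)).
    by rewrite lerDl sumr_ge0.
  move=> i; case ri: (r i != 0); rewrite ?andbF //.
  have ic : i != c by apply: contraTneq ri => ->; rewrite rc.
  rewrite ic rep_touch.
  have [|-> _] // := placed_meets scaled_width_gt0 scaled_height_gt0 rc feas ic.
  by rewrite lt0n ri r12.
have t0 : (0 <= total_profit w h p opt)%R by rewrite total_profitE sumr_ge0.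
have le' : (2 / 3 * ((profit (assign W H P r'))%:R / d) <= (profit (assign W H P r))%:R / d)%R.
  have : ((2 * profit (assign W H P r'))%:R / d <= (3 * profit (assign W H P r))%:R / d :> R)%R.
    by rewrite le_unit.
  rewrite !natrM -!mulrA; lra.
apply: le_trans lo; apply: le_trans le'.
apply: le_trans (ler_wpM2r t0 one_minus_inv_e_le) _.
by rewrite ler_pM2l ?divr_gt0 ?ltr0n.
Qed.

End Instance.

Local Open Scope ring_scope.

Theorem theorem5 :
  exists (M : TM) (c k : nat),
    forall (n : nat) (w h : 'I_n -> rat) (p : 'I_n -> 'I_n -> rat),
      valid_instance w h p -> star_support p ->
      exists (t : nat) (pos : 'I_n -> rat * rat),
        [/\ (t <= c * (size (enc_instance w h p)).+1 ^ k)%N,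
            tm_computes_in M (enc_instance w h p) t (enc_placement pos),
            is_representation w h (ratr2 pos) &
            forall opt : 'I_n -> R * R, is_representation w h opt ->
              one_minus_inv_e * total_profit w h p opt
                <= total_profit w h p (ratr2 pos)].
Proof.
have [M [c [k HM]]] := polyfun_TM pf_algorithm.
exists M, c, k => n w h p valid star.
have [b bE [zero ppos]] := center_instance valid star.
have [pos [algE rep best]] := algorithm_correct valid bE zero ppos.
have [t ht comp] := HM (enc_instance w h p).
by exists t, pos; split=> //; rewrite -algE.
Qed.
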